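(* Let $0<\alpha<1$ and let $N_\alpha(t)=N_1(\Lambda(Y_\alpha(t)))$, $t\ge 0$, be the fractional non-homogeneous Poisson process. Then its marginal distributions $$f_x^\alpha(t)=\mathbb{P}\{N_\alpha(t)=x\}=\int_0^\infty \frac{\mathrm{e}^{-\Lambda(u)}\Lambda(u)^x}{x!}\,h_\alpha(t,u)\,\mathrm{d}u,\qquad x=0,1,2,\ldots,$$ satisfy, for $t>0$, the fractional differential-integral equations $$D_t^\alpha f_x^\alpha(t)=\int_0^\infty\lambda(u)\,[-p_x(u)+p_{x-1}(u)]\,h_\alpha(t,u)\,\mathrm{d}u,\qquad x=0,1,2,\ldots,$$ with initial condition $f_x^\alpha(0)=1$ if $x=0$ and $f_x^\alpha(0)=0$ if $x\ge 1$, and $f_{-1}^\alpha(0)\equiv 0$. Here $p_x(u)=\mathrm{e}^{-\Lambda(u)}\Lambda(u)^x/x!$ for $x=0,1,2,\ldots$ and $p_{-1}(u)=0$.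
   Context: The intensity is a function $\lambda:[0,\infty)\to[0,\infty)$, and $\Lambda(t)=\int_0^t\lambda(u)\,\mathrm{d}u$ (assumed finite). $N_1=\{N_1(t),t\ge 0\}$ is a homogeneous Poisson process with intensity $1$. $L_\alpha=\{L_\alpha(t),t\ge 0\}$ is the $\alpha$-stable subordinator with $\mathbb{E}[\exp(-sL_\alpha(t))]=\exp(-ts^\alpha)$, $s\ge 0$. Its inverse is $Y_\alpha(t)=\inf\{u\ge 0: L_\alpha(u)>t\}$, the inverse stable subordinator, taken independent of $N_1$; $Y_\alpha(0)=0$ a.s. For $t>0$, $Y_\alpha(t)$ has density $$h_\alpha(t,x)=\frac{t}{\alpha x^{1+1/\alpha}}\,g_\alpha\!\left(\frac{t}{x^{1/\alpha}}\right),\quad x>0,$$ where $g_\alpha$ is the density of $L_\alpha(1)$. Its Laplace transform in $t$ is $\tilde h_\alpha(s,x)=s^{\alpha-1}\mathrm{e}^{-xs^\alpha}$. $D_t^\alpha$ is the fractional Caputo-Djrbashian derivative $$D_t^\alpha f(t)=\frac{1}{\Gamma(1-\alpha)}\int_0^t\frac{\mathrm{d}f(\tau)}{\mathrm{d}\tau}\frac{\mathrm{d}\tau}{(t-\tau)^\alpha},\quad 0<\alpha<1.$$ *)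

(* Defs.v *)
(* MathComp-Analysis, over an arbitrary real line [R : realType].
   Functions and processes indexed by [0, +oo[ are total on [R]; only their
   values at nonnegative times are constrained or used. *)
From HB Require Import structures.
From mathcomp Require Import all_boot all_order all_algebra.
From mathcomp Require Import all_classical all_reals all_analysis.

Set Implicit Arguments.
Unset Strict Implicit.
Unset Printing Implicit Defensive.

Import Order.TTheory GRing.Theory Num.Theory.
Import numFieldNormedType.Exports.

Local Open Scope classical_set_scope.
Local Open Scope ring_scope.

Section Processes.
Context d (T : measurableType d) (R : realType) (P : probability T R).

(* Mutual independence of X(t_1) - X(t_0), ..., X(t_n) - X(t_(n-1)) for all
   0 <= t_0 <= ... <= t_n; subfamilies are covered by taking [B i = setT]. *)
Definition independent_increments (X : R -> T -> R) : Prop :=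
  forall (n : nat) (t : nat -> R) (B : nat -> set R),
    0 <= t 0%N -> {homo t : i j / (i <= j)%N >-> i <= j} ->
    (forall i, measurable (B i)) ->
    P (\bigcap_(i in `I_n) [set w | B i (X (t i.+1) w - X (t i) w)]) =
    (\prod_(i < n) P [set w | B i (X (t i.+1) w - X (t i) w)%R])%E.

Definition stationary_increments (X : R -> T -> R) : Prop :=
  forall (s t : R) (B : set R), 0 <= s -> 0 <= t -> measurable B ->
    P [set w | B (X (s + t) w - X s w)] = P [set w | B (X t w)].

(* Nondecreasing paths have left limits, so such paths are cadlag. *)
Definition nondecreasing_cadlag (X : R -> T -> R) : Prop :=
  forall w,
    (forall s t, 0 <= s -> s <= t -> X s w <= X t w) /\
    (forall t, 0 <= t -> X s w @[s --> t^'+] --> X t w).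

(* Unlike the library's [poisson_pmf], which returns 1 at rate 0 for every k,
   this is the Poisson mass function for every m >= 0. *)
Definition poisson_mass (m : R) (k : nat) : R :=
  expR (- m) * m ^+ k / k`!%:R.

Definition poisson_process (rate : R) (N : R -> {RV P >-> nat}) : Prop :=
  [/\ {ae P, forall w, N 0 w = 0%N},
      nondecreasing_cadlag (fun t w => (N t w)%:R),
      independent_increments (fun t w => (N t w)%:R) &
      forall (s t : R) (k : nat), 0 <= s -> s <= t ->
        P [set w | N t w = (N s w + k)%N] =
        (poisson_mass (rate * (t - s)) k)%:E].

Definition subordinator (L : R -> {RV P >-> R}) : Prop :=
  [/\ {ae P, forall w, L 0 w = 0},
      nondecreasing_cadlag (fun t w => L t w),
      independent_increments (fun t w => L t w) &
      stationary_increments (fun t w => L t w)].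

Definition stable_subordinator (alpha : R) (L : R -> {RV P >-> R}) : Prop :=
  subordinator L /\
  forall s t : R, 0 <= s -> 0 <= t ->
    ('E_P[fun w => expR (- (s * L t w))] = (expR (- (t * s `^ alpha)))%:E)%E.

(* The set is empty only on the null event where the path L(.) w is bounded
   by t; the real infimum is then 0. *)
Definition first_passage (L : R -> T -> R) (t : R) (w : T) : R :=
  inf [set u | 0 <= u /\ t < L u w].

Definition process_sigma_algebra d' (T' : measurableType d')
    (X : R -> T -> T') : set (set T) :=
  <<s \bigcup_(t in `[0, +oo[) preimage_set_system setT (X t) measurable >>.

Definition independent_processes d1 (T1 : measurableType d1)
    d2 (T2 : measurableType d2) (X : R -> T -> T1) (Y : R -> T -> T2) : Prop :=
  forall A B, process_sigma_algebra X A -> process_sigma_algebra Y B ->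
    P (A `&` B) = (P A * P B)%E.

Definition is_density (X : {RV P >-> R}) (g : R -> R) : Prop :=
  [/\ measurable_fun setT g,
      forall x, 0 <= g x &
      forall B, measurable B ->
        distribution P X B = (\int[lebesgue_measure]_(x in B) (g x)%:E)%E].

Definition time_changed (N : R -> T -> nat) (Lambda : R -> R)
    (Y : R -> T -> R) (t : R) (w : T) : nat := N (Lambda (Y t w)) w.

(* Indexed by integers so that the index -1 makes sense. *)
Definition marginal (X : R -> T -> nat) (x : int) (t : R) : R :=
  fine (P [set w | (X t w)%:Z = x]).

End Processes.

Section Analysis.
Context (R : realType).
Local Notation mu := (@lebesgue_measure R).

Definition cumulative_intensity (lambda : R -> R) (t : R) : R :=
  \int[mu]_(u in `[0, t]) lambda u.

Definition poisson_at (Lambda : R -> R) (x : int) (u : R) : R :=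
  if x is Posz k then poisson_mass (Lambda u) k else 0.

(* [g] stands for the density of L(1). *)
Definition inverse_stable_density (alpha : R) (g : R -> R) (t x : R) : R :=
  t / (alpha * x `^ (1 + alpha^-1)) * g (t / x `^ alpha^-1).

Definition Gamma (z : R) : R :=
  \int[mu]_(x in `]0, +oo[) (x `^ (z - 1) * expR (- x)).

Definition caputo_integrand (alpha : R) (f : R -> R) (t tau : R) : R :=
  derive1 f tau / (t - tau) `^ alpha.

(* [caputo] is meaningful only under [caputo_derivable]: derivatives and
   integrals are total operations here. *)
Definition caputo_derivable (alpha : R) (f : R -> R) (t : R) : Prop :=
  (forall tau, 0 < tau -> tau < t -> derivable f tau 1) /\
  mu.-integrable `]0, t[ (EFin \o caputo_integrand alpha f t).

Definition caputo (alpha : R) (f : R -> R) (t : R) : R :=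
  (Gamma (1 - alpha))^-1 *
  \int[mu]_(tau in `]0, t[) caputo_integrand alpha f t tau.

End Analysis.

(* Main.v *)
Require Import Defs.
From HB Require Import structures.
From mathcomp Require Import all_boot all_order all_algebra.
From mathcomp Require Import all_classical all_reals all_analysis.
From mathcomp Require Import measurable_realfun lra ring.

Set Implicit Arguments.
Unset Strict Implicit.
Unset Printing Implicit Defensive.

Import Order.TTheory GRing.Theory Num.Theory.
Import numFieldNormedType.Exports.

Local Open Scope classical_set_scope.
Local Open Scope ring_scope.

(** Let J_q(t) be the integral over v > 0 of q(v) P(Y(t) > v). The proof expresses every
    marginal through such functions and computes the Caputo derivative of J_q.

    Since L is nondecreasing, {Y(t) > v} and {L(v) <= t} differ by a null set, and by
    self-similarity P(L(v) <= t) = F(t v^(-1/alpha)) with F the distribution function of L(1).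
    Differentiating in v, Y(t) has density h(t, .) (ge0_integral_first_passage). Conditioning on
    the independent time Lambda(Y(t)), approximated from the right by grid-valued times, gives
    f_x(t) = E p_x(Y(t)) (integral_poisson_mass_at_time, time_changed_prob).

    The Poisson distribution functions Q_x = p_0 + ... + p_x satisfy Q_x' = - lambda p_x in the
    integrated sense, because (d/dm) (Poisson distribution function at x) = - (mass at x) and
    because Lambda carries the measure lambda(u) du to Lebesgue measure even when lambda is
    merely integrable (ge0_integral_time_change). Integration by parts against h(t, .), in the
    form of Tonelli on a triangle, yields E Q_x(Y(t)) = 1 - J_(lambda p_x)(t), so that
    f_x = [x = 0] + J_(lambda p_(x-1)) - J_(lambda p_x) (marginal_mixed_cdf).

    It remains to show D_t^alpha J_q(t) = integral of q(v) h(t, v) dv, and for this the density g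
    of L(1) must be understood. Minus the derivative of the Laplace transform e^(-s^alpha) is
    alpha s^(alpha-1) e^(-s^alpha), that is,
      x g(x) = alpha / Gamma(1 - alpha) * (y^(-alpha) convolved with g)(x)   almost everywhere.
    After the scaling tau = v^(1/alpha) y this identity says that the fractional integral of
    order 1 - alpha of (d/dtau) F(tau v^(-1/alpha)) at t is exactly h(t, v); integrating against q and
    using Tonelli is all that is needed (frac_integral_slope, frac_integral_mixed_cdf).

    Differentiability of J_q at every t > 0 requires more than an almost everywhere statement:
    F must be C^1 with x F'(x) bounded, to differentiate under the integral sign. Up to
    the sign (-1)^m, the m-th derivative of e^(-s^alpha) is a sum of terms c s^(-a) e^(-s^alpha) with
    c >= 0 and a >= m (1 - alpha),
    so x^m g is almost everywhere a positive combination of convolutions of g with y^(a-1). When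
    m (1 - alpha) > 1 all these kernels are continuous and the combination, divided by x^m, is
    a continuous version rho of g, with the required bounds at 0 and at infinity
    (stable_density_regular). The identification of these densities, and of the law of L(v)
    with that of v^(1/alpha) L(1), rests on uniqueness of Laplace transforms (laplace_unique). *)

(** * Images of weighted measures *)

Section weighted_image.
Local Open Scope ereal_scope.
Context d d' (T : measurableType d) (T' : measurableType d') (R : realType).
Variables (mu : {measure set T -> \bar R}) (D : set T) (W : T -> \bar R) (X : T -> T').

(** The push-forward under X of the restriction to D of the measure with density W. Changes of
    variables, measures with a density and laws of random variables are all of this form. *)
Definition weighted_image (A : set T') : \bar R :=
  \int[mu]_(x in D `&` X @^-1` A) W x.

Hypotheses (mD : measurable D) (mW : measurable_fun D (W : T -> \bar R))
  (W0 : forall x, D x -> 0 <= W x) (mX : measurable_fun D X).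

Let wi0 : weighted_image set0 = 0.
Proof. by rewrite /weighted_image preimage_set0 setI0 integral_set0. Qed.

Let wi_ge0 A : 0 <= weighted_image A.
Proof. by apply: integral_ge0 => x [/W0]. Qed.

Let wi_sigma_additive : semi_sigma_additive weighted_image.
Proof.
move=> F mF tF mUF; rewrite /weighted_image preimage_bigcup setI_bigcupr.
have mDF i : measurable (D `&` X @^-1` F i) by exact: mX.
rewrite ge0_integral_bigcup//.
- apply: is_cvg_ereal_nneg_natsum => n _; exact: wi_ge0.
- apply: measurable_funS mW => //; by apply: bigcup_sub => i _ x [].
- by move=> x [i _ [/W0]].
- apply/trivIsetP => /= i j _ _ ij; rewrite setIACA setIid -preimage_setI.
  by move/trivIsetP : tF => /(_ _ _ _ _ ij) ->//; rewrite preimage_set0 setI0.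
Qed.

HB.instance Definition _ := isMeasure.Build _ _ _
  weighted_image wi0 wi_ge0 wi_sigma_additive.

Definition weighted_image_measure : {measure set T' -> \bar R} := weighted_image.

Lemma weighted_image_measureE A :
  weighted_image_measure A = \int[mu]_(x in D `&` X @^-1` A) W x.
Proof. by []. Qed.

Import HBNNSimple.

Let mkX (k : T' -> \bar R) :
  measurable_fun setT k -> measurable_fun D (k \o X).
Proof. by move=> mk; apply: measurableT_comp. Qed.

(** Both sides are linear and commute with increasing limits in k, so that the case of an
    indicator, which is the definition, suffices. The limit needs care where W is infinite. *)
Lemma ge0_integral_weighted_image (k : T' -> \bar R) :
  measurable_fun setT k -> (forall y, 0 <= k y) ->
  \int[weighted_image_measure]_y k y = \int[mu]_(x in D) (W x * k (X x)).
Proof.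
move=> mk k0; pose k_ := nnsfun_approx measurableT mk.
have kX : forall x, (k_ n x)%:E @[n --> \oo] --> k x.
  by move=> x; exact: cvg_nnsfun_approx.
have ndk x a b : (a <= b)%N -> (k_ a x <= k_ b x)%R.
  by move=> ab; exact/lefP/nd_nnsfun_approx.
have mkn n : measurable_fun setT (fun x => (k_ n x)%:E) by exact/measurable_EFinP.
transitivity (limn (fun n => \int[weighted_image_measure]_y (k_ n y)%:E)).
  rewrite -monotone_convergence//.
  - by apply: eq_integral => y _; apply/esym/cvg_lim.
  - by move=> n y _; rewrite lee_fin.
  - by move=> y _ a b ab; rewrite lee_fin ndk.
transitivity (limn (fun n => \int[mu]_(x in D) (W x * (k_ n (X x))%:E))); last first.
  rewrite -monotone_convergence//.
  - apply: eq_integral => x /[!inE] Dx; apply/cvg_lim => //.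
    have [->|Wx0] := eqVneq (W x) 0.
      by rewrite mul0e; under eq_fun do rewrite mul0e; exact: cvg_cst.
    have := kX (X x).
    have := W0 Dx; case: (W x) Wx0 => [r||]//.
      by move=> r0 _ H; exact: (cvgeZl _ H).
    move=> _ _ H.
    have [k00|k00] := eqVneq (k (X x)) 0.
      rewrite k00 mule0.
      have kn0 n : (k_ n (X x))%:E = 0.
        apply/eqP; rewrite eq_le [in X in _ && X]lee_fin fun_ge0 andbT.
        rewrite -[leRHS]k00 -(cvg_lim _ H)//; apply: lime_ge.
          by apply/cvg_ex; eexists; exact: H.
        by exists n => // m /= nm; rewrite lee_fin ndk.
      by under eq_fun do rewrite kn0 mule0; exact: cvg_cst.
    have kpos : 0 < k (X x) by rewrite lt0e k00 k0.
    rewrite gt0_mulye//; apply: cvg_near_cst.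
    have : \forall n \near \oo, 0 < (k_ n (X x))%:E.
      exact: (H _ (open_ereal_gt' kpos)).
    by apply: filterS => n kn; rewrite gt0_mulye.
  - by move=> n; apply: emeasurable_funM => //; exact: (mkX (mkn n)).
  - by move=> n x Dx; rewrite mule_ge0// ?W0// lee_fin.
  - by move=> x Dx a b ab; rewrite lee_wpmul2l ?W0// lee_fin ndk.
congr (limn _); apply/funext => n.
under eq_integral do rewrite fimfunE -fsumEFin//.
rewrite ge0_integral_fsum//; last 2 first.
- by move=> r; exact/measurable_EFinP/measurable_funM.
- by move=> r y _; rewrite nnfun_muleindic_ge0.
transitivity (\int[mu]_(x in D) \sum_(r \in range (k_ n))
    (W x * (r * \1_(k_ n @^-1` [set r]) (X x))%:E)); last first.
  apply: eq_integral => x /[!inE] Dx.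
  rewrite -ge0_mule_fsumr; last by move=> r; rewrite nnfun_muleindic_ge0.
  by rewrite fsumEFin// -fimfunE.
rewrite ge0_integral_fsum//; last 2 first.
- move=> r; apply: emeasurable_funM => //.
  apply: (@mkX (fun y => (r * \1_(k_ n @^-1` [set r]) y)%:E)).
  exact/measurable_EFinP/measurable_funM.
- by move=> r x Dx; rewrite mule_ge0 ?W0// nnfun_muleindic_ge0.
apply: eq_fsbigr => r _.
have [r0|r0] := leP 0%R r; last first.
  rewrite !integral0_eq//.
  - by move=> x Dx; rewrite preimage_nnfun0// indic0 mulr0 mule0.
  - by move=> x Dx; rewrite preimage_nnfun0// indic0 mulr0.
under eq_integral do rewrite EFinM.
rewrite ge0_integralZl//; last exact/measurable_EFinP.
under [RHS]eq_integral do rewrite EFinM muleCA.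
rewrite [RHS]ge0_integralZl//; last 2 first.
- apply: emeasurable_funM => //.
  by apply: (@mkX (fun y => (\1_(k_ n @^-1` [set r]) y)%:E)) => //; exact/measurable_EFinP.
- by move=> x Dx; rewrite mule_ge0 ?W0// lee_fin.
congr (_ * _); rewrite integral_indic// setIT /= /weighted_image integral_mkcondr.
apply: eq_integral => x /[!inE] Dx; rewrite patchE /= indicE.
have -> : (x \in X @^-1` (k_ n @^-1` [set r])) = (X x \in k_ n @^-1` [set r]).
  by apply/idP/idP; rewrite !inE.
by case: ifPn => xA; rewrite ?mule1 ?mule0.
Qed.

End weighted_image.

(** * Uniqueness of Laplace transforms *)

Section measure_uniqueness.
Local Open Scope ereal_scope.
Context (R : realType).
Implicit Types m : {measure set (measurableTypeR R) -> \bar R}.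

(** Left rays form a pi-system that generates the Borel sets. *)
Lemma measure_unique_ray m1 m2 :
  (forall a, m1 `]-oo, a[%classic = m2 `]-oo, a[%classic) ->
  (forall a, m1 `]-oo, a[%classic < +oo) ->
  forall A, measurable A -> m1 A = m2 A.
Proof.
move=> m12 m1oo A mA.
pose g (k : nat) := `]-oo, k%:R[%classic : set (measurableTypeR R).
have Gm : @RGenInftyO.G R `<=` (@measurable _ (measurableTypeR R)).
  by move=> B [x ->]; exact: measurable_itv.
have sA : <<s @RGenInftyO.G R >> A.
  by have -> : <<s @RGenInftyO.G R >> = (@ocitv R).-sigma.-measurable by rewrite RGenInftyO.measurableE.
apply: (@g_sigma_algebra_measure_unique _ R (measurableTypeR R) _ Gm g _ _ m1 m2 _ _ _ A sA) => //.
- by move=> k; exists k%:R.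
- apply/seteqP; split => // x _; exists (Num.trunc x).+1 => //.
  by rewrite /g /= in_itv/= truncnS_gt.
- move=> B C [x ->] [y ->]; exists (Num.min x y).
  apply/seteqP; split => z /=; rewrite !in_itv/= lt_min.
    by move=> [-> ->].
  by move=> /andP[-> ->].
- by move=> B [x ->].
- by move=> k; exact: m1oo.
Qed.

(** A Laplace transform at integer points gives the integrals of the powers of w = e^(-n x), and
    this is 1 - exp(- c w) for c = e^(n a) / n, a power series in w. *)
Definition bump n (a x : R) : R := (1 - expR (- (expR (n%:R * a) / n%:R * expR (- (n%:R * x)))))%R.

(** The exponent is e^(n (a - x)) / n, which tends to infinity for x < a and to 0 for a <= x. *)
Lemma cvg_bump (a x : R) : (bump n a x)%:E @[n --> \oo] --> (\1_(`]-oo, a[) x : R)%:E.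
Proof.
have bumpE n : bump n a x = (1 - expR (- (n%:R^-1 * expR (n%:R * (a - x)))))%R.
  by rewrite /bump mulrAC -expRD mulrC -mulrBr.
apply: cvg_EFin; first exact: nearW.
rewrite (_ : fine \o _ = fun n => (1 - expR (- (n%:R^-1 * expR (n%:R * (a - x)))))%R); last first.
  by apply/funext => n /=; rewrite bumpE.
rewrite indicE; have [xa|ax] := ltP x a.
- rewrite mem_set ?in_itv//= -[X in _ --> X]subr0.
  apply: (@cvgB _ R^o); first exact: cvg_cst.
  have H A : \forall n \near \oo, (A <= n%:R * ((a - x) ^+ 2 / 2))%R.
    near=> n; rewrite -ler_pdivrMr; last by rewrite divr_gt0// exprn_gt0// subr_gt0.
    by near: n; exact: nbhs_infty_ger.
  have K : (n%:R^-1 * expR (n%:R * (a - x)))%R @[n --> \oo] --> +oo%R.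
    apply/cvgryPge => A; near=> n.
    have n0 : (0 < n%:R :> R)%R by rewrite ltr0n; near: n; exists 1%N.
    rewrite mulrC ler_pdivlMr//.
    apply: (le_trans _ (@expR_ge1Dxn R (n%:R * (a - x)) 1 _)); last first.
      by rewrite mulr_ge0// ?ltW// subr_gt0.
    have : (A <= n%:R * ((a - x) ^+ 2 / 2))%R by near: n; exact: H.
    move=> /(ler_wpM2r (ltW n0)) /le_trans; apply.
    rewrite exprMn (_ : (2`! = 2)%N)//.
    have -> : (n%:R * ((a - x) ^+ 2 / 2) * n%:R = n%:R ^+ 2 * (a - x) ^+ 2 / 2 :> R)%R.
      by field.
    by rewrite lerDr.
  exact: (@cvg_comp _ _ _ _ (fun x => expR (- x)%R) _ _ _ K (@cvgr_expR R)).
- rewrite memNset ?in_itv/=; last by rewrite in_itv/= ltNge ax.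
  rewrite -[X in _ --> X](subrr 1%R).
  apply: (@cvgB _ R^o); first exact: cvg_cst.
  rewrite -[X in _ --> X](@expR0 R); apply: continuous_cvg; first exact: continuous_expR.
  rewrite -oppr0; apply: cvgN.
  apply: (@squeeze_cvgr _ _ _ _ (cst 0%R) (fun n => n%:R^-1%R)).
  + near=> n; rewrite /= mulr_ge0 ?invr_ge0// ?expR_ge0//=.
    rewrite ler_piMr ?invr_ge0// expR_le1.
    by rewrite mulr_ge0_le0// subr_le0.
  + exact: cvg_cst.
  + by apply/gtr0_cvgV0; [near=> n; rewrite ltr0n; near: n; exists 1%N|exact: cvgr_idn].
Unshelve. all: by end_near. Qed.

End measure_uniqueness.

Section laplace_uniqueness.
Local Open Scope ereal_scope.
Context (R : realType).
Implicit Types m : {measure set (measurableTypeR R) -> \bar R}.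

Let lap m n := \int[m]_x (expR (- (n%:R * x)))%:E.

Let meas_exp n : measurable_fun setT (fun x : measurableTypeR R => expR (- (n%:R * x))).
Proof.
apply: measurableT_comp => //; apply: measurableT_comp => //.
Qed.

Let partial c n N (x : measurableTypeR R) : R :=
  series (exp_coeff (- (c * expR (- (n%:R * x))))%R) N.

Section one_measure.
Variable m : {measure set (measurableTypeR R) -> \bar R}.
Hypotheses (moo : m setT < +oo) (m0 : m `]-oo, 0%R[%classic = 0).

Let ae_ge0 : {ae m, forall x : measurableTypeR R, (0 <= x)%R}.
Proof.
exists `]-oo, 0%R[%classic; split; [exact: measurable_itv|exact: m0|].
by move=> x /= /negP; rewrite -ltNge in_itv.
Qed.

Let int_cst k : m.-integrable setT (cst k%:E).
Proof.
apply/integrableP; split => //; rewrite integral_cst//= .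
by apply: lte_mul_pinfty => //; rewrite lee_fin.
Qed.

Let int_exp n : m.-integrable setT (fun x => (expR (- (n%:R * x)))%:E).
Proof.
apply/integrableP; split; first by apply/measurable_EFinP; exact: meas_exp.
apply: (@le_lt_trans _ _ (\int[m]_x (cst 1 x))); last first.
  by rewrite integral_cst// mul1e.
apply: ae_ge0_le_integral => //.
- by apply: measurableT_comp => //; by apply/measurable_EFinP; exact: meas_exp.
- apply: filterS ae_ge0 => x x0 _ /=.
  by rewrite lee_fin ger0_norm ?expR_ge0// expR_le1 oppr_le0 mulr_ge0.
Qed.

Let partialS c n N x : partial c n N.+1 x =
  (partial c n N x + (- c) ^+ N / N`!%:R * expR (- ((N * n)%:R * x)))%R.
Proof.
rewrite /partial /series /= big_nat_recr//= /exp_coeff /=; congr (_ + _)%R.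
rewrite -mulNr exprMn -expRM_natl mulrAC; congr (_ * expR _)%R.
by rewrite mulrN mulrA natrM.
Qed.

Let int_partial c n N : m.-integrable setT (EFin \o partial c n N).
Proof.
elim: N => [|N ih].
  apply: (eq_integrable _ (cst 0)) => //; last exact: integrable0.
  by move=> x _; rewrite /= /partial /series /= big_geq.
apply: (eq_integrable _ ((EFin \o partial c n N) \+
   (fun x => ((- c) ^+ N / N`!%:R)%:E * (expR (- ((N * n)%:R * x)))%:E))) => //.
  by move=> x _; rewrite /= partialS.
by apply: integrableD => //; exact: integrableZl.
Qed.

Lemma integral_partialS c n N :
  \int[m]_x (partial c n N.+1 x)%:E = \int[m]_x (partial c n N x)%:E +
   ((- c) ^+ N / N`!%:R)%:E * lap m (N * n).
Proof.
under eq_integral do rewrite partialS EFinD EFinM.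
rewrite integralD//; [|exact: int_partial|exact: integrableZl].
by rewrite integralZl.
Qed.

(** On x >= 0 the partial sums of exp(- c e^(-n x)) are dominated by e^c. *)
Lemma cvg_integral_partial c n : (0 <= c)%R ->
  \int[m]_x (partial c n N x)%:E @[N --> \oo] -->
  \int[m]_x (expR (- (c * expR (- (n%:R * x)))))%:E.
Proof.
move=> c0.
have mf N : measurable_fun setT (fun x => (partial c n N x)%:E).
  exact: (measurable_int m (int_partial c n N)).
have [] := @dominated_convergence _ _ _ m setT measurableT
  (fun N x => (partial c n N x)%:E)
  (fun x => (expR (- (c * expR (- (n%:R * x)))))%:E) (cst (expR c)%:E) => //.
- apply/measurable_EFinP; apply: measurableT_comp => //; apply: measurableT_comp => //.
  by apply: measurable_funM => //; exact: meas_exp.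
- apply: aeW => x _; apply: cvg_EFin; first exact: nearW.
  exact: is_cvg_series_exp_coeff.
- apply: filterS ae_ge0 => x x0 N _; rewrite /= lee_fin.
  have cx : (`|- (c * expR (- (n%:R * x)))| <= c)%R.
    rewrite normrN ger0_norm ?mulr_ge0// ?expR_ge0// ler_piMr//.
    by rewrite expR_le1 oppr_le0 mulr_ge0.
  apply: (le_trans (ler_norm_sum _ _ _)).
  apply: (@le_trans _ _ (series (exp_coeff c) N)).
    apply: ler_sum_nat => i _; rewrite /exp_coeff /= normrM normrX.
    rewrite [X in (_ * X)%R]ger0_norm ?invr_ge0// ler_wpM2r ?invr_ge0//.
    exact: lerXn2r.
  apply: nondecreasing_cvgn_le; last exact: is_cvg_series_exp_coeff.
  apply: nondecreasing_series => i _ _; rewrite /exp_coeff /=.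
  by rewrite divr_ge0// exprn_ge0.
Qed.

Lemma cvg_integral_bump a :
  \int[m]_x (bump n a x)%:E @[n --> \oo] --> m `]-oo, a[%classic.
Proof.
rewrite (_ : m `]-oo, a[%classic = \int[m]_x (\1_(`]-oo, a[) x : R)%:E); last first.
  by rewrite integral_indic//= setIT.
have [] := @dominated_convergence _ _ _ m setT measurableT
  (fun n x => (bump n a x)%:E)
  (fun x => (\1_(`]-oo, a[) x : R)%:E) (cst 1) => //.
- move=> n; apply/measurable_EFinP; apply: measurable_funB => //.
  apply: measurableT_comp => //; apply: measurableT_comp => //.
  by apply: measurable_funM => //; exact: meas_exp.
- by apply/measurable_EFinP.
- by apply: aeW => x _; exact: cvg_bump.
- apply: aeW => x n _; rewrite /= lee_fin /bump.
  set z := expR (- _); have z0 : (0 <= z)%R by exact: expR_ge0.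
  have z1 : (z <= 1)%R.
    by rewrite expR_le1 oppr_le0 mulr_ge0 ?divr_ge0 ?expR_ge0.
  by rewrite ger0_norm ?subr_ge0// lerBlDr lerDl.
Qed.

Lemma integral_bump n a : let c := (expR (n%:R * a) / n%:R)%R in
  \int[m]_x (bump n a x)%:E = lap m 0 -
  \int[m]_x (expR (- (c * expR (- (n%:R * x)))))%:E.
Proof.
move=> c; have c0 : (0 <= c)%R by rewrite divr_ge0 ?expR_ge0.
under eq_integral do rewrite /bump EFinB.
have iexp : m.-integrable setT (fun x => (expR (- (c * expR (- (n%:R * x)))))%:E).
  apply: (@le_integrable _ _ _ _ _ _ _ (cst 1)) => //.
  - apply/measurable_EFinP; apply: measurableT_comp => //; apply: measurableT_comp => //.
    by apply: measurable_funM => //; exact: meas_exp.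
  - move=> x _; rewrite /= lee_fin normr1 ger0_norm ?expR_ge0// expR_le1.
    by rewrite oppr_le0 mulr_ge0 ?expR_ge0.
rewrite integralB//; last exact: int_cst.
by congr (_ - _); apply: eq_integral => x _; rewrite mul0r oppr0 expR0.
Qed.

End one_measure.

(** Polynomials in e^(-n x) have equal integrals, hence by the exponential series so do the
    functions [bump n a], and these converge boundedly to the indicator of ]-oo, a[. *)
Lemma laplace_unique m1 m2 :
  m1 setT < +oo -> m2 setT < +oo ->
  m1 `]-oo, 0%R[%classic = 0 -> m2 `]-oo, 0%R[%classic = 0 ->
  (forall n : nat, \int[m1]_x (expR (- (n%:R * x)))%:E =
                   \int[m2]_x (expR (- (n%:R * x)))%:E) ->
  forall A, measurable A -> m1 A = m2 A.
Proof.
move=> m1oo m2oo m10 m20 lap12.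
apply: measure_unique_ray => a; last first.
  by apply: le_lt_trans m1oo; apply: le_measure; rewrite ?inE//; exact: measurable_itv.
have c1 := cvg_integral_bump m1oo (a := a); have := cvg_integral_bump m2oo (a := a).
rewrite (_ : (fun n => _) = (fun n => \int[m1]_x (bump n a x)%:E)).
  by move=> /(cvg_unique _ c1) -> //.
apply/funext => n; rewrite !integral_bump// /lap lap12; congr (_ - _).
set c := (_ / _)%R; have c0 : (0 <= c)%R by rewrite divr_ge0 ?expR_ge0.
have d1 := cvg_integral_partial m1oo m10 (n := n) c0.
have := cvg_integral_partial m2oo m20 (n := n) c0.
rewrite (_ : (fun N => _) = (fun N => \int[m1]_x (partial c n N x)%:E)).
  by move=> /(cvg_unique _ d1) -> //.
apply/funext; elim => [|N ih].
  by rewrite !integral0_eq// => x _; rewrite /partial /series /= big_geq.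
by rewrite !integral_partialS// ih /lap lap12.
Qed.

End laplace_uniqueness.

Section densities.
Local Open Scope ereal_scope.
Context (R : realType).
Local Notation mu := (@lebesgue_measure R).

(** The densities may fail to be integrable; multiplying them by e^(-x) makes the measures finite,
    and only shifts the Laplace variable. *)
Lemma laplace_density_unique (D1 D2 : R -> \bar R) :
  measurable_fun setT D1 -> measurable_fun setT D2 ->
  (forall x, 0 <= D1 x) -> (forall x, 0 <= D2 x) ->
  (forall s : R, (0 < s)%R ->
    \int[mu]_(x in `]0%R, +oo[) ((expR (- (s * x)))%:E * D1 x) =
    \int[mu]_(x in `]0%R, +oo[) ((expR (- (s * x)))%:E * D2 x)) ->
  (forall s : R, (0 < s)%R ->
    \int[mu]_(x in `]0%R, +oo[) ((expR (- (s * x)))%:E * D1 x) < +oo) ->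
  ae_eq mu `]0%R, +oo[%classic D1 D2.
Proof.
move=> mD1 mD2 D10 D20 lap12 lapoo.
pose pos : set (measurableTypeR R) := `]0%R, +oo[%classic.
have mpos : measurable pos by exact: measurable_itv.
pose w (D : R -> \bar R) x := (expR (- (1 * x)))%:E * D x.
have mexp s : measurable_fun setT (fun x : measurableTypeR R => (expR (- (s * x)))%:E).
  by apply/measurable_EFinP; apply: measurableT_comp => //; apply: measurableT_comp.
have mw D : measurable_fun setT D -> measurable_fun pos (w D).
  move=> mD; apply: (@measurable_funTS _ _ (measurableTypeR R)).
  by apply: emeasurable_funM.
have w0 D : (forall x, 0 <= D x) -> forall x, 0 <= w D x.
  by move=> D0 x; rewrite mule_ge0// lee_fin expR_ge0.
have mid : measurable_fun pos (@idfun (measurableTypeR R)) by exact: measurable_id.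
pose m1 := weighted_image_measure mu mpos (mw _ mD1) (fun x _ => w0 _ D10 x) mid.
pose m2 := weighted_image_measure mu mpos (mw _ mD2) (fun x _ => w0 _ D20 x) mid.
have lapE D (mD : measurable_fun setT D) (D0 : forall x, 0 <= D x) (n : nat) :
    \int[weighted_image_measure mu mpos (mw _ mD) (fun x _ => w0 _ D0 x) mid]_x
      (expR (- (n%:R * x)))%:E =
    \int[mu]_(x in `]0%R, +oo[) ((expR (- (n.+1%:R * x)))%:E * D x).
  rewrite ge0_integral_weighted_image//.
  apply: eq_integral => x _; rewrite /w muleAC -EFinM -expRD; congr ((expR _)%:E * _).
  by rewrite -[n.+1]add1n natrD mulrDl opprD.
have totE D (mD : measurable_fun setT D) (D0 : forall x, 0 <= D x) :
    weighted_image_measure mu mpos (mw _ mD) (fun x _ => w0 _ D0 x) mid setT =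
    \int[mu]_(x in `]0%R, +oo[) w D x.
  by rewrite weighted_image_measureE (_ : _ `&` _ = pos)// setIT.
have negE D (mD : measurable_fun setT D) (D0 : forall x, 0 <= D x) :
    weighted_image_measure mu mpos (mw _ mD) (fun x _ => w0 _ D0 x) mid `]-oo, 0%R[%classic = 0.
  rewrite weighted_image_measureE (_ : _ `&` _ = set0) ?integral_set0//.
  rewrite -subset0 => x [] /=; rewrite /pos /= !in_itv/= andbT => x0 /(lt_trans x0).
  by rewrite ltxx.
have m12 : forall A, measurable A -> m1 A = m2 A.
  apply: laplace_unique; rewrite ?totE ?negE//.
  - exact: lapoo.
  - by rewrite /w -lap12// lapoo.
  - by move=> n; rewrite !lapE lap12.
have : ae_eq mu pos (w D1) (w D2).
  apply: integral_ae_eq => //.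
  - apply/integrableP; split; first exact: (mw _ mD1).
    under eq_integral do rewrite gee0_abs ?w0//.
    by apply: lapoo.
  - exact: (mw _ mD2).
  - move=> E Epos mE; have := m12 _ mE.
    by rewrite /m1 /m2 !weighted_image_measureE setIidr.
apply: filterS => x /= H px; have {H} := H px.
rewrite /w => /(congr1 (fun y => (expR x)%:E * y)).
by rewrite !muleA -EFinM mul1r -expRD subrr expR0 !mul1e.
Qed.

Section change_of_variables.
Context d (T : measurableType d) (nu : {measure set T -> \bar R}).
Variables (D : set T) (W : T -> \bar R) (X : T -> measurableTypeR R).
Variable B : set (measurableTypeR R).
Hypotheses (mD : measurable D) (mW : measurable_fun D W)
  (W0 : forall x, D x -> 0 <= W x) (mX : measurable_fun D X) (mB : measurable B).
Hypothesis rays : forall a, \int[nu]_(x in D `&` X @^-1` `]-oo, a[) W x =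
  mu (B `&` `]-oo, a[%classic).
Hypothesis rays_fin : forall a, mu (B `&` `]-oo, a[%classic) < +oo.

(** To substitute it is enough to know the image of the weighted measure on rays; no derivative
    of X enters, so X may be an indefinite integral or fail to be injective. *)
Lemma ge0_change_of_variables (k : R -> \bar R) :
  measurable_fun setT k -> (forall y, 0 <= k y) ->
  \int[mu]_(y in B) k y = \int[nu]_(x in D) (W x * k (X x)).
Proof.
move=> mk k0.
rewrite -(ge0_integral_weighted_image nu mD mW W0 mX mk k0).
have mBa a : measurable (B `&` `]-oo, a[%classic).
  by apply: measurableI => //; exact: measurable_itv.
have mid : measurable_fun B (@idfun (measurableTypeR R)) by exact: measurable_id.
have m1 : measurable_fun B (cst 1 : measurableTypeR R -> \bar R) by [].
transitivity (\int[mu]_(y in B) (cst 1 y * k (idfun y))).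
  by apply: eq_integral => y _; rewrite mul1e.
rewrite -(@ge0_integral_weighted_image _ _ _ _ _ _ _ _ _ mB m1 (fun _ _ => @lee01 R) mid _ mk k0).
apply: eq_measure_integral => A mA _.
apply: measure_unique_ray => // a; rewrite !weighted_image_measureE/= preimage_id.
- by rewrite rays integral_cst ?mul1e.
- by rewrite integral_cst ?mul1e//; exact: rays_fin.
Qed.

End change_of_variables.
End densities.

(** * Substitutions on the positive half-line and the Gamma integral *)

Section substitutions.
Local Open Scope ereal_scope.
Context (R : realType).
Local Notation mu := (@lebesgue_measure R).
Local Notation pos := (`]0%R, +oo[%classic : set R).

Lemma lebesgue_pos_ray (a : R) :
  mu (`]0%R, +oo[%classic `&` `]-oo, a[%classic) = (Num.max a 0)%:E.
Proof.
rewrite (_ : _ `&` _ = `]0%R, a[%classic); last first.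
  apply/seteqP; split=> x /=; rewrite !in_itv/= ?andbT; first by case=> -> ->.
  by case/andP=> -> ->.
rewrite lebesgue_measure_itv/= lte_fin; case: ltP => a0; last by [].
by rewrite -EFinB subr0.
Qed.

Lemma ge0_integral_scale (c : R) (k : R -> \bar R) : (0 < c)%R ->
  measurable_fun setT k -> (forall y, 0 <= k y) ->
  \int[mu]_(y in `]0%R, +oo[) k y =
  \int[mu]_(x in `]0%R, +oo[) (c%:E * k (c * x)%R).
Proof.
move=> c0 mk k0.
apply: (@ge0_change_of_variables _ _ _ mu _ (cst c%:E) (fun x => c * x)%R) => //.
- by move=> x _; rewrite lee_fin ltW.
- by apply: measurable_funM.
- move=> a; rewrite lebesgue_pos_ray.
  rewrite (_ : _ `&` _ = `]0%R, +oo[%classic `&` `]-oo, a / c[%classic)%R; last first.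
    by apply/seteqP; split=> x /=; rewrite !in_itv/= ?andbT ltr_pdivlMr// mulrC.
  rewrite integral_cst/=; last by apply: measurableI; exact: measurable_itv.
  rewrite lebesgue_pos_ray -EFinM maxr_pMr ?ltW// mulr0 mulrC divfK//.
  by rewrite gt_eqF.
- by move=> a; rewrite lebesgue_pos_ray ltry.
Qed.

Lemma ge0_integral_shift (a : R) (k : R -> \bar R) :
  measurable_fun setT k -> (forall y, 0 <= k y) ->
  \int[mu]_(y in `]0%R, +oo[) k y = \int[mu]_(x in `]a, +oo[) k (x - a)%R.
Proof.
move=> mk k0.
rewrite (@ge0_change_of_variables _ _ _ mu `]a, +oo[%classic (cst 1) (fun x => x - a)%R) => //.
- by apply: eq_integral => x _; rewrite mul1e.
- by apply: measurable_funB.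
- move=> b; rewrite lebesgue_pos_ray.
  rewrite (_ : _ `&` _ = `]a, (b + a)%R[%classic); last first.
    apply/seteqP; split=> x /=; rewrite !in_itv/= ?andbT ltrBlDr; first by case=> -> ->.
    by move=> /andP[].
  rewrite integral_cst//= mul1e lebesgue_measure_itv/= lte_fin.
  case: (ltP b 0%R) => b0.
    by rewrite ltNge gerDr ltW.
  move: b0; rewrite le_eqVlt => /predU1P[<-|b0]; first by rewrite add0r ltxx.
  by rewrite ltrDr b0 -EFinB addrK.
- by move=> b; rewrite lebesgue_pos_ray ltry.
Qed.

Lemma continuous_powR (p x : R) : (0 < x)%R -> {for x, continuous (fun y : R => (y `^ p)%R)}.
Proof.
move=> x0; apply: differentiable_continuous; apply/derivable1_diffP.
by apply: derivable_powR; rewrite in_itv/= x0.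
Qed.

Lemma powRN_cvgy (p : R) : (0 < p)%R -> (x `^ (- p))%R @[x --> +oo%R] --> (0%R : R).
Proof.
move=> p0; apply/cvgrPdist_le => e e0; near=> x.
have x0 : (0 < x)%R by near: x; exact: nbhs_pinfty_gt.
rewrite sub0r normrN ger0_norm ?powR_ge0//.
have eE : e = ((e `^ (- p^-1)) `^ (- p))%R.
  by rewrite -powRrM mulrNN mulVf ?gt_eqF// powRr1 ?ltW.
rewrite [X in (_ <= X)%R]eE [X in (X <= _)%R]powRN [X in (_ <= X)%R]powRN.
rewrite lef_pV2 ?posrE ?powR_gt0//.
apply: ge0_ler_powR; rewrite ?nnegrE ?powR_ge0 ?(ltW x0) ?(ltW p0)//.
Unshelve. all: by end_near. Qed.

(** Used for the mass that the substitution y = c x^(-b) below gives to left rays. *)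
Lemma integral_powRN_tail (b r : R) : (0 < b)%R -> (0 < r)%R ->
  \int[mu]_(x in `]r, +oo[) (b * x `^ (- b - 1))%:E = (r `^ (- b))%:E.
Proof.
move=> b0 r0.
have mb : measurable_fun `]r, +oo[ (fun x => (b * x `^ (- b - 1))%:E).
  apply/measurable_EFinP; apply: measurable_funM => //.
  by apply: measurable_funTS; exact: measurable_powR.
rewrite integral_itv_obnd_cbnd//.
have cF (x : R) : (0 < x)%R -> is_derive x 1%R (fun y : R => - (y `^ (- b)))%R (b * x `^ (- b - 1))%R.
  move=> x0; have -> : (b * x `^ (- b - 1) = - (- b * x `^ (- b - 1)))%R by rewrite mulNr opprK.
  by apply: is_deriveN; exact: is_derive1_powR.
rewrite (@ge0_continuous_FTC2y _ _ (fun x => - (x `^ (- b)))%R _ 0%R).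
- by rewrite EFinN oppeK add0e.
- by move=> x rx; rewrite mulr_ge0 ?powR_ge0// ltW.
- apply: continuous_in_subspaceT => x; rewrite inE/= in_itv/= andbT => rx.
  apply: cvgM; first exact: cvg_cst.
  by apply: continuous_powR; exact: lt_le_trans rx.
- by rewrite -oppr0; apply: cvgN; exact: powRN_cvgy.
- by move=> x rx; have [] := cF x (lt_trans r0 rx).
- apply: cvg_at_right_filter; apply: cvgN; exact: continuous_powR.
- move=> x; rewrite in_itv/= andbT => rx; rewrite derive1E.
  by have [_ ->] := cF x (lt_trans r0 rx).
Qed.

Lemma ge0_integral_powRN (c b : R) (k : R -> \bar R) : (0 < c)%R -> (0 < b)%R ->
  measurable_fun setT k -> (forall y, 0 <= k y) ->
  \int[mu]_(y in `]0%R, +oo[) k y =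
  \int[mu]_(x in `]0%R, +oo[) ((c * (b * x `^ (- b - 1)))%:E * k (c * x `^ (- b))%R).
Proof.
move=> c0 b0 mk k0.
have mW : measurable_fun setT (fun x : R => (c * (b * x `^ (- b - 1)))%:E).
  apply/measurable_EFinP; apply: measurable_funM => //; apply: measurable_funM => //.
have W0 (x : R) : 0 <= (c * (b * x `^ (- b - 1)))%:E.
  by rewrite lee_fin !mulr_ge0 ?powR_ge0// ltW.
apply: (@ge0_change_of_variables _ _ _ mu _ (fun x : R => (c * (b * x `^ (- b - 1)))%:E)
  (fun x => c * x `^ (- b))%R) => //.
- exact: (measurable_funTS mW).
- apply: (@measurable_funTS _ _ (measurableTypeR R)).
  by apply: measurable_funM => //; exact: measurable_powR.
- move=> a; rewrite lebesgue_pos_ray.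
  have [a0|a0] := leP a 0%R.
    rewrite (_ : _ `&` _ = set0) ?integral_set0//.
    rewrite -subset0 => x [] /=; rewrite !in_itv/= andbT => x0; apply/negP.
    by rewrite -leNgt (le_trans a0)// mulr_ge0 ?powR_ge0// ltW.
  pose r := ((c / a) `^ b^-1)%R; have r0 : (0 < r)%R by apply: powR_gt0; exact: divr_gt0.
  rewrite (_ : _ `&` _ = `]r, +oo[%classic); last first.
    apply/seteqP; split=> x /=; rewrite !in_itv/= !andbT.
      move=> [x0 xa]; rewrite /r -[ltRHS]powRr1 ?ltW// -(mulfV (lt0r_neq0 b0)) powRrM.
      apply: gt0_ltr_powR; rewrite ?nnegrE ?powR_ge0 ?invr_gt0 ?divr_ge0 ?ltW//.
      by move: xa; rewrite powRN ltr_pdivrMr ?powR_gt0// ltr_pdivrMr// mulrC.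
    move=> rx; have x0 := lt_trans r0 rx; split => //.
    rewrite powRN ltr_pdivrMr ?powR_gt0// mulrC -ltr_pdivrMr//.
    have -> : (c / a = r `^ b)%R.
      by rewrite /r -powRrM mulVf ?gt_eqF// powRr1// divr_ge0 ?ltW.
    by apply: gt0_ltr_powR; rewrite ?nnegrE ?ltW.
  under eq_integral do rewrite EFinM.
  rewrite ge0_integralZl//; last 3 first.
  + apply/measurable_EFinP; apply: measurable_funM => //.
    by apply: measurable_funTS; exact: measurable_powR.
  + by move=> x _; rewrite lee_fin mulr_ge0 ?powR_ge0// ltW.
  + by rewrite lee_fin ltW.
  rewrite integral_powRN_tail// -EFinM /r -powRrM mulrN mulVf ?gt_eqF//.
  by rewrite powR_inv1 ?divr_ge0 ?ltW// invf_div mulrC divfK// gt_eqF.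
- by move=> a; rewrite lebesgue_pos_ray ltry.
Qed.
End substitutions.

Section gamma.
Local Open Scope ereal_scope.
Context (R : realType).
Local Notation mu := (@lebesgue_measure R).
Local Notation pos := (`]0%R, +oo[%classic : set (measurableTypeR R)).

(** Power substitutions are absolutely continuous: the preimage of a null set has weighted measure
    zero and the weight is positive. *)
Lemma ae_powRN (c b : R) (Q : R -> Prop) : (0 < c)%R -> (0 < b)%R ->
  {ae mu, forall x, (0 < x)%R -> Q x} ->
  {ae mu, forall v, (0 < v)%R -> Q (c * v `^ (- b))%R}.
Proof.
move=> c0 b0 [N [mN N0 QN]].
have mk : measurable_fun setT (fun x : R => (\1_N x)%:E : \bar R) by exact/measurable_EFinP.
pose W (x : R) := ((c * (b * x `^ (- b - 1)))%:E * (\1_N (c * x `^ (- b)))%:E)%E.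
have mX : measurable_fun setT (fun x : R => c * x `^ (- b))%R.
  by apply: measurable_funM => //; exact: measurable_powR.
have mW : measurable_fun pos W.
  apply: (@measurable_funTS _ _ (measurableTypeR R)); apply: emeasurable_funM.
    by apply/measurable_EFinP; apply: measurable_funM => //; apply: measurable_funM => //.
  by apply: (measurableT_comp mk mX).
have W0 (x : R) : 0 <= W x.
  by apply: mule_ge0; rewrite lee_fin ?mulr_ge0 ?powR_ge0// ltW.
have : \int[mu]_(x in `]0%R, +oo[) `|W x| = 0.
  under eq_integral do rewrite gee0_abs//.
  rewrite -(@ge0_integral_powRN _ c b (fun x => (\1_N x)%:E))//.
    rewrite integral_indic//=.
    apply/eqP; rewrite -measure_le0 -N0 le_measure ?inE//.
    exact: measurableI.
move/(ae_eq_integral_abs mu (measurable_itv _) mW).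
apply: filterS => v /= Wv v0.
have {}Wv : W v = 0 by apply: Wv; rewrite in_itv/= v0.
apply: contrapT => nQ.
have Nv : N (c * v `^ (- b))%R.
  by apply: QN => /= H; apply: nQ; apply: H; rewrite mulr_gt0// powR_gt0.
move: Wv; rewrite /W indicE mem_set// mule1 => -[] /eqP; apply/negP.
by rewrite gt_eqF// !mulr_gt0// powR_gt0.
Qed.

(** One term of the exponential series already dominates the power. *)
Lemma powR_expR_bounded (p : R) : (0 <= p)%R ->
  exists C : R, (0 < C)%R /\ forall z : R, (0 < z)%R -> (z `^ p * expR (- z) <= C)%R.
Proof.
move=> p0; pose n := (Num.trunc p).+1.
have pn : (p <= n%:R)%R by rewrite ltW// truncnS_gt.
exists (n`!%:R)%R; split; first by rewrite ltr0n fact_gt0.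
move=> z z0; have [z1|z1] := leP z 1%R.
  apply: (@le_trans _ _ (1 * 1)%R); last by rewrite mulr1 ler1n fact_gt0.
  apply: ler_pM; rewrite ?powR_ge0 ?expR_ge0//; last by rewrite expR_le1 oppr_le0 ltW.
  by rewrite -(powRr0 z); apply: ger_powR => //; rewrite z0.
rewrite expRN ler_pdivrMr ?expR_gt0// mulrC -ler_pdivrMr ?ltr0n ?fact_gt0//.
have H := expR_ge1Dxn (Num.trunc p) (ltW z0).
apply: (@le_trans _ _ (z ^+ n / n`!%:R)%R); last by apply: le_trans H; rewrite lerDr.
rewrite ler_wpM2r ?invr_ge0//; apply: (le_trans (ler_powR (ltW z1) pn)).
by rewrite powR_mulrn// ltW.
Qed.

Definition gamma_integral (a : R) : \bar R :=
  \int[mu]_(w in `]0%R, +oo[) (w `^ (a - 1) * expR (- w))%:E.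

Let mgam (a s : R) : measurable_fun setT (fun w : R => (w `^ (a - 1) * expR (- (s * w)))%:E).
Proof.
apply/measurable_EFinP; apply: measurable_funM; first exact: measurable_powR.
by apply: measurableT_comp => //; apply: measurableT_comp => //; exact: measurable_funM.
Qed.

Let mgam1 (a : R) : measurable_fun setT (fun w : R => (w `^ (a - 1) * expR (- w))%:E).
Proof.
apply/measurable_EFinP; apply: measurable_funM; first exact: measurable_powR.
by apply: measurableT_comp => //; exact: measurableT_comp.
Qed.

(** With w = y^(-1/a) the integrand becomes y^(-2) exp(- y^(-1/a)) / a, bounded near 0 and
    comparable to y^(-2) at infinity. *)
Lemma gamma_integral_lty (a : R) : (0 < a)%R -> gamma_integral a < +oo.
Proof.
move=> a0; pose b := (a^-1)%R; have b0 : (0 < b)%R by rewrite invr_gt0.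
have mg := mgam a 1; rewrite /gamma_integral.
under eq_integral do rewrite -[X in expR (- X)]mul1r.
rewrite (@ge0_integral_powRN _ 1 b (fun w => (w `^ (a - 1) * expR (- (1 * w)))%:E))//; last first.
  by move=> y; rewrite lee_fin mulr_ge0 ?powR_ge0 ?expR_ge0.
have [C [C0 CP]] := @powR_expR_bounded (a + a)%R (ltW (addr_gt0 a0 a0)).
set G := fun x : R => (_ * _)%E.
have GE (y : R) : (0 < y)%R -> G y = (b * y `^ (-2) * expR (- (y `^ (- b))))%:E.
  move=> y0; rewrite /G !mul1r -EFinM; congr (_%:E); rewrite mulrA -powRrM; congr (_ * _)%R.
  rewrite -mulrA -powRD; last by rewrite (gt_eqF y0) implybT.
  by congr (_ * _ `^ _)%R; rewrite /b; field; rewrite gt_eqF.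
have mG : measurable_fun setT G.
  apply: emeasurable_funM.
    by apply/measurable_EFinP; apply: measurable_funM => //; apply: measurable_funM => //.
  by apply: (measurableT_comp mg); apply: measurable_funM => //; exact: measurable_powR.
have G0 y : 0 <= G y.
  by apply: mule_ge0; rewrite lee_fin ?mulr_ge0 ?powR_ge0 ?expR_ge0// ltW.
clearbody G.
rewrite (_ : `]0%R, +oo[%classic = `]0%R, 1%R] `|` `]1%R, +oo[); last first.
  apply/seteqP; split => x /=; rewrite !in_itv/= !andbT.
    by move=> x0; have [x1|x1] := leP x 1%R; [left; rewrite x0|right].
  by move=> [/andP[]//|]; apply: lt_trans.
rewrite ge0_integral_setU//; last 2 first.
- exact: (measurable_funTS mG).
- rewrite disj_set2E; apply/eqP; rewrite -subset0 => x [] /=; rewrite !in_itv/= andbT.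
  by move=> /andP[_ x1]; rewrite ltNge x1.
apply: lte_add_pinfty.
- apply: (@le_lt_trans _ _ (\int[mu]_(y in `]0%R, 1%R]) (cst (b * C)%:E y))).
    apply: ge0_le_integral => //; first exact: (measurable_funTS mG).
    move=> y /=; rewrite in_itv/= => /andP[y0 y1]; rewrite GE// lee_fin -mulrA.
    rewrite ler_wpM2l ?(ltW b0)//; have := CP (y `^ (- b))%R (powR_gt0 _ y0).
    by rewrite -powRrM (_ : - b * (a + a) = -2)%R//; rewrite /b; field; rewrite gt_eqF.
  rewrite integral_cst//= lebesgue_measure_itv/= lte_fin ltr01.
  by rewrite -EFinB -EFinM ltry.
- apply: (@le_lt_trans _ _ (\int[mu]_(y in `]1%R, +oo[) (b%:E * (1 * y `^ (- 1 - 1))%:E))).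
    apply: ge0_le_integral => //; first exact: (measurable_funTS mG).
    + apply: (@measurable_funTS _ _ (measurableTypeR R)); apply: emeasurable_funM => //.
      by apply/measurable_EFinP; apply: measurable_funM => //; exact: measurable_powR.
    + move=> y /=; rewrite in_itv/= andbT => y1; have y0 := lt_trans ltr01 y1.
      rewrite GE// -EFinM lee_fin mul1r -mulrA ler_wpM2l ?(ltW b0)//.
      rewrite (_ : (-1 - 1)%R = -2 :> R)%R; last by ring.
      by rewrite ler_piMr ?powR_ge0// expR_le1 oppr_le0 powR_ge0.
  rewrite ge0_integralZl//; last 3 first.
  + apply: (@measurable_funTS _ _ (measurableTypeR R)).
    by apply/measurable_EFinP; apply: measurable_funM => //; exact: measurable_powR.
  + by move=> y _; rewrite lee_fin mulr_ge0 ?powR_ge0.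
  + by rewrite lee_fin ltW.
  by rewrite integral_powRN_tail// -EFinM ltry.
Qed.

Lemma gamma_integral_gt0 (a : R) : 0 < gamma_integral a.
Proof.
rewrite lt0e integral_ge0 ?andbT; last first.
  by move=> w _; rewrite lee_fin mulr_ge0 ?powR_ge0 ?expR_ge0.
apply/negP => /eqP I0.
have mg : measurable_fun pos (fun w : R => (w `^ (a - 1) * expR (- w))%:E).
  exact: (measurable_funTS (mgam1 a)).
have : \int[mu]_(x in `]0%R, +oo[) `|(x `^ (a - 1) * expR (- x))%:E| = 0.
  by under eq_integral do rewrite gee0_abs ?lee_fin ?mulr_ge0 ?powR_ge0 ?expR_ge0//.
move/(ae_eq_integral_abs mu (measurable_itv _) mg) => [N [mN N0 posN]].
have : mu `]0%R, 1%R[%classic <= mu N.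
  apply: le_measure; rewrite ?inE//.
  move=> x /=; rewrite in_itv/= => /andP[x0 x1]; apply: posN => /= H.
  have := H; rewrite in_itv/= x0 => /(_ isT) [] /eqP; apply/negP.
  by rewrite gt_eqF// mulr_gt0 ?powR_gt0 ?expR_gt0.
by rewrite [X in _ <= X]N0 lebesgue_measure_itv/= lte_fin ltr01 leNgt -EFinB subr0 lte01.
Qed.

(** Scaling w by s. *)
Lemma gamma_laplace (a s : R) : (0 < a)%R -> (0 < s)%R ->
  \int[mu]_(w in `]0%R, +oo[) (w `^ (a - 1) * expR (- (s * w)))%:E =
  (s `^ (- a))%:E * gamma_integral a.
Proof.
move=> a0 s0; rewrite /gamma_integral.
have mg := mgam1 a.
rewrite (@ge0_integral_scale _ s (fun w => (w `^ (a - 1) * expR (- w))%:E))//; last first.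
  by move=> y; rewrite lee_fin mulr_ge0 ?powR_ge0 ?expR_ge0.
rewrite -ge0_integralZl//; last 3 first.
- apply: (@measurable_funTS _ _ (measurableTypeR R)); apply: emeasurable_funM => //.
  by apply: (measurableT_comp mg); exact: measurable_funM.
- by move=> x _; rewrite mule_ge0// lee_fin ?(ltW s0)// mulr_ge0 ?powR_ge0 ?expR_ge0.
- by rewrite lee_fin powR_ge0.
apply: eq_integral => w; rewrite inE/= in_itv/= andbT => w0.
rewrite -!EFinM powRM ?ltW//; congr (_%:E).
have sE : (s `^ (- a) * s * s `^ (a - 1) = 1)%R.
  rewrite -{2}(powRr1 (ltW s0)) -!powRD ?(gt_eqF s0) ?implybT//.
  by rewrite (_ : - a + 1 + (a - 1) = 0)%R ?powRr0//; ring.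
transitivity ((s `^ (- a) * s * s `^ (a - 1)) * (w `^ (a - 1) * expR (- (s * w))))%R.
  by rewrite sE mul1r.
by ring.
Qed.

End gamma.

(** * The one-sided stable density *)

Section stable_moments.
Context (R : realType).
Local Notation mu := (@lebesgue_measure R).
Local Notation pos := (`]0%R, +oo[%classic : set (measurableTypeR R)).
Variables (alpha : R) (g : R -> R).
Hypotheses (alpha_gt0 : 0 < alpha) (alpha_lt1 : alpha < 1).
Hypotheses (mg : measurable_fun setT g) (g_ge0 : forall x, 0 <= g x).
Hypothesis g_int : mu.-integrable pos (EFin \o g).
Hypothesis g_laplace : forall s : R, 0 < s ->
  (\int[mu]_(x in pos) (expR (- (s * x)) * g x) = expR (- (s `^ alpha)))%R.

Let mpos : measurable pos. Proof. exact: measurable_itv. Qed.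

Let integrand (m : nat) (s x : R) : R := x ^+ m * expR (- (s * x)) * g x.

Lemma stable_moment_bound (m : nat) (r : R) : 0 < r ->
  exists C : R, 0 <= C /\ forall s x : R, r <= s -> 0 < x -> x ^+ m * expR (- (s * x)) <= C.
Proof.
move=> r0; have [C [C0 CP]] := @powR_expR_bounded R m%:R (ler0n _ _).
exists (C / r ^+ m); split; first by rewrite divr_ge0 ?exprn_ge0 ?ltW.
move=> s x rs x0; rewrite ler_pdivlMr ?exprn_gt0//.
have rx0 : 0 < r * x by rewrite mulr_gt0.
apply: le_trans (CP _ rx0); rewrite powR_mulrn ?(ltW rx0)// exprMn.
have -> : x ^+ m * expR (- (s * x)) * r ^+ m = r ^+ m * x ^+ m * expR (- (s * x)) by ring.
apply: ler_wpM2l.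
  by rewrite mulr_ge0 ?exprn_ge0 ?(ltW r0) ?(ltW x0).
by rewrite ler_expR lerN2 ler_pM2r.
Qed.

Let measurable_integrand m s : measurable_fun pos (integrand m s).
Proof.
apply: measurable_funTS; apply: measurable_funM => //; apply: measurable_funM => //.
by apply: measurableT_comp => //; apply: measurableT_comp => //; exact: measurable_funM.
Qed.

Lemma integrable_stable_moment m (s : R) : 0 < s -> mu.-integrable pos (EFin \o integrand m s).
Proof.
move=> s0; have [C [C0 CP]] := stable_moment_bound m s0.
apply: (le_integrable mpos _ _ (integrableZl mpos C g_int)).
- by apply/measurable_EFinP; exact: measurable_integrand.
- move=> x; rewrite /= in_itv/= andbT => x0.
  rewrite lee_fin !ger0_norm ?mulr_ge0 ?exprn_ge0 ?expR_ge0 ?(ltW x0)//.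
  by rewrite ler_wpM2r//; exact: CP.
Qed.

Let moment m s := \int[mu]_(x in pos) integrand m s x.

(** Differentiation of the Laplace transform under the integral sign, away from s = 0. *)
Lemma is_derive_stable_moment m (s : R) : 0 < s -> is_derive s 1 (moment m) (- moment m.+1 s).
Proof.
move=> s0; have s20 : 0 < s / 2 by rewrite divr_gt0.
have [C [C0 CP]] := stable_moment_bound m.+1 s20.
have Is : `](s / 2), (s + 1)[%classic s.
  by rewrite /= in_itv/= ltr_pdivrMr// ltr_pMr// ltr1n ltrDl ltr01.
have derf (x y : R) : is_derive x 1 (integrand m ^~ y) (- integrand m.+1 x y).
  have -> : - integrand m.+1 x y = (y ^+ m * g y) *: (expR (- (x * y)) * - y).
    by rewrite /integrand /GRing.scale /= exprS; ring.
  rewrite (_ : integrand m ^~ y = (y ^+ m * g y) \*: (expR \o (fun s => - (s * y)))); last first.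
    by apply/funext => z; rewrite /integrand /= /GRing.scale /=; ring.
  apply: is_deriveZ; apply: is_derive1_comp.
  rewrite (_ : (fun s => _) = (- y) \*: id); last first.
    by apply/funext => z; rewrite /= /GRing.scale /= mulrC mulNr.
  by rewrite -[X in is_derive _ _ _ X]mulr1; exact: is_deriveZ.
have dfE (x y : R) : partial1of2 (integrand m) x y = - integrand m.+1 x y.
  by rewrite partial1of2E; apply: derive_val; exact: derf.
have intf (x : R) : `](s / 2), (s + 1)[%classic x -> mu.-integrable pos (EFin \o integrand m x).
  by rewrite /= in_itv/= => /andP[sx _]; apply: integrable_stable_moment; exact: lt_trans sx.
have derf1 (x y : R) : `](s / 2), (s + 1)[%classic x -> pos y -> derivable (integrand m ^~ y) x 1.
  by move=> _ _; have [] := derf x y.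
have intG : mu.-integrable pos (EFin \o (fun y => C * g y)).
  by apply: (eq_integrable mpos _ _ _ (integrableZl mpos C g_int)) => y _; rewrite /= EFinM.
have G_ub (x y : R) : `](s / 2), (s + 1)[%classic x -> pos y ->
    `|partial1of2 (integrand m) x y| <= C * g y.
  rewrite /= !in_itv/= andbT => /andP[sx _] y0; rewrite dfE normrN.
  rewrite ger0_norm ?mulr_ge0 ?exprn_ge0 ?expR_ge0 ?(ltW y0)//.
  by rewrite ler_wpM2r// CP// ltW.
have G0 (y : R) : 0 <= C * g y by rewrite mulr_ge0.
apply: DeriveDef; first exact: (derivable_under_integral mpos Is intf derf1 G0 intG G_ub).
rewrite -derive1E (differentiation_under_integral mpos Is intf derf1 G0 intG G_ub).
under eq_Rintegral do rewrite dfE -mulN1r.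
by rewrite RintegralZl ?mulN1r//; exact: integrable_stable_moment.
Qed.

(** The derivatives of e^(-s^alpha) are sums of terms c s^-a e^(-s^alpha); the list holds the
    pairs (c, a), so that differentiation becomes an operation on lists. *)
Definition stable_terms (l : seq (R * R)) (s : R) : R :=
  \sum_(p <- l) p.1 * s `^ (- p.2) * expR (- (s `^ alpha)).

(** Minus the derivative of c s^-a e^(-s^alpha) is
    c a s^(-a-1) e^(-s^alpha) + alpha c s^(-(a+1-alpha)) e^(-s^alpha). *)
Definition stable_terms_step (l : seq (R * R)) : seq (R * R) :=
  [seq (p.1 * p.2, p.2 + 1) | p <- l] ++ [seq (alpha * p.1, p.2 + 1 - alpha) | p <- l].

Lemma is_derive_stable_terms l (s : R) : 0 < s ->
  is_derive s 1 (stable_terms l) (- stable_terms (stable_terms_step l) s).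
Proof.
move=> s0.
have dterm (p : R * R) : is_derive s 1 (fun s => p.1 * s `^ (- p.2) * expR (- (s `^ alpha)))
    (- (p.1 * p.2 * s `^ (- (p.2 + 1)) * expR (- (s `^ alpha)) +
        alpha * p.1 * s `^ (- (p.2 + 1 - alpha)) * expR (- (s `^ alpha)))).
  have d1 : is_derive s 1 (fun s : R => p.1 * s `^ (- p.2)) (p.1 * (- p.2 * s `^ (- p.2 - 1))).
    by apply: (@is_deriveZ _ _ _ (fun s : R => s `^ (- p.2))); exact: is_derive1_powR.
  have d2 : is_derive s 1 (fun s : R => expR (- (s `^ alpha)))
      (expR (- (s `^ alpha)) * - (alpha * s `^ (alpha - 1))).
    apply: (@is_derive1_comp _ expR (fun s : R => - (s `^ alpha))).
    by apply: is_deriveN; exact: is_derive1_powR.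
  apply: (is_derive_eq (is_deriveM d1 d2)).
  rewrite /GRing.scale /=.
  have -> : - (p.2 + 1 - alpha) = - p.2 + (alpha - 1) by ring.
  have -> : - (p.2 + 1) = - p.2 - 1 by ring.
  rewrite (powRD (r := - p.2) (s := alpha - 1)) ?(gt_eqF s0) ?implybT//.
  by ring.
elim: l => [|p l ih].
  rewrite /stable_terms_step /= /stable_terms big_nil oppr0.
  rewrite (_ : (fun s => _) = cst 0); last by apply/funext => x; rewrite big_nil.
  exact: is_derive_cst.
rewrite (_ : stable_terms (p :: l) =
  (fun s => p.1 * s `^ (- p.2) * expR (- (s `^ alpha))) \+ stable_terms l); last first.
  by apply/funext => x; rewrite /stable_terms big_cons.
apply: (is_derive_eq (is_deriveD (dterm p) ih)).
rewrite /stable_terms /stable_terms_step /= !big_cat/= !big_cons !big_cat/= !big_cons.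
by rewrite !big_map /=; ring.
Qed.

Lemma stable_moment_step m l :
  (forall s : R, 0 < s -> \int[mu]_(x in pos) (x ^+ m * expR (- (s * x)) * g x) = stable_terms l s) ->
  forall s : R, 0 < s ->
    \int[mu]_(x in pos) (x ^+ m.+1 * expR (- (s * x)) * g x) = stable_terms (stable_terms_step l) s.
Proof.
move=> ml s s0; apply: oppr_inj.
have [d1 <-] := is_derive_stable_moment m s0.
have [d2 <-] := is_derive_stable_terms l s0.
apply: near_eq_derive => //; near=> x; apply: ml.
by near: x; exact: lt_nbhsr.
Unshelve. all: by end_near. Qed.

Lemma stable_moment1 (s : R) : 0 < s ->
  \int[mu]_(x in pos) (x ^+ 1 * expR (- (s * x)) * g x) = stable_terms [:: (alpha, 1 - alpha)] s.
Proof.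
move=> s0; rewrite (@stable_moment_step 0 [:: (1, 0)])//.
  rewrite /stable_terms /stable_terms_step /= !big_cons !big_nil /=.
  by rewrite mulr0 !mul0r !mulr1 !add0r addr0.
move=> r r0; rewrite /stable_terms big_cons big_nil /= oppr0 powRr0 !mul1r addr0.
by rewrite -g_laplace//; apply: eq_Rintegral => x _; rewrite expr0 mul1r.
Qed.

(** Each differentiation raises an exponent by 1 or by 1 - alpha. The lower bound on the exponents
    makes the kernels regular for large m; the upper bound controls x^m rho at infinity. *)
Lemma stable_moments m : (0 < m)%N -> exists l : seq (R * R),
  (forall p, p \in l -> [/\ 0 <= p.1, m%:R * (1 - alpha) <= p.2 & p.2 <= m%:R - alpha]) /\
  forall s : R, 0 < s ->
    \int[mu]_(x in pos) (x ^+ m * expR (- (s * x)) * g x) = stable_terms l s.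
Proof.
case: m => // m _; elim: m => [|m [l [lP lE]]].
  exists [:: (alpha, 1 - alpha)]; split; last exact: stable_moment1.
  by move=> p; rewrite inE => /eqP -> /=; split; rewrite ?mul1r// ltW.
exists (stable_terms_step l); split; last exact: stable_moment_step.
have mE : m.+2%:R = m.+1%:R + 1 :> R by rewrite -natr1.
have a1 : 0 <= 1 - alpha by rewrite subr_ge0 ltW.
have m1 : 0 <= m.+1%:R * (1 - alpha) by rewrite mulr_ge0.
move=> p; rewrite /stable_terms_step mem_cat => /orP[] /mapP[q /lP[q1 q2 q3] ->] /=; split.
- by rewrite mulr_ge0// (le_trans m1).
- by rewrite mE mulrDl mul1r lerD// lerBlDl lerDr ltW.
- by rewrite mE addrAC lerD2r.
- by rewrite mulr_ge0// ltW.
- by rewrite mE mulrDl mul1r -addrA lerD2r.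
- by rewrite lerD2r mE -lerBrDr addrK (le_trans q3)// gerBl ltW.
Qed.

End stable_moments.

Section power_kernel.
Local Open Scope ereal_scope.
Context (R : realType).
Local Notation mu := (@lebesgue_measure R).
Local Notation pos := (`]0%R, +oo[%classic : set (measurableTypeR R)).

Lemma ge0_integral_indic (D : set (measurableTypeR R)) (f : R -> \bar R) : measurable D ->
  \int[mu]_(x in D) f x = \int[mu]_x ((\1_D x)%:E * f x).
Proof.
move=> mD; rewrite integral_mkcond; apply: eq_integral => x _.
by rewrite patchE indicE; case: ifPn => xD; rewrite ?mul1e ?mul0e.
Qed.

Definition power_kernel (a w : R) : R := (w `^ (a - 1) * \1_pos w)%R.

Definition positive_part (g : R -> R) (y : R) : R := (g y * \1_pos y)%R.

(** Up to the factor Gamma(a), this is the Riemann-Liouville fractional integral of order a. *)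
Definition power_conv (g : R -> R) (a x : R) : \bar R :=
  \int[mu]_y (power_kernel a (x - y) * positive_part g y)%:E.

Lemma indic_pos (w : R) : \1_pos w = (0 < w)%R%:R :> R.
Proof.
rewrite indicE (_ : (w \in pos) = (0 < w)%R)//.
by apply/idP/idP; rewrite inE/= in_itv/= andbT.
Qed.

Lemma power_kernel_ge0 a w : (0 <= power_kernel a w)%R.
Proof. by rewrite mulr_ge0// powR_ge0. Qed.

Lemma power_kernel_gt0 a w : (0 < w)%R -> power_kernel a w = (w `^ (a - 1))%R.
Proof. by move=> w0; rewrite /power_kernel indic_pos w0 mulr1. Qed.

Lemma power_kernel_le0 a w : (w <= 0)%R -> power_kernel a w = 0%R.
Proof. by move=> w0; rewrite /power_kernel indic_pos ltNge w0 mulr0. Qed.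

Lemma measurable_power_kernel a :
  measurable_fun setT (power_kernel a : measurableTypeR R -> measurableTypeR R).
Proof. by apply: measurable_funM; [exact: measurable_powR|exact: measurable_indic]. Qed.

Variable g : R -> R.
Hypotheses (mg : measurable_fun setT g) (g_ge0 : forall x, (0 <= g x)%R).

Lemma positive_part_ge0 y : (0 <= positive_part g y)%R.
Proof. by rewrite mulr_ge0. Qed.

Lemma positive_part_gt0 y : (0 < y)%R -> positive_part g y = g y.
Proof. by move=> y0; rewrite /positive_part indic_pos y0 mulr1. Qed.

Lemma positive_part_le0 y : (y <= 0)%R -> positive_part g y = 0%R.
Proof. by move=> y0; rewrite /positive_part indic_pos ltNge y0 mulr0. Qed.

Lemma measurable_positive_part :
  measurable_fun setT (positive_part g : measurableTypeR R -> measurableTypeR R).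
Proof. by apply: measurable_funM => //; exact: measurable_indic. Qed.

Lemma measurable_power_conv_integrand a :
  measurable_fun setT (fun z : measurableTypeR R * measurableTypeR R =>
    (power_kernel a (z.1 - z.2) * positive_part g z.2)%:E).
Proof.
apply/measurable_EFinP; apply: measurable_funM.
  apply: (measurableT_comp (measurable_power_kernel a)).
  by apply: measurable_funB.
by apply: (measurableT_comp measurable_positive_part).
Qed.

Lemma power_conv_integrand_ge0 a x y :
  0 <= (power_kernel a (x - y) * positive_part g y)%:E.
Proof. by rewrite lee_fin mulr_ge0 ?power_kernel_ge0 ?positive_part_ge0. Qed.

Lemma power_conv_ge0 a x : 0 <= power_conv g a x.
Proof. by apply: integral_ge0 => y _; exact: power_conv_integrand_ge0. Qed.

Lemma measurable_power_conv a :
  measurable_fun setT (power_conv g a : measurableTypeR R -> \bar R).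
Proof.
exact: (measurable_fun_fubini_tonelli_F (m2 := mu) _
  (measurable_power_conv_integrand a) (fun z => power_conv_integrand_ge0 a z.1 z.2)).
Qed.

Let measurable_exp (s : R) :
  measurable_fun setT (fun x : measurableTypeR R => expR (- (s * x)) : measurableTypeR R).
Proof.
by apply: measurableT_comp => //; apply: measurableT_comp => //; exact: measurable_funM.
Qed.

(** Translating by y turns the integral into a Gamma integral. *)
Lemma laplace_power_kernel (a s y : R) : (0 < a)%R -> (0 < s)%R -> (0 < y)%R ->
  \int[mu]_x (\1_pos x * expR (- (s * x)) * power_kernel a (x - y))%:E =
  (expR (- (s * y)) * s `^ (- a))%:E * gamma_integral a.
Proof.
move=> a0 s0 y0.
transitivity (\int[mu]_(x in `]y, +oo[)
    ((expR (- (s * y)))%:E * ((x - y) `^ (a - 1) * expR (- (s * (x - y))))%:E)).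
  rewrite [RHS]ge0_integral_indic//; apply: eq_integral => x _.
  have [yx|xy] := ltP y x.
    rewrite indic_pos (lt_trans y0 yx) mul1r indicE mem_set; last by rewrite /= in_itv/= yx.
    rewrite mul1e -EFinM; congr (_%:E).
    rewrite power_kernel_gt0 ?subr_gt0// mulrC [in RHS]mulrCA; congr (_ * _)%R.
    by rewrite -expRD; congr expR; ring.
  rewrite power_kernel_le0 ?subr_le0// mulr0 indicE memNset ?mul0e//.
  by rewrite /= in_itv/= andbT ltNge xy.
have mk : measurable_fun setT (fun w : R => (w `^ (a - 1) * expR (- (s * w)))%:E).
  by apply/measurable_EFinP; apply: measurable_funM; [exact: measurable_powR|exact: measurable_exp].
have k0 (w : R) : 0 <= (w `^ (a - 1) * expR (- (s * w)))%:E.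
  by rewrite lee_fin mulr_ge0 ?powR_ge0 ?expR_ge0.
rewrite ge0_integralZl//; last first.
  apply: (@measurable_funTS _ _ (measurableTypeR R)); apply: (measurableT_comp mk).
  exact: measurable_funB.
rewrite -(@ge0_integral_shift _ y (fun w => (w `^ (a - 1) * expR (- (s * w)))%:E))//.
by rewrite gamma_laplace// muleA -EFinM.
Qed.

(** Tonelli: the Laplace transform turns convolution into a product. *)
Lemma laplace_power_conv (a s : R) : (0 < a)%R -> (0 < s)%R ->
  \int[mu]_(x in pos) ((expR (- (s * x)))%:E * power_conv g a x) =
  (s `^ (- a))%:E * gamma_integral a * \int[mu]_(x in pos) (expR (- (s * x)) * g x)%:E.
Proof.
move=> a0 s0; rewrite ge0_integral_indic//.
pose F (z : measurableTypeR R * measurableTypeR R) : \bar R :=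
  (\1_pos z.1 * expR (- (s * z.1)) * (power_kernel a (z.1 - z.2) * positive_part g z.2))%:E.
have mh : measurable_fun setT (fun x : measurableTypeR R => \1_pos x * expR (- (s * x)) : measurableTypeR R)%R.
  by apply: measurable_funM; [exact: measurable_indic|exact: measurable_exp].
have mF : measurable_fun setT F.
  apply/measurable_EFinP; apply: measurable_funM.
    exact: (measurableT_comp mh measurable_fst).
  apply: measurable_funM; last exact: (measurableT_comp measurable_positive_part measurable_snd).
  by apply: (measurableT_comp (measurable_power_kernel a)); exact: measurable_funB.
have F0 z : 0 <= F z.
  rewrite /F lee_fin; apply: mulr_ge0; apply: mulr_ge0;
    by rewrite ?expR_ge0 ?power_kernel_ge0 ?positive_part_ge0 ?indic_pos ?ler0n.
transitivity (\int[mu]_x \int[mu]_y F (x, y)).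
  apply: eq_integral => x _; rewrite muleA -EFinM -ge0_integralZl//.
  - exact: (measurable_fun_pair2 x (measurable_power_conv_integrand a)).
  - by move=> y _; exact: power_conv_integrand_ge0.
rewrite fubini_tonelli//.
have g0fin : 0 <= gamma_integral a by exact/ltW/gamma_integral_gt0.
transitivity (\int[mu]_y (((s `^ (- a))%:E * gamma_integral a) *
    ((\1_pos y)%:E * (expR (- (s * y)) * g y)%:E))).
  apply: eq_integral => y _.
  have [y0|y0] := leP y 0%R.
    rewrite indic_pos ltNge y0 mul0e mule0.
    by apply: integral0_eq => x _; rewrite /F positive_part_le0// !mulr0.
  rewrite indic_pos y0 mul1e.
  transitivity (\int[mu]_x ((g y)%:E *
      (\1_pos x * expR (- (s * x)) * power_kernel a (x - y))%:E)).
    apply: eq_integral => x _; rewrite /F positive_part_gt0// -EFinM; congr (_%:E).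
    by rewrite /=; ring.
  rewrite ge0_integralZl//.
  - rewrite laplace_power_kernel// muleA -EFinM [RHS]muleC muleA -EFinM.
    by congr (_%:E * _); ring.
  - apply/measurable_EFinP; apply: measurable_funM.
      by apply: measurable_funM; [exact: measurable_indic|exact: measurable_exp].
    by apply: (measurableT_comp (measurable_power_kernel a)); exact: measurable_funB.
  - move=> x _; rewrite lee_fin indic_pos; apply: mulr_ge0; last exact: power_kernel_ge0.
    by apply: mulr_ge0; rewrite ?expR_ge0 ?ler0n.
  - by rewrite lee_fin.
rewrite ge0_integralZl//.
- by rewrite [in RHS]ge0_integral_indic.
- apply: emeasurable_funM; first by apply/measurable_EFinP; exact: measurable_indic.
  by apply/measurable_EFinP; apply: measurable_funM => //; exact: measurable_exp.
- by move=> y _; rewrite mule_ge0// lee_fin ?mulr_ge0 ?expR_ge0.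
- by rewrite mule_ge0// lee_fin powR_ge0.
Qed.

End power_kernel.

Section stable_density.
Context (R : realType).
Local Notation mu := (@lebesgue_measure R).
Local Notation pos := (`]0%R, +oo[%classic : set (measurableTypeR R)).
Variables (alpha : R) (g : R -> R).
Hypotheses (alpha_gt0 : 0 < alpha) (alpha_lt1 : alpha < 1).
Hypotheses (mg : measurable_fun setT g) (g_ge0 : forall x, 0 <= g x).
Hypothesis g_int : mu.-integrable pos (EFin \o g).
Hypothesis g_laplace : forall s : R, 0 < s ->
  (\int[mu]_(x in pos) (expR (- (s * x)) * g x) = expR (- (s `^ alpha)))%R.

Let mpos : measurable pos. Proof. exact: measurable_itv. Qed.

Lemma GammaE (a : R) : 0 < a -> gamma_integral a = (Gamma a)%:E.
Proof.
move=> a0; rewrite -[Gamma a]/(fine (gamma_integral a)) fineK// ge0_fin_numE ?gamma_integral_lty//.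
exact/ltW/gamma_integral_gt0.
Qed.

Lemma Gamma_gt0 (a : R) : 0 < a -> 0 < Gamma a.
Proof. by move=> a0; rewrite -lte_fin -GammaE// gamma_integral_gt0. Qed.

Lemma ge0_laplace_stable (s : R) : 0 < s ->
  (\int[mu]_(x in pos) (expR (- (s * x)) * g x)%:E)%E = (expR (- (s `^ alpha)))%:E.
Proof.
move=> s0; rewrite -g_laplace// /Rintegral fineK//; apply: integrable_fin_num => //.
have := integrable_stable_moment mg g_ge0 g_int 0 s0.
by apply: eq_integrable => // x _; rewrite /= expr0 mul1r.
Qed.

(** Both sides have the same Laplace transform, since Gamma(a) s^(-a) is that of y^(a-1). *)
Lemma moment_power_conv m l :
  (forall p, p \in l -> 0 <= p.1 /\ 0 < p.2) ->
  (forall s : R, 0 < s ->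
    \int[mu]_(x in pos) (x ^+ m * expR (- (s * x)) * g x) = stable_terms alpha l s) ->
  ae_eq mu pos (fun x => (x ^+ m * positive_part g x)%:E)
    (fun x => \sum_(p <- l) ((p.1 / Gamma p.2)%:E * power_conv g p.2 x))%E.
Proof.
move=> lP lE.
have lap1 (s : R) : 0 < s ->
    (\int[mu]_(x in pos) ((expR (- (s * x)))%:E * (x ^+ m * positive_part g x)%:E))%E =
    (stable_terms alpha l s)%:E.
  move=> s0; rewrite -lE// /Rintegral fineK; last first.
    apply: integrable_fin_num => //; exact: (integrable_stable_moment mg g_ge0 g_int m s0).
  apply: eq_integral => x; rewrite inE/= in_itv/= andbT => x0.
  by rewrite -EFinM positive_part_gt0//; congr (_%:E); ring.
have D20 x p : p \in l -> (0 <= (p.1 / Gamma p.2)%:E * power_conv g p.2 x)%E.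
  move=> /lP[p1 p2]; apply: mule_ge0; last exact: power_conv_ge0.
  by rewrite lee_fin divr_ge0// ltW// Gamma_gt0.
apply: laplace_density_unique.
- apply/measurable_EFinP; apply: measurable_funM; first exact: measurable_funX.
  exact: measurable_positive_part.
- apply: emeasurable_sum => p; apply: emeasurable_funM => //.
  exact: measurable_power_conv.
- move=> x; rewrite lee_fin; have [x0|x0] := leP x 0.
    by rewrite positive_part_le0// mulr0.
  by rewrite mulr_ge0 ?exprn_ge0 ?(ltW x0)// positive_part_ge0.
- by move=> x; rewrite big_seq_cond; apply: sume_ge0 => p /andP[pl _]; exact: D20.
- move=> s s0; rewrite lap1//.
  (* Padding l with the harmless pair (0, 1) makes the sign conditions total. *)
  pose P i := nth (0, 1) l i.
  have PP i : 0 <= (P i).1 /\ 0 < (P i).2.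
    have [il|li] := ltnP i (size l); first by apply: lP; exact: mem_nth.
    by rewrite /P nth_default.
  have c0 i : 0 <= (P i).1 / Gamma (P i).2.
    by have [p1 p2] := PP i; rewrite divr_ge0// ltW// Gamma_gt0.
  transitivity (\int[mu]_(x in pos) \sum_(i <- index_iota 0 (size l))
      (((P i).1 / Gamma (P i).2)%:E * ((expR (- (s * x)))%:E * power_conv g (P i).2 x)))%E; last first.
    apply: eq_integral => x _; rewrite (big_nth (0, 1)) ge0_sume_distrr; last first.
      by move=> i _; apply: mule_ge0; [rewrite lee_fin c0|exact: power_conv_ge0].
    by apply: eq_bigr => i _; rewrite muleCA.
  have mterm p : measurable_fun pos (fun x => ((expR (- (s * x)))%:E * power_conv g p x))%E.
    apply: (@measurable_funTS _ _ (measurableTypeR R)); apply: emeasurable_funM.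
      apply/measurable_EFinP; apply: measurableT_comp => //; exact: measurableT_comp.
    exact: measurable_power_conv.
  have term0 p x : (0 <= (expR (- (s * x)))%:E * power_conv g p x)%E.
    by apply: mule_ge0; rewrite ?lee_fin ?expR_ge0// power_conv_ge0.
  rewrite ge0_integral_sum//; last 2 first.
  + by move=> i; apply: emeasurable_funM.
  + by move=> i x _; apply: mule_ge0 => //; rewrite lee_fin c0.
  rewrite /stable_terms -sumEFin (big_nth (0, 1)); apply: eq_bigr => i _.
  have [p1 p2] := PP i; rewrite ge0_integralZl//; last by rewrite lee_fin c0.
  rewrite laplace_power_conv// ge0_laplace_stable// GammaE// -!EFinM; congr (_%:E).
  by rewrite -/(P i); field; rewrite gt_eqF// Gamma_gt0.
- by move=> s s0; rewrite lap1// ltry.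
Qed.

Let measurable_exp_g (s : R) :
  measurable_fun setT (fun y : measurableTypeR R => (expR (- (s * y)) * g y)%:E).
Proof.
apply/measurable_EFinP; apply: measurable_funM => //.
by apply: measurableT_comp => //; exact: measurableT_comp.
Qed.

(** On 0 < y < x the bound 1 <= e^(1 - y/x) compares the convolution with the Laplace transform of g
    at 1/x, which decays like exp(- x^(-alpha)) as x tends to 0. *)
Lemma power_conv_le (a x : R) : 1 <= a -> 0 < x ->
  (power_conv g a x <= (x `^ (a - 1) * expR 1 * expR (- (x^-1 `^ alpha)))%:E)%E.
Proof.
move=> a1 x0; have xV0 : 0 < x^-1 by rewrite invr_gt0.
rewrite [leRHS]EFinM -ge0_laplace_stable// -ge0_integralZl//; last 3 first.
- exact: (measurable_funTS (measurable_exp_g _)).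
- by move=> y _; rewrite lee_fin mulr_ge0 ?expR_ge0.
- by rewrite lee_fin mulr_ge0 ?expR_ge0 ?powR_ge0.
rewrite ge0_integral_indic//; apply: ge0_le_integral => //.
- by move=> y _; exact: power_conv_integrand_ge0.
- exact: (measurable_fun_pair2 x (measurable_power_conv_integrand mg a)).
- apply: emeasurable_funM; first by apply/measurable_EFinP; exact: measurable_indic.
  by apply: emeasurable_funM.
- move=> y _; rewrite indic_pos; have [y0|y0] := leP y 0.
    by rewrite positive_part_le0// mulr0 mul0e.
  rewrite positive_part_gt0// mul1e -EFinM lee_fin mulrA; apply: ler_wpM2r => //.
  have [xy|yx] := leP x y.
    by rewrite power_kernel_le0 ?subr_le0// !mulr_ge0 ?powR_ge0 ?expR_ge0.
  rewrite power_kernel_gt0 ?subr_gt0// -mulrA -expRD -[leLHS]mulr1.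
  apply: ler_pM => //; rewrite ?powR_ge0//.
    by apply: ge0_ler_powR; rewrite ?subr_ge0 ?nnegrE ?subr_ge0 ?(ltW yx) ?(ltW x0)// gerBl ltW.
  by rewrite -[leLHS]expR0 ler_expR subr_ge0 mulrC ler_pdivrMr ?mul1r ?(ltW yx).
Qed.

Lemma power_conv_fin_num (a x : R) : 1 <= a -> 0 < x -> power_conv g a x \is a fin_num.
Proof.
move=> a1 x0; rewrite ge0_fin_numE ?power_conv_ge0//.
by rewrite (le_lt_trans (power_conv_le a1 x0))// ltry.
Qed.

(** At 0 the exponent a - 1 > 0 makes both one-sided limits vanish. *)
Lemma continuous_power_kernel (a : R) : 1 < a -> continuous (power_kernel a : R -> R).
Proof.
move=> a1 w; have a10 : 0 < a - 1 by rewrite subr_gt0.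
have [w0|w0|->] := ltgtP w 0.
- apply: (near_cst_continuous 0); near=> z; rewrite power_kernel_le0//; apply: ltW.
  by near: z; exact: lt_nbhsl.
- rewrite /continuous_at power_kernel_gt0//.
  apply: (@cvg_trans _ ((fun z : R => z `^ (a - 1)) @ w)); last exact: continuous_powR.
  apply: near_eq_cvg; near=> z; rewrite power_kernel_gt0//.
  by near: z; exact: lt_nbhsr.
- rewrite /continuous_at power_kernel_le0//; apply/cvgrPdist_le => e e0; near=> z.
  rewrite sub0r normrN ger0_norm ?power_kernel_ge0//.
  have [z0|z0] := leP z 0; first by rewrite power_kernel_le0// ltW.
  rewrite power_kernel_gt0//.
  have -> : e = (e `^ (a - 1)^-1) `^ (a - 1).
    by rewrite -powRrM mulVf ?(gt_eqF a10)// powRr1// (ltW e0).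
  apply: ge0_ler_powR; rewrite ?nnegrE ?powR_ge0 ?(ltW a10) ?(ltW z0)//.
  by near: z; apply: nbhs0_ltW; exact: powR_gt0.
Unshelve. all: by end_near. Qed.

(** Dominated by (x + 1)^(a-1) g(y) for arguments below x + 1. *)
Lemma continuous_power_conv (a x : R) : 1 < a -> 0 < x ->
  {for x, continuous (fun z => fine (power_conv g a z))}.
Proof.
move=> a1 x0.
have Ix : `]0, (x + 1)[%classic x by rewrite /= in_itv/= x0 ltrDl ltr01.
have mp (z : R) : measurable_fun setT (fun y : measurableTypeR R => (power_kernel a (z - y) * positive_part g y)%:E).
  exact: (measurable_fun_pair2 z (measurable_power_conv_integrand mg a)).
have gpi : mu.-integrable setT (EFin \o positive_part g).
  apply/integrableP; split.
    by apply/measurable_EFinP; exact: measurable_positive_part.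
  move/integrableP : g_int => [_]; rewrite ge0_integral_indic//; apply: le_lt_trans.
  rewrite le_eqVlt; apply/orP; left; apply/eqP; apply: eq_integral => y _ /=.
  rewrite -EFinM /positive_part indic_pos normrM mulrC; congr (_ * _)%:E.
  by case: (0 < y); rewrite ?normr1 ?normr0.
pose G (y : measurableTypeR R) : R := (x + 1) `^ (a - 1) * positive_part g y.
have Gub (z : R) : `]0, (x + 1)[%classic z ->
    forall y, `|power_kernel a (z - y) * positive_part g y| <= G y.
  rewrite /= in_itv/= => /andP[z0 zx] y.
  rewrite ger0_norm; last by apply: mulr_ge0; [exact: power_kernel_ge0|exact: positive_part_ge0].
  have [y0|y0] := leP y 0; first by rewrite /G positive_part_le0// !mulr0.
  apply: ler_wpM2r; first exact: positive_part_ge0.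
  have [zy|yz] := leP z y; first by rewrite power_kernel_le0 ?subr_le0// powR_ge0.
  rewrite power_kernel_gt0 ?subr_gt0//.
  have x10 : 0 <= x + 1 by rewrite addr_ge0// ltW.
  have zy0 : 0 <= z - y by rewrite subr_ge0 ltW.
  have a10 : 0 <= a - 1 by rewrite subr_ge0 ltW.
  apply: (ge0_ler_powR a10); rewrite ?nnegrE//.
  by rewrite lerBlDr (le_trans (ltW zx))// lerDl ltW.
have Gi : mu.-integrable setT (EFin \o G).
  by apply: (eq_integrable measurableT _ _ _ (integrableZl measurableT ((x + 1) `^ (a - 1)) gpi)).
pose k (z : R) (y : measurableTypeR R) : R := power_kernel a (z - y) * positive_part g y.
have int_k : forall t : R, `]0, (x + 1)[%classic t -> mu.-integrable setT (EFin \o k t).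
  move=> t Iz; apply: (le_integrable measurableT _ _ Gi); first exact: mp.
  by move=> y _; rewrite /= lee_fin (le_trans (Gub _ Iz y))// ler_norm.
have cont_k : {ae mu, forall y, setT y -> {in `]0, (x + 1)[%classic, continuous (k ^~ y)}}.
  apply: aeW => y _ v _; apply: cvgM; last exact: cvg_cst.
  apply: (@continuous_comp _ _ _ (fun u : R => u - y)); last exact: continuous_power_kernel.
  by apply: cvgB; [exact: cvg_id|exact: cvg_cst].
have k_ub : forall t : R, `]0, (x + 1)[%classic t -> {ae mu, forall y, setT y -> `|k t y| <= G y}.
  by move=> t Iz; apply: aeW => y _; exact: Gub.
exact: (@continuity_under_integral _ _ _ _ k setT measurableT 0 (x + 1) int_k cont_k
  G Gi k_ub x (mem_set Ix)).
Qed.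

(** In terms of z = x^(-alpha) this is the boundedness of z^p e^(-z), p >= 0. *)
Lemma powR_stable_decay (q : R) : q <= 0 ->
  exists C : R, 0 < C /\ forall x : R, 0 < x -> x `^ q * expR (- (x^-1 `^ alpha)) <= C.
Proof.
move=> q0; have p0 : 0 <= - q / alpha by rewrite divr_ge0 ?oppr_ge0// ltW.
have [C [C0 CP]] := powR_expR_bounded p0; exists C; split => // x x0.
have z0 : 0 < x^-1 `^ alpha by rewrite powR_gt0// invr_gt0.
apply: le_trans (CP _ z0); rewrite -powRrM.
have -> : alpha * (- q / alpha) = - q by field; rewrite gt_eqF.
suff -> : x^-1 `^ (- q) = x `^ q by [].
by rewrite -powR_inv1 ?(ltW x0)// -powRrM mulN1r opprK.
Qed.

(** The density g is only defined almost everywhere. Its version h is read off from the m-th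
    moment formula for an m with m (1 - alpha) > 1, and the convolution identity comes from the first
    moment formula. *)
Lemma stable_density_regular : exists h : R -> R,
  [/\ measurable_fun setT h, forall x, 0 <= h x,
      forall x, 0 < x -> {for x, continuous h} &
      {ae mu, forall x, 0 < x -> g x = h x}] /\
  (exists C : R, forall x, 0 < x -> x * h x <= C /\ x `^ (1 + alpha) * h x <= C) /\
  {ae mu, forall x, 0 < x ->
    ((x * h x)%:E = (alpha / Gamma (1 - alpha))%:E * power_conv h (1 - alpha) x)%E}.
Proof.
have a10 : 0 < 1 - alpha by rewrite subr_gt0.
(* All exponents in the m-th moment formula exceed 1 once m (1 - alpha) > 1. *)
pose m := (Num.trunc (1 - alpha)^-1).+1.
have m1 : 1 < m%:R * (1 - alpha).
  by rewrite -ltr_pdivrMr// div1r truncnS_gt.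
have [l [lP lE]] := stable_moments alpha_gt0 alpha_lt1 mg g_ge0 g_int g_laplace (ltn0Sn _ : (0 < m)%N).
have l1 p : p \in l -> 1 < p.2 by move=> /lP[_ p2 _]; exact: lt_le_trans m1 p2.
have lc p : p \in l -> 0 <= p.1 / Gamma p.2.
  by move=> pl; have [p1 _ _] := lP _ pl; rewrite divr_ge0// ltW// Gamma_gt0// (lt_trans ltr01)// l1.
pose S (x : R) := \sum_(p <- l) p.1 / Gamma p.2 * fine (power_conv g p.2 x).
pose h (x : R) := S x / `|x| ^+ m * \1_pos x.
have S0 x : 0 <= S x.
  rewrite /S big_seq; apply: sumr_ge0 => p pl; apply: mulr_ge0; first exact: lc.
  by apply: fine_ge0; exact: power_conv_ge0.
have hE x : 0 < x -> h x = S x / x ^+ m.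
  by move=> x0; rewrite /h indic_pos x0 mulr1 gtr0_norm.
have h0 x : 0 <= h x.
  by rewrite /h indic_pos mulr_ge0// divr_ge0// exprn_ge0.
have mh : measurable_fun setT h.
  apply: measurable_funM; last exact: measurable_indic.
  apply: measurable_funM.
    apply: measurable_sum => p; apply: measurable_funM => //.
    by apply: measurableT_comp => //; exact: measurable_power_conv.
  apply: (@eq_measurable_fun _ _ _ _ _ (fun x : R => `|x| `^ (- m%:R))).
    by move=> x _; rewrite powRN powR_mulrn.
  by apply: (measurableT_comp (measurable_powR (- m%:R))).
have ch x : 0 < x -> {for x, continuous h}.
  move=> x0; suff : h z @[z --> x] --> S x / x ^+ m by rewrite -hE.
  apply: (@cvg_trans _ ((fun x => S x / x ^+ m) @ x)).
    apply: near_eq_cvg; near=> z; rewrite hE//; near: z; exact: lt_nbhsr.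
  suff cS : S z @[z --> x] --> S x.
    apply: (@cvgM _ _ _ _ S (fun z => (z ^+ m)^-1) _ _ cS).
    apply: cvgV; first by rewrite expf_neq0// gt_eqF.
    exact: exprn_continuous.
  rewrite /S; elim: l l1 {lP lE lc S S0 h hE h0 mh} => [|p l ih] l1.
    rewrite big_nil (_ : (fun z => _) = cst 0); first exact: cvg_cst.
    by apply/funext => z; rewrite big_nil.
  rewrite big_cons (_ : (fun z => _) = (fun z => p.1 / Gamma p.2 * fine (power_conv g p.2 z) +
    \sum_(p <- l) p.1 / Gamma p.2 * fine (power_conv g p.2 z))); last first.
    by apply/funext => z; rewrite big_cons.
  apply: cvgD; last by apply: ih => q ql; apply: l1; rewrite inE ql orbT.
  apply: cvgM; first exact: cvg_cst.
  by apply: continuous_power_conv => //; apply: l1; rewrite inE eqxx.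
have gh : {ae mu, forall x, 0 < x -> g x = h x}.
  have lP' p : p \in l -> 0 <= p.1 /\ 0 < p.2.
    by move=> pl; have [p1 _ _] := lP _ pl; rewrite (lt_trans ltr01 (l1 _ pl)).
  have := moment_power_conv lP' lE; apply: filterS => x /= H x0.
  have {}H : (x ^+ m * g x)%:E = (\sum_(p <- l) ((p.1 / Gamma p.2)%:E * power_conv g p.2 x))%E.
    by rewrite -H ?in_itv/= ?x0// positive_part_gt0.
  rewrite hE//; apply/eqP; rewrite eq_sym -subr_eq0.
  have -> : S x = x ^+ m * g x.
    apply/EFin_inj; rewrite H /S -sumEFin big_seq [in RHS]big_seq; apply: eq_bigr => p pl.
    by rewrite EFinM fineK// power_conv_fin_num// ltW// l1.
  by rewrite mulrC mulKf ?subrr// expf_neq0// gt_eqF.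
exists h; split; [by split|split].
- have bound p : p \in l -> exists C : R, forall x, 0 < x ->
     x * (p.1 / Gamma p.2 * fine (power_conv g p.2 x) / x ^+ m) <= C /\
     x `^ (1 + alpha) * (p.1 / Gamma p.2 * fine (power_conv g p.2 x) / x ^+ m) <= C.
    move=> pl; have [p1 p2 p3] := lP _ pl; have p11 := l1 _ pl.
    have q1 : p.2 - m%:R <= 0 by rewrite subr_le0 (le_trans p3)// gerBl ltW.
    have q2 : p.2 + alpha - m%:R <= 0 by rewrite subr_le0 -lerBrDr.
    have [C1 [C10 C1P]] := powR_stable_decay q1; have [C2 [C20 C2P]] := powR_stable_decay q2.
    exists (p.1 / Gamma p.2 * expR 1 * (C1 + C2)) => x x0.
    have fb : fine (power_conv g p.2 x) <= x `^ (p.2 - 1) * expR 1 * expR (- (x^-1 `^ alpha)).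
      by rewrite -lee_fin fineK ?power_conv_fin_num ?(ltW p11)// power_conv_le// ltW.
    have xm : (x ^+ m)^-1 = x `^ (- m%:R) by rewrite powRN powR_mulrn// ltW.
    have ge1 : 0 <= expR 1 :> R by exact: expR_ge0.
    have key q C : 0 <= q -> x `^ (q + (p.2 - 1) - m%:R) * expR (- (x^-1 `^ alpha)) <= C ->
        x `^ q * (p.1 / Gamma p.2 * fine (power_conv g p.2 x) / x ^+ m) <=
        p.1 / Gamma p.2 * expR 1 * C.
      move=> q0 H.
      apply: (@le_trans _ _ (p.1 / Gamma p.2 * expR 1 *
         (x `^ (q + (p.2 - 1) - m%:R) * expR (- (x^-1 `^ alpha))))); last first.
        by apply: ler_wpM2l => //; rewrite mulr_ge0// lc.
      rewrite xm (powRD (r := q + (p.2 - 1))) ?(gt_eqF x0) ?implybT// powRD ?(gt_eqF x0) ?implybT//.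
      have -> : x `^ q * (p.1 / Gamma p.2 * fine (power_conv g p.2 x) * x `^ (- m%:R)) =
        (x `^ q * (p.1 / Gamma p.2) * x `^ (- m%:R)) * fine (power_conv g p.2 x) by ring.
      have -> : p.1 / Gamma p.2 * expR 1 * (x `^ q * x `^ (p.2 - 1) * x `^ (- m%:R) * expR (- (x^-1 `^ alpha))) =
        (x `^ q * (p.1 / Gamma p.2) * x `^ (- m%:R)) * (x `^ (p.2 - 1) * expR 1 * expR (- (x^-1 `^ alpha))) by ring.
      apply: ler_wpM2l => //; apply: mulr_ge0; last exact: powR_ge0.
      by apply: mulr_ge0; [exact: powR_ge0|exact: lc].
    split.
      rewrite -[X in X * _](powRr1 (ltW x0)); apply: key => //.
      have -> : 1 + (p.2 - 1) - m%:R = p.2 - m%:R by ring.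
      by apply: (le_trans (C1P _ x0)); rewrite lerDl ltW.
    apply: key; first by rewrite addr_ge0// ltW.
    have -> : 1 + alpha + (p.2 - 1) - m%:R = p.2 + alpha - m%:R by ring.
    by apply: (le_trans (C2P _ x0)); rewrite lerDr ltW.
  suff [C CP] : exists C : R, forall x, 0 < x ->
      x * (S x / x ^+ m) <= C /\ x `^ (1 + alpha) * (S x / x ^+ m) <= C.
    by exists C => x x0; rewrite hE//; exact: CP.
  rewrite /S; elim: l bound {lP lE l1 lc S S0 h hE h0 mh ch gh} => [|p l ih] bound.
    by exists 0 => x x0; rewrite big_nil mul0r !mulr0.
  have [C1 C1P] := bound p (mem_head _ _).
  have [|C2 C2P] := ih; first by move=> q ql; apply: bound; rewrite inE ql orbT.
  exists (C1 + C2) => x x0; rewrite big_cons mulrDl !mulrDr.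
  have [a1 a2] := C1P _ x0; have [b1 b2] := C2P _ x0.
  by split; exact: lerD.
- have E1 : forall s : R, 0 < s ->
      \int[mu]_(x in pos) (x ^+ 1 * expR (- (s * x)) * g x) = stable_terms alpha [:: (alpha, 1 - alpha)] s.
    by move=> s s0; apply: stable_moment1.
  have P1 (p : R * R) : p \in [:: (alpha, 1 - alpha)] -> 0 <= p.1 /\ 0 < p.2.
    by rewrite inE => /eqP -> /=; split => //; exact: ltW.
  have := moment_power_conv P1 E1.
  have convE x : power_conv h (1 - alpha) x = power_conv g (1 - alpha) x.
    apply: ge0_ae_eq_integral => //.
    - exact: (measurable_fun_pair2 x (measurable_power_conv_integrand mh (1 - alpha))).
    - exact: (measurable_fun_pair2 x (measurable_power_conv_integrand mg (1 - alpha))).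
    - by move=> y _; exact: power_conv_integrand_ge0.
    - by move=> y _; exact: power_conv_integrand_ge0.
    - apply: (@filterS _ _ (ae_filter_ringOfSetsType mu) _ _ _ gh) => y /= H _.
      have [y0|y0] := leP y 0; first by rewrite !positive_part_le0.
      by rewrite !positive_part_gt0// H.
  move=> H1; have := @filterI _ _ (ae_filter_ringOfSetsType mu) _ _ gh H1.
  apply: filterS => x /= [gx H] x0; rewrite convE.
  have := H _; rewrite in_itv/= x0 => /(_ isT).
  by rewrite big_seq1/= positive_part_gt0// expr1 gx.
Unshelve. all: by end_near. Qed.

End stable_density.

(** * The inverse stable density and its fractional integral *)

Section inverse_stable_kernel.
Context (R : realType).
Local Notation mu := (@lebesgue_measure R).
Local Notation pos := (`]0%R, +oo[%classic : set (measurableTypeR R)).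
Implicit Types t v x y tau : R.
Variables (alpha : R) (g rho : R -> R) (C : R).
Hypotheses (alpha_gt0 : 0 < alpha) (alpha_lt1 : alpha < 1).
Hypotheses (mg : measurable_fun setT g) (g_ge0 : forall x, 0 <= g x).
Hypotheses (mrho : measurable_fun setT rho) (rho_ge0 : forall x, 0 <= rho x)
  (crho : forall x, 0 < x -> {for x, continuous rho})
  (g_rho : {ae mu, forall x, 0 < x -> g x = rho x})
  (rho_le : forall x, 0 < x -> x * rho x <= C /\ x `^ (1 + alpha) * rho x <= C)
  (rho_conv : {ae mu, forall x, 0 < x ->
    ((x * rho x)%:E = (alpha / Gamma (1 - alpha))%:E * power_conv rho (1 - alpha) x)%E}).
Hypothesis rho_int : mu.-integrable pos (EFin \o rho).
Hypothesis rho1 : \int[mu]_(x in pos) rho x = 1.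

Let mpos : measurable pos. Proof. exact: measurable_itv. Qed.
Let aegt0 : 0 < alpha^-1. Proof. by rewrite invr_gt0. Qed.

Lemma C_ge0 : 0 <= C.
Proof. by have [+ _] := rho_le ltr01; apply: le_trans; rewrite mulr_ge0. Qed.

Definition cdf (x : R) : R := \int[mu]_(y in `[0, x]) rho y.

Let rho_int_itv x : mu.-integrable `[0, x] (EFin \o rho).
Proof.
apply/integrableP; split.
  by apply/measurable_EFinP; exact: measurable_funTS.
rewrite -integral_itv_obnd_cbnd; last first.
  apply: measurableT_comp => //; apply/measurable_EFinP; exact: measurable_funTS.
have /integrableP[mr] := rho_int; apply: le_lt_trans; apply: ge0_subset_integral => //.
  by apply: measurableT_comp => //; exact: mr.
by move=> y; rewrite /= !in_itv/= => /andP[-> _].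
Qed.

Lemma cdf_ge0 x : 0 <= cdf x.
Proof. by apply: Rintegral_ge0 => y _. Qed.

Lemma cdf_le1 x : cdf x <= 1.
Proof.
rewrite -rho1 /cdf /Rintegral -lee_fin !fineK; try exact: integrable_fin_num.
rewrite -integral_itv_obnd_cbnd; last by apply/measurable_EFinP; exact: measurable_funTS.
apply: ge0_subset_integral => //.
- by apply/measurable_EFinP; exact: measurable_funTS.
- by move=> y _; rewrite lee_fin.
- by move=> y; rewrite /= !in_itv/= => /andP[-> _].
Qed.

Lemma is_derive_cdf x : 0 < x -> is_derive x 1 cdf (rho x).
Proof.
move=> x0; have xx1 : x < x + 1 by rewrite ltrDl.
have [d1 d2] := continuous_FTC1_closed xx1 (rho_int_itv _) x0 (crho x0).
by apply: DeriveDef; [exact: d1|rewrite -derive1E; exact: d2].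
Qed.

Let arg (t v : R) := t * v `^ (- alpha^-1).

Let arg_gt0 t v : 0 < t -> 0 < v -> 0 < arg t v.
Proof. by move=> t0 v0; rewrite mulr_gt0// powR_gt0. Qed.

Let continuous_arg t v : 0 < v -> {for v, continuous (arg t)}.
Proof.
by move=> v0; apply: cvgM; [exact: cvg_cst|exact: continuous_powR].
Qed.

Let continuous_cdf_arg t v : 0 < t -> 0 < v -> {for v, continuous (cdf \o arg t)}.
Proof.
move=> t0 v0; apply: continuous_comp; first exact: continuous_arg.
apply: differentiable_continuous; apply/derivable1_diffP.
by have [] := is_derive_cdf (arg_gt0 t0 v0).
Qed.

Variable q : R -> R.
Hypotheses (q_ge0 : forall v, 0 < v -> 0 <= q v) (q_int : mu.-integrable pos (EFin \o q)).

Let mq : measurable_fun pos q.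
Proof. by apply/measurable_EFinP; exact: (measurable_int mu q_int). Qed.

(** The function J_q of the overview: cdf (t v^(-1/alpha)) is the probability that the first passage
    time at level t exceeds v. *)
Definition mixed_cdf (t : R) : R := \int[mu]_(v in pos) (q v * cdf (arg t v)).

Lemma integrable_mixed_cdf t : 0 < t ->
  mu.-integrable pos (EFin \o (fun v => q v * cdf (arg t v))).
Proof.
move=> t0; apply: (le_integrable mpos _ _ q_int).
  apply/measurable_EFinP; apply: measurable_funM => //.
  apply: open_continuous_measurable_fun; first exact: interval_open.
  by move=> v; rewrite inE/= in_itv/= andbT => v0; exact: continuous_cdf_arg.
move=> v _; rewrite /= lee_fin normrM ler_piMr//.
by rewrite ger0_norm ?cdf_ge0// cdf_le1.
Qed.

Let slope t v := q v * (v `^ (- alpha^-1) * rho (arg t v)).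

Let slope_ge0 t v : 0 < v -> 0 <= slope t v.
Proof. by move=> v0; rewrite mulr_ge0 ?q_ge0// mulr_ge0// powR_ge0. Qed.

Let slope_le t v : 0 < t -> 0 < v -> slope t v <= q v * (C / t).
Proof.
move=> t0 v0; apply: ler_wpM2l; first exact: q_ge0.
rewrite ler_pdivlMr// mulrC mulrA.
by have [+ _] := rho_le (arg_gt0 t0 v0); exact: le_trans.
Qed.

Let measurable_slope t : measurable_fun pos (slope t).
Proof.
apply: measurable_funM => //; apply: measurable_funTS; apply: measurable_funM.
  exact: measurable_powR.
apply: (measurableT_comp mrho); apply: measurable_funM => //; exact: measurable_powR.
Qed.

Lemma integrable_slope t : 0 < t -> mu.-integrable pos (EFin \o slope t).
Proof.
move=> t0; apply: (le_integrable mpos _ _ (integrableZl mpos (C / t) q_int)).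
  by apply/measurable_EFinP; exact: measurable_slope.
move=> v; rewrite /= in_itv/= andbT => v0; rewrite lee_fin ger0_norm ?slope_ge0//.
apply: (le_trans (slope_le t0 v0)); rewrite mulrC; exact: ler_norm.
Qed.

(** The bound on x rho(x) dominates the derivative by a multiple of q, locally uniformly in t. *)
Lemma is_derive_mixed_cdf (t : R) : 0 < t ->
  is_derive t 1 mixed_cdf (\int[mu]_(v in pos) slope t v).
Proof.
move=> t0; have t20 : 0 < t / 2 by rewrite divr_gt0.
have It : `](t / 2), (t + 1)[%classic t.
  by rewrite /= in_itv/= ltr_pdivrMr// ltr_pMr// ltr1n ltrDl ltr01.
pose f (x v : R) : R := q v * cdf (arg x v).
have derf (x v : R) : 0 < x -> 0 < v -> is_derive x 1 (f ^~ v) (slope x v).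
  move=> x0 v0.
  have -> : slope x v = q v *: (rho (arg x v) * v `^ (- alpha^-1)).
    by rewrite /slope /GRing.scale /=; ring.
  rewrite (_ : f ^~ v = q v \*: (cdf \o (fun x => arg x v))); last by apply/funext.
  apply: is_deriveZ; apply: is_derive1_comp; first exact: is_derive_cdf (arg_gt0 x0 v0).
  rewrite (_ : (fun x => _) = (v `^ (- alpha^-1)) \*: id); last first.
    by apply/funext => z; rewrite /= /GRing.scale /= mulrC.
  by rewrite -[X in is_derive _ _ _ X]mulr1; exact: is_deriveZ.
have pI (x : R) : `](t / 2), (t + 1)[%classic x -> 0 < x.
  by rewrite /= in_itv/= => /andP[+ _]; exact: lt_trans.
have intf (x : R) : `](t / 2), (t + 1)[%classic x -> mu.-integrable pos (EFin \o f x).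
  by move=> /pI; exact: integrable_mixed_cdf.
have pv (v : R) : pos v -> 0 < v by rewrite /= in_itv/= andbT.
have derf1 (x v : R) : `](t / 2), (t + 1)[%classic x -> pos v -> derivable (f ^~ v) x 1.
  by move=> /pI x0 /pv v0; have [] := derf x v x0 v0.
pose G (v : R) : R := `|q v| * (C / (t / 2)).
have intG : mu.-integrable pos (EFin \o G).
  have := integrableZl mpos (C / (t / 2)) (integrable_norm q_int).
  by apply: eq_integrable => // v _; rewrite /= -EFinM mulrC.
have G0 (v : R) : 0 <= G v by rewrite mulr_ge0// divr_ge0 ?C_ge0// ltW.
have G_ub (x v : R) : `](t / 2), (t + 1)[%classic x -> pos v -> `|partial1of2 f x v| <= G v.
  move=> Ix /pv v0; have x0 := pI _ Ix.
  rewrite partial1of2E (derive_val (is_derive := derf x v x0 v0)).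
  rewrite ger0_norm ?slope_ge0//; apply: (le_trans (slope_le x0 v0)).
  rewrite /G ger0_norm ?q_ge0//; apply: ler_wpM2l; first exact: q_ge0.
  apply: ler_wpM2l; first exact: C_ge0.
  by rewrite lef_pV2 ?posrE//; move: Ix; rewrite /= in_itv/= => /andP[/ltW].
apply: DeriveDef; first exact: (derivable_under_integral mpos It intf derf1 G0 intG G_ub).
rewrite -derive1E (differentiation_under_integral mpos It intf derf1 G0 intG G_ub).
apply: eq_Rintegral => v; rewrite inE => /pv v0.
by rewrite partial1of2E; apply: (derive_val (is_derive := derf t v t0 v0)).
Qed.

Local Notation inverse_density := (inverse_stable_density alpha g).

(** Writing x = t v^(-1/alpha), the density is x rho(x) / (alpha v). *)
Lemma inverse_densityE t : 0 < t ->
  {ae mu, forall v, 0 < v -> inverse_density t v = arg t v * rho (arg t v) / (alpha * v)}.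
Proof.
move=> t0; apply: (@filterS _ _ (ae_filter_ringOfSetsType mu) _ _ _ (ae_powRN t0 aegt0 g_rho)) => v /= gE v0.
rewrite /inverse_stable_density -powRN gE//.
rewrite powRD ?(gt_eqF v0) ?implybT// powRr1 ?(ltW v0)// /arg powRN.
have ? : v `^ alpha^-1 != 0 by rewrite gt_eqF// powR_gt0.
by field; apply/and3P; split => //; rewrite gt_eqF.
Qed.

(** With x as above, 1/v = x^alpha t^(-alpha), so the bound on x^(1+alpha) rho(x) applies. *)
Lemma inverse_density_le t : 0 < t ->
  {ae mu, forall v, 0 < v -> 0 <= inverse_density t v <= C * (t `^ (- alpha) / alpha)}.
Proof.
move=> t0; apply: (@filterS _ _ (ae_filter_ringOfSetsType mu) _ _ _ (inverse_densityE t0)) => v /= + v0 => /(_ v0) ->.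
have x0 := arg_gt0 t0 v0.
have vE : v^-1 = arg t v `^ alpha * t `^ (- alpha).
  rewrite /arg powRM ?powR_ge0 ?(ltW t0)// -powRrM mulNr mulVf ?gt_eqF// powR_inv1 ?(ltW v0)//.
  rewrite powRN; field; apply/andP; split; first by rewrite gt_eqF// powR_gt0.
  by rewrite gt_eqF.
apply/andP; split; first by rewrite divr_ge0// mulr_ge0// ltW.
have [_ H] := rho_le x0.
have -> : arg t v * rho (arg t v) / (alpha * v) =
    (arg t v `^ (1 + alpha) * rho (arg t v)) * (t `^ (- alpha) / alpha).
  rewrite invfM vE powRD ?(gt_eqF x0) ?implybT// powRr1 ?(ltW x0)//; ring.
by apply: ler_wpM2r H; rewrite divr_ge0 ?powR_ge0// ltW.
Qed.

(** The convolution identity for rho at t v^(-1/alpha), transported by tau = v^(1/alpha) y. *)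
Lemma frac_integral_slope t : 0 < t ->
  {ae mu, forall v, 0 < v ->
    (\int[mu]_tau (power_kernel (1 - alpha) (t - tau) * (\1_pos tau *
        (v `^ (- alpha^-1) * rho (arg tau v))))%:E)%E =
    (Gamma (1 - alpha) * inverse_density t v)%:E}.
Proof.
move=> t0; have a10 : 0 < 1 - alpha by rewrite subr_gt0.
have g10 := Gamma_gt0 a10.
have ae1 := ae_powRN t0 aegt0 rho_conv; have ae2 := inverse_densityE t0.
have := @filterI _ _ (ae_filter_ringOfSetsType mu) _ _ ae1 ae2.
apply: (@filterS _ _ (ae_filter_ringOfSetsType mu)) => v /= [convE densE] v0.
rewrite (densE v0); have {}convE := convE v0; rewrite -/(arg t v) in convE.
pose c := v `^ alpha^-1; have c0 : 0 < c by rewrite powR_gt0.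
have cV : v `^ (- alpha^-1) = c^-1 by rewrite powRN.
have cA : c `^ (- alpha) = v^-1.
  by rewrite /c -powRrM mulrN mulVf ?gt_eqF// powR_inv1// ltW.
pose k (tau : R) : \bar R := (power_kernel (1 - alpha) (t - tau) * (c^-1 * rho (tau * c^-1)))%:E.
have mk : measurable_fun setT k.
  apply/measurable_EFinP; apply: measurable_funM.
    by apply: (measurableT_comp (measurable_power_kernel _)); exact: measurable_funB.
  by apply: measurable_funM => //; apply: (measurableT_comp mrho); exact: measurable_funM.
have k0 tau : (0 <= k tau)%E.
  by rewrite lee_fin mulr_ge0 ?power_kernel_ge0// mulr_ge0// invr_ge0 ltW.
transitivity (\int[mu]_(tau in pos) k tau)%E.
  rewrite [RHS]ge0_integral_indic//; apply: eq_integral => tau _.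
  by rewrite -EFinM /k /arg cV; congr (_%:E); ring.
rewrite (ge0_integral_scale c0 mk k0).
transitivity (\int[mu]_(y in pos) ((v^-1)%:E * (power_kernel (1 - alpha) (arg t v - y) * rho y)%:E))%E.
  apply: eq_integral => y; rewrite inE/= in_itv/= andbT => y0.
  rewrite /k -!EFinM; congr (_%:E).
  have -> : c * y * c^-1 = y by field; rewrite gt_eqF.
  have xE : t - c * y = c * (arg t v - y) by rewrite /arg cV; field; rewrite gt_eqF.
  rewrite xE; have [xy|yx] := leP (arg t v - y) 0.
    have cxy : c * (arg t v - y) <= 0 by apply: mulr_ge0_le0 => //; exact: ltW.
    by rewrite !power_kernel_le0// !mul0r !mulr0.
  rewrite !power_kernel_gt0 ?mulr_gt0// powRM ?(ltW c0) ?(ltW yx)//.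
  rewrite (_ : 1 - alpha - 1 = - alpha); last by ring.
  by rewrite cA; field; rewrite !gt_eqF.
have mj : measurable_fun pos (fun y => (power_kernel (1 - alpha) (arg t v - y) * rho y)%:E).
  apply: (@measurable_funTS _ _ (measurableTypeR R)); apply/measurable_EFinP; apply: measurable_funM => //.
  by apply: (measurableT_comp (measurable_power_kernel _)); exact: measurable_funB.
rewrite ge0_integralZl//; last 2 first.
- by move=> y _; rewrite lee_fin mulr_ge0// power_kernel_ge0.
- by rewrite lee_fin invr_ge0 ltW.
have -> : (\int[mu]_(y in pos) (power_kernel (1 - alpha) (arg t v - y) * rho y)%:E =
    power_conv rho (1 - alpha) (arg t v))%E.
  rewrite ge0_integral_indic//; apply: eq_integral => y _.
  by rewrite -EFinM /positive_part; congr (_%:E); ring.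
have -> : power_conv rho (1 - alpha) (arg t v) =
    (Gamma (1 - alpha) / alpha * (arg t v * rho (arg t v)))%:E.
  rewrite EFinM convE muleA -EFinM (_ : _ / _ * _ = 1) ?mul1e//.
  by field; rewrite !gt_eqF.
by rewrite -EFinM; congr (_%:E); field; rewrite !gt_eqF.
Qed.

Lemma measurable_inverse_density t : measurable_fun setT (inverse_density t).
Proof.
apply: measurable_funM.
  apply: measurable_funM => //.
  apply: (@eq_measurable_fun _ _ _ _ _ (fun v => (alpha^-1 * v `^ (- (1 + alpha^-1))))).
    by move=> v _; rewrite invfM -powRN.
  by apply: measurable_funM => //; exact: measurable_powR.
apply: (measurableT_comp mg).
apply: (@eq_measurable_fun _ _ _ _ _ (fun v => (t * v `^ (- alpha^-1)))).
  by move=> v _; rewrite -powRN.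
by apply: measurable_funM => //; exact: measurable_powR.
Qed.

Let measurable_q_density t : measurable_fun pos (fun v => q v * inverse_density t v).
Proof.
by apply: measurable_funM => //; apply: measurable_funTS; exact: measurable_inverse_density.
Qed.

Lemma integrable_inverse_density t : 0 < t ->
  mu.-integrable pos (EFin \o (fun v => q v * inverse_density t v)).
Proof.
move=> t0; apply/integrableP; split; first by apply/measurable_EFinP; exact: measurable_q_density.
have /integrableP[_] := integrableZl mpos (C * (t `^ (- alpha) / alpha)) q_int.
apply: le_lt_trans; apply: ae_ge0_le_integral => //.
- by apply: measurableT_comp => //; apply/measurable_EFinP; exact: measurable_q_density.
- by apply: measurableT_comp => //; apply: emeasurable_funM => //; exact/measurable_EFinP.
- apply: (@filterS _ _ (ae_filter_ringOfSetsType mu) _ _ _ (inverse_density_le t0)) => v /= + /[!in_itv]/= /andP[v0 _] => /(_ v0) /andP[d0 d1].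
  rewrite lee_fin [leLHS]normrM [leRHS]normrM mulrC; apply: ler_wpM2r => //.
  by rewrite ger0_norm// (le_trans d1)// ler_norm.
Qed.

(** Tonelli exchanges the fractional integral in tau with the mixture in v; for almost every v the
    inner integral is the density. *)
Lemma frac_integral_mixed_cdf t : 0 < t ->
  measurable_fun (`]0, t[%classic : set (measurableTypeR R))
    (fun tau => (derive1 mixed_cdf tau / (t - tau) `^ alpha)%:E) /\
  (\int[mu]_(tau in `]0%R, t[) (derive1 mixed_cdf tau / (t - tau) `^ alpha)%:E =
  (Gamma (1 - alpha))%:E * \int[mu]_(v in pos) (q v * inverse_density t v)%:E)%E.
Proof.
move=> t0; have a10 : 0 < 1 - alpha by rewrite subr_gt0.
have g10 := Gamma_gt0 a10.
pose F (z : measurableTypeR R * measurableTypeR R) : \bar R :=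
  ((power_kernel (1 - alpha) (t - z.1) * \1_pos z.1) * ((q \_ pos) z.2 *
     (z.2 `^ (- alpha^-1) * rho (arg z.1 z.2))))%:E.
have mqp : measurable_fun setT (q \_ pos : measurableTypeR R -> measurableTypeR R).
  by apply/(measurable_restrictT _ mpos).
have mpow : measurable_fun setT (fun v : measurableTypeR R => v `^ (- alpha^-1) : measurableTypeR R).
  exact: measurable_powR.
have mker : measurable_fun setT (fun x : measurableTypeR R => power_kernel (1 - alpha) (t - x) * \1_pos x : measurableTypeR R).
  apply: measurable_funM; last exact: measurable_indic.
  by apply: (measurableT_comp (measurable_power_kernel _)); exact: measurable_funB.
have mF : measurable_fun setT F.
  apply/measurable_EFinP; apply: measurable_funM.
    exact: (measurableT_comp mker measurable_fst).
  apply: measurable_funM; first exact: (measurableT_comp mqp measurable_snd).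
  apply: measurable_funM; first exact: (measurableT_comp mpow measurable_snd).
  apply: (measurableT_comp mrho); apply: measurable_funM; first exact: measurable_fst.
  exact: (measurableT_comp mpow measurable_snd).
have qp0 (v : R) : 0 <= (q \_ pos) v.
  by rewrite patchE; case: ifPn => //; rewrite inE/= in_itv/= andbT => /q_ge0.
have F0 z : (0 <= F z)%E.
  rewrite /F lee_fin; apply: mulr_ge0.
    by rewrite indic_pos mulr_ge0 ?power_kernel_ge0.
  by rewrite mulr_ge0// mulr_ge0// powR_ge0.
have qpE (v : R) : 0 < v -> (q \_ pos) v = q v.
  by move=> v0; rewrite patchE mem_set//= in_itv/= v0.
have qp00 (v : R) : v <= 0 -> (q \_ pos) v = 0.
  by move=> v0; rewrite patchE memNset//= in_itv/= andbT; apply/negP; rewrite -leNgt.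
have mz z : measurable_fun setT (fun v : measurableTypeR R => F (z, v)).
  exact: (measurable_fun_pair2 z mF).
have mz' v : measurable_fun setT (fun z : measurableTypeR R => F (z, v)).
  exact: (measurable_fun_pair1 v mF).
have FE tau : ((\1_(`]0, t[) tau)%:E * (derive1 mixed_cdf tau / (t - tau) `^ alpha)%:E =
    \int[mu]_v F (tau, v))%E.
  have [tau0|tau0] := leP tau 0.
    rewrite indicE memNset ?mul0e; last by rewrite /= in_itv/= ltNge tau0.
    by apply/esym/integral0_eq => v _; rewrite /F indic_pos/= ltNge tau0 mulr0 mul0r.
  have [ttau|taut] := leP t tau.
    rewrite indicE memNset ?mul0e; last by rewrite /= in_itv/= [tau < t]ltNge ttau andbF.
    by apply/esym/integral0_eq => v _; rewrite /F power_kernel_le0 ?subr_le0// !mul0r.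
  rewrite indicE mem_set ?mul1e; last by rewrite /= in_itv/= tau0.
  rewrite derive1E (derive_val (is_derive := is_derive_mixed_cdf tau0)).
  rewrite mulrC EFinM /Rintegral fineK; last by apply: integrable_fin_num => //; exact: integrable_slope.
  rewrite -ge0_integralZl//; last 3 first.
  - by apply/measurable_EFinP; exact: measurable_slope.
  - by move=> v; rewrite /= in_itv/= andbT => v0; rewrite lee_fin slope_ge0.
  - by rewrite lee_fin invr_ge0 powR_ge0.
  rewrite [LHS]ge0_integral_indic//; apply: eq_integral => v _.
  rewrite /F /= power_kernel_gt0 ?subr_gt0// (indic_pos tau) tau0 mulr1.
  rewrite (_ : 1 - alpha - 1 = - alpha); last by ring.
  rewrite powRN indic_pos; have [v0|v0] := leP v 0.
    by rewrite mul0e qp00// mul0r mulr0.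
  by rewrite mul1e qpE// -EFinM.
split.
  have mt : measurable (`]0, t[%classic : set (measurableTypeR R)) by exact: measurable_itv.
  apply/(measurable_restrictT _ mt).
  apply: (@eq_measurable_fun _ _ _ _ _ (fun tau => \int[mu]_v F (tau, v))%E).
    by move=> tau _; rewrite -FE patchE indicE; case: ifPn => vp; rewrite ?mul1e ?mul0e.
  exact: measurable_fun_fubini_tonelli_F.
transitivity (\int[mu]_tau \int[mu]_v F (tau, v))%E.
  by rewrite ge0_integral_indic//; apply: eq_integral => tau _; exact: FE.
rewrite fubini_tonelli//.
have d0 (v : R) : pos v -> 0 <= q v * inverse_density t v.
  rewrite /= in_itv/= andbT => v0; rewrite mulr_ge0 ?q_ge0//.
  by rewrite mulr_ge0// divr_ge0 ?(ltW t0)// mulr_ge0 ?powR_ge0// ltW.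
rewrite -ge0_integralZl//; last 2 first.
- by apply/measurable_EFinP; exact: measurable_q_density.
- by rewrite lee_fin ltW.
rewrite [RHS]ge0_integral_indic//; apply: ge0_ae_eq_integral => //.
- exact: measurable_fun_fubini_tonelli_G.
- apply: (@eq_measurable_fun _ _ _ _ _ ((fun v => (Gamma (1 - alpha))%:E * (q v * inverse_density t v)%:E)%E \_ pos)).
    by move=> v _; rewrite patchE indicE; case: ifPn => vp; rewrite ?mul1e ?mul0e.
  apply/(measurable_restrictT _ mpos); apply: emeasurable_funM => //.
  by apply/measurable_EFinP; exact: measurable_q_density.
- by move=> v _; apply: integral_ge0.
- move=> v _; rewrite indic_pos; have [v0|v0] := leP v 0; first by rewrite mul0e.
  by rewrite mul1e mule_ge0// lee_fin ?(ltW g10)// d0//= in_itv/= v0.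
apply: (@filterS _ _ (ae_filter_ringOfSetsType mu) _ _ _ (frac_integral_slope t0)) => v /= H _.
have [v0|v0] := leP v 0.
  rewrite indic_pos ltNge v0 mul0e.
  by apply: integral0_eq => tau _; rewrite /F qp00// mul0r mulr0.
rewrite indic_pos v0 mul1e.
transitivity (\int[mu]_tau ((q v)%:E * (power_kernel (1 - alpha) (t - tau) * (\1_pos tau *
        (v `^ (- alpha^-1) * rho (arg tau v))))%:E))%E.
  by apply: eq_integral => tau _; rewrite /F qpE// -EFinM; congr (_%:E); rewrite /=; ring.
rewrite ge0_integralZl//.
- by rewrite (H v0) -!EFinM; congr (_%:E); ring.
- apply/measurable_EFinP; apply: measurable_funM.
    by apply: (measurableT_comp (measurable_power_kernel _)); exact: measurable_funB.
  apply: measurable_funM; first exact: measurable_indic.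
  by apply: measurable_funM => //; apply: (measurableT_comp mrho); exact: measurable_funM.
- move=> tau _; rewrite lee_fin indic_pos mulr_ge0 ?power_kernel_ge0// mulr_ge0//.
  by rewrite mulr_ge0// powR_ge0.
- by rewrite lee_fin q_ge0.
Qed.

(** Stated with g and the indicator of an open ray, the form in which the laws of L(v) produce it. *)
Lemma cdfE x : (\int[mu]_(y in pos) ((\1_(`]-oo, x[) y)%:E * (g y)%:E))%E = (cdf x)%:E.
Proof.
have mray : measurable_fun setT (fun y : measurableTypeR R => (\1_(`]-oo, x[) y)%:E : \bar R).
  by apply/measurable_EFinP; exact: measurable_indic.
transitivity (\int[mu]_(y in pos) ((\1_(`]-oo, x[) y)%:E * (rho y)%:E))%E.
  apply: ge0_ae_eq_integral => //.
  - apply: (@measurable_funTS _ _ (measurableTypeR R)); apply: emeasurable_funM => //; exact/measurable_EFinP.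
  - apply: (@measurable_funTS _ _ (measurableTypeR R)); apply: emeasurable_funM => //; exact/measurable_EFinP.
  - by move=> y _; rewrite mule_ge0// lee_fin.
  - by move=> y _; rewrite mule_ge0// lee_fin.
  - apply: (@filterS _ _ (ae_filter_ringOfSetsType mu) _ _ _ g_rho) => y /= H.
    by rewrite in_itv/= andbT => /H ->.
rewrite /cdf /Rintegral fineK; last exact: integrable_fin_num.
rewrite -integral_itv_obnd_cbnd; last by apply/measurable_EFinP; exact: measurable_funTS.
rewrite -integral_itv_bndo_bndc; last by apply/measurable_EFinP; exact: measurable_funTS.
rewrite [LHS]ge0_integral_indic// [RHS]ge0_integral_indic//; apply: eq_integral => y _.
rewrite -!EFinM mulrA; congr (_%:E); congr (_ * _); rewrite !indicE -natrM mulnb; congr (_%:R).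
congr nat_of_bool; apply/andP/idP; rewrite !inE/= !in_itv/= ?andbT; first by move=> [-> ->].
by move=> /andP[-> ->].
Qed.

(** The substitution y = t u^(-1/alpha) reverses the order: u > v becomes y < t v^(-1/alpha). *)
Lemma tail_inverse_density t v : 0 < t -> 0 < v ->
  (\int[mu]_(u in `]v, +oo[) (inverse_density t u)%:E = (cdf (arg t v))%:E)%E.
Proof.
move=> t0 v0; rewrite -cdfE.
pose k (y : R) : \bar R := ((\1_(`]-oo, (arg t v)[) y)%:E * (g y)%:E)%E.
have mk : measurable_fun setT k.
  apply: emeasurable_funM; last exact/measurable_EFinP.
  by apply/measurable_EFinP; exact: measurable_indic.
have k0 y : (0 <= k y)%E by rewrite mule_ge0// lee_fin.
rewrite (ge0_integral_powRN t0 aegt0 mk k0) [LHS]ge0_integral_indic// [RHS]ge0_integral_indic//; apply: eq_integral => u _.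
rewrite indic_pos indicE; have [u0|u0] := leP u 0.
  by rewrite mul0e memNset ?mul0e//= in_itv/= andbT; apply/negP; rewrite -leNgt (le_trans u0)// ltW.
rewrite mul1e /k indicE.
have -> : (t * u `^ (- alpha^-1) \in `]-oo, (arg t v)[%classic) = (u \in `]v, +oo[%classic).
  apply/idP/idP; rewrite !inE/= !in_itv/= andbT /arg ltr_pM2l// !powRN ltf_pV2 ?posrE ?powR_gt0//.
    by rewrite !ltNge; apply: contra => uv; apply: ge0_ler_powR; rewrite ?nnegrE ?(ltW aegt0) ?(ltW v0) ?(ltW u0).
  by move=> vu; apply: gt0_ltr_powR; rewrite ?nnegrE ?(ltW v0) ?(ltW u0).
rewrite -!EFinM; congr (_%:E).
rewrite /inverse_stable_density invfM -!powRN (_ : - (1 + alpha^-1) = - alpha^-1 - 1); last by ring.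
ring.
Qed.

Lemma integral_inverse_density t : 0 < t ->
  (\int[mu]_(u in pos) (inverse_density t u)%:E = 1)%E.
Proof.
move=> t0.
have <- : (\int[mu]_(y in pos) (g y)%:E = 1)%E.
  transitivity (\int[mu]_(y in pos) (rho y)%:E)%E.
    apply: ge0_ae_eq_integral => //.
    - by apply: (@measurable_funTS _ _ (measurableTypeR R)); exact/measurable_EFinP.
    - by apply: (@measurable_funTS _ _ (measurableTypeR R)); exact/measurable_EFinP.
    - by move=> y _; rewrite lee_fin.
    - by move=> y _; rewrite lee_fin.
    - apply: (@filterS _ _ (ae_filter_ringOfSetsType mu) _ _ _ g_rho) => y /= H.
      by rewrite in_itv/= andbT => /H ->.
  by rewrite -rho1 /Rintegral fineK//; exact: integrable_fin_num.
have mk : measurable_fun setT (fun y : R => (g y)%:E) by exact/measurable_EFinP.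
have k0 y : (0 <= (g y)%:E)%E by rewrite lee_fin.
rewrite (ge0_integral_powRN t0 aegt0 mk k0); apply: eq_integral => u _.
rewrite -EFinM; congr (_%:E).
rewrite /inverse_stable_density invfM -!powRN (_ : - (1 + alpha^-1) = - alpha^-1 - 1); last by ring.
ring.
Qed.

End inverse_stable_kernel.

(** * Poisson masses along the cumulative intensity *)

Section poisson_calculus.
Context (R : realType).
Local Notation mu := (@lebesgue_measure R).
Implicit Types m M : R.

Lemma poisson_mass_ge0 m k : 0 <= m -> 0 <= poisson_mass m k.
Proof. by move=> m0; rewrite /poisson_mass divr_ge0// mulr_ge0 ?expR_ge0 ?exprn_ge0. Qed.

Let is_derive_expN m : is_derive m 1 (fun x => expR (- x)) (- expR (- m)).
Proof.
rewrite -[X in is_derive _ _ _ X]mulrN1; apply: (@is_derive1_comp _ expR (fun x => - x)).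
Qed.

Lemma is_derive_poisson_mass0 m : is_derive m 1 ((@poisson_mass R)^~ 0%N) (- poisson_mass m 0).
Proof.
rewrite /poisson_mass (_ : (fun x => _) = (fun x => expR (- x))); last first.
  by apply/funext => x; rewrite expr0 fact0 mulr1 divr1.
by rewrite expr0 fact0 mulr1 divr1; exact: is_derive_expN.
Qed.

Lemma is_derive_poisson_massS m k :
  is_derive m 1 ((@poisson_mass R)^~ k.+1) (poisson_mass m k - poisson_mass m k.+1).
Proof.
rewrite /poisson_mass (_ : (fun x => _) =
    (k.+1`!%:R^-1) \*: ((fun x : R => expR (- x)) * (fun x => x ^+ k.+1))); last first.
  by apply/funext => x; rewrite /= /GRing.scale /= mulrC.
have dX : is_derive m 1 (fun x : R => x ^+ k.+1) (k.+1%:R * m ^+ k).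
  apply: DeriveDef; first exact: exprn_derivable.
  by rewrite exp_derive /GRing.scale /= mulr1.
apply: (is_derive_eq (is_deriveZ _ (is_deriveM (is_derive_expN m) dX))).
rewrite /GRing.scale /= factS natrM.
have k0 : k`!%:R != 0 :> R by rewrite pnatr_eq0 -lt0n fact_gt0.
have k1 : k.+1%:R != 0 :> R by rewrite pnatr_eq0.
set K := k.+1%:R; rewrite exprS; field.
by rewrite k0 addrC natr1 k1.
Qed.

Definition poisson_cdf (k : nat) (m : R) : R := \sum_(j < k.+1) poisson_mass m j.

Lemma poisson_cdfS k m : poisson_cdf k.+1 m = poisson_cdf k m + poisson_mass m k.+1.
Proof. by rewrite /poisson_cdf big_ord_recr. Qed.

Lemma poisson_cdf0 m : poisson_cdf 0 m = poisson_mass m 0.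
Proof. by rewrite /poisson_cdf big_ord1. Qed.

Lemma poisson_cdf_ge0 k m : 0 <= m -> 0 <= poisson_cdf k m.
Proof. by move=> m0; apply: sumr_ge0 => j _; exact: poisson_mass_ge0. Qed.

(** The derivatives of the masses telescope. *)
Lemma is_derive_poisson_cdf k m : is_derive m 1 (poisson_cdf k) (- poisson_mass m k).
Proof.
elim: k => [|k ih].
  rewrite (_ : poisson_cdf 0 = (@poisson_mass R)^~ 0%N); first exact: is_derive_poisson_mass0.
  by apply/funext => x; exact: poisson_cdf0.
rewrite (_ : poisson_cdf k.+1 = poisson_cdf k + (@poisson_mass R)^~ k.+1); last first.
  by apply/funext => x; exact: poisson_cdfS.
by apply: (is_derive_eq (is_deriveD ih (is_derive_poisson_massS m k))); rewrite addKr.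
Qed.

Lemma continuous_poisson_mass k : continuous ((@poisson_mass R)^~ k).
Proof.
move=> m; apply: differentiable_continuous; apply/derivable1_diffP.
case: k => [|k]; first by have [] := is_derive_poisson_mass0 m.
by have [] := is_derive_poisson_massS m k.
Qed.

Lemma poisson_cdf_at0 k : poisson_cdf k 0 = 1.
Proof.
elim: k => [|k ih].
  by rewrite poisson_cdf0 /poisson_mass oppr0 expR0 expr0 fact0 mulr1 divr1.
by rewrite poisson_cdfS ih /poisson_mass expr0n/= mulr0 mul0r addr0.
Qed.

Lemma integral_poisson_mass k M : 0 <= M ->
  (\int[mu]_(m in `[0%R, M]) (poisson_mass m k)%:E = (1 - poisson_cdf k M)%:E)%E.
Proof.
rewrite le_eqVlt => /predU1P[<-|M0].
  by rewrite set_itv1 integral_set1 poisson_cdf_at0 subrr.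
have dN m : is_derive m 1 (fun x => - poisson_cdf k x) (poisson_mass m k).
  rewrite -[X in is_derive _ _ _ X]opprK; apply: is_deriveN; exact: is_derive_poisson_cdf.
have cN : continuous (fun x => - poisson_cdf k x).
  by move=> m; apply: differentiable_continuous; apply/derivable1_diffP; have [] := dN m.
rewrite (@continuous_FTC2 _ (fun m => poisson_mass m k) (fun m => - poisson_cdf k m))//.
- by rewrite -EFinB poisson_cdf_at0 opprK addrC.
- by apply: continuous_subspaceT => x; exact: continuous_poisson_mass.
- split; [by move=> m _; have [] := dN m|apply: cvg_at_right_filter; exact: cN|].
  by apply: cvg_at_left_filter; exact: cN.
- by move=> m _; rewrite derive1E; apply: (derive_val (is_derive := dN m)).
Qed.

End poisson_calculus.

Section cumulative_intensity.
Context (R : realType).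
Local Notation mu := (@lebesgue_measure R).
Local Notation pos := (`]0%R, +oo[%classic : set (measurableTypeR R)).
Implicit Types m M u v a : R.
Variable lambda : R -> R.
Hypotheses (lambda_ge0 : forall u : R, 0 <= u -> 0 <= lambda u)
  (lambda_int : forall t : R, 0 <= t -> mu.-integrable `[0, t] (EFin \o lambda)).
Local Notation Lambda := (cumulative_intensity lambda).

Lemma cumulative_intensity0 : Lambda 0 = 0.
Proof. by rewrite /cumulative_intensity set_itv1 Rintegral_set1. Qed.

Lemma cumulative_intensity_ge0 u : 0 <= Lambda u.
Proof.
by apply: Rintegral_ge0 => v; rewrite /= in_itv/= => /andP[v0 _]; exact: lambda_ge0.
Qed.

Let measurable_lambda_itv u : measurable_fun (`[0, u]%classic : set (measurableTypeR R)) lambda.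
Proof.
have [u0|u0] := leP 0 u; last by rewrite set_itv_ge ?bnd_simp -?ltNge//; exact: measurable_fun_set0.
by apply/measurable_EFinP; exact: (measurable_int mu (lambda_int u0)).
Qed.

Lemma integral_lambda u : 0 <= u -> (\int[mu]_(v in `[0%R, u]) (lambda v)%:E = (Lambda u)%:E)%E.
Proof.
move=> u0; rewrite /cumulative_intensity /Rintegral fineK//.
exact: integrable_fin_num (lambda_int u0).
Qed.

Lemma cumulative_intensity_le u v : 0 <= u -> u <= v -> Lambda u <= Lambda v.
Proof.
move=> u0 uv; rewrite -lee_fin -!integral_lambda// ?(le_trans u0)//.
apply: ge0_subset_integral => //.
- by apply/measurable_EFinP.
- by move=> x; rewrite /= in_itv/= => /andP[x0 _]; rewrite lee_fin lambda_ge0.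
- by apply: subset_itvl; rewrite bnd_simp.
Qed.

(** Continuity of Lambda is what the intermediate value theorem needs below; lambda itself may be
    discontinuous. *)
Lemma continuous_cumulative_intensity u : 0 <= u -> {within `[0, u], continuous Lambda}.
Proof. by move=> u0; apply: parameterized_integral_continuous => //; exact: lambda_int. Qed.

Lemma measurable_cumulative_intensity u :
  measurable_fun (`[0, u]%classic : set (measurableTypeR R)) Lambda.
Proof.
have [u0|u0] := leP 0 u; last by rewrite set_itv_ge ?bnd_simp -?ltNge//; exact: measurable_fun_set0.
apply: subspace_continuous_measurable_fun; first exact: measurable_itv.
exact: continuous_cumulative_intensity.
Qed.

Lemma cumulative_intensity_attains u a : 0 <= u -> 0 <= a -> a <= Lambda u ->
  exists w, [/\ 0 <= w, w <= u & Lambda w = a].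
Proof.
move=> u0 a0 au.
have [|w] := @IVT R Lambda 0 u a u0 (continuous_cumulative_intensity u0).
  have L0 := cumulative_intensity_ge0 u.
  by rewrite cumulative_intensity0 (min_l L0) (max_r L0) a0 au.
by rewrite in_itv/= => /andP[w0 wu] <-; exists w.
Qed.

(** The law of Lambda under lambda(v) dv on [0, u] is Lebesgue measure on [0, Lambda u]: by
    monotonicity the preimage of a ray is an interval, whose mass is found by intermediate values. *)
Lemma integral_lambda_ray u a : 0 <= u ->
  (\int[mu]_(v in `[0%R, u] `&` Lambda @^-1` `]-oo, a[) (lambda v)%:E =
   mu (`[0%R, Lambda u] `&` `]-oo, a[%classic))%E.
Proof.
move=> u0; set A := _ `&` _.
have mA : measurable (A : set (measurableTypeR R)).
  by apply: measurable_cumulative_intensity => //; exact: measurable_itv.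
have lam0 v : `[0, u]%classic v -> (0 <= (lambda v)%:E)%E.
  by rewrite /= in_itv/= => /andP[v0 _]; rewrite lee_fin lambda_ge0.
have mlam (B : set (measurableTypeR R)) : B `<=` `[0, u]%classic -> measurable_fun B (fun v => (lambda v)%:E).
  by move=> Bu; apply/measurable_EFinP; apply: measurable_funS (@measurable_lambda_itv u).
have [a0|a0] := leP a 0.
  rewrite [A](_ : _ = set0) ?integral_set0; last first.
    rewrite -subset0 => v [_] /=; rewrite in_itv/=; apply/negP.
    by rewrite -leNgt (le_trans a0)// cumulative_intensity_ge0.
  rewrite (_ : _ `&` _ = set0) ?measure0// -subset0 => v [] /=; rewrite !in_itv/= => /andP[v0 _].
  by move=> /(le_lt_trans v0); rewrite ltNge a0.
have [ua|au] := ltP (Lambda u) a.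
  rewrite [A](_ : _ = `[0%R, u]%classic); last first.
    apply/seteqP; split => [v []//|v vu]; split => //=; rewrite in_itv/=.
    move: vu; rewrite /= in_itv/= => /andP[v0 vu].
    by apply: le_lt_trans ua; exact: cumulative_intensity_le.
  rewrite integral_lambda// (_ : _ `&` _ = `[0%R, Lambda u]%classic).
    rewrite lebesgue_measure_itv/= lte_fin; case: ltP => H; first by rewrite -EFinB subr0.
    by congr (_%:E); apply/eqP; rewrite eq_le H cumulative_intensity_ge0.
  apply/seteqP; split => [v []//|v vu]; split => //; move: vu; rewrite /= !in_itv/= => /andP[_ vu].
  exact: le_lt_trans ua.
rewrite (_ : `[0%R, Lambda u] `&` _ = `[0, a[%classic); last first.
  apply/seteqP; split => v /=; rewrite !in_itv/=; first by move=> [/andP[-> _] ->].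
  by move=> /andP[-> va]; rewrite va (le_trans (ltW va)).
rewrite lebesgue_measure_itv/= lte_fin a0 -EFinB subr0.
have sub_itv w : w <= u -> `[0, w]%classic `<=` `[0, u]%classic.
  by move=> wu; apply: subset_itvl; rewrite bnd_simp.
apply/eqP; rewrite eq_le; apply/andP; split.
  have [w [w0 wu wa]] := cumulative_intensity_attains u0 (ltW a0) au.
  rewrite -wa -integral_lambda//; apply: ge0_subset_integral => //.
  - by apply: mlam; exact: sub_itv.
  - by move=> v /(sub_itv _ wu); exact: lam0.
  - move=> v [] /=; rewrite !in_itv/= => /andP[v0 _]; rewrite -wa v0/= => H.
    by rewrite leNgt; apply: contraTN H => wv; rewrite -leNgt cumulative_intensity_le// ltW.
apply/lee_addgt0Pr => e e0.
pose b := Num.max 0 (a - e).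
have b0 : 0 <= b by rewrite le_max lexx.
have ba : b < a by rewrite gt_max a0/= gtrBl.
have [w [w0 wu wb]] := cumulative_intensity_attains u0 b0 (le_trans (ltW ba) au).
apply: (@le_trans _ _ (b%:E + e%:E)%E); first by rewrite -EFinD lee_fin -lerBlDr le_max lexx orbT.
rewrite leeD2r// -wb -integral_lambda//; apply: ge0_subset_integral => //.
- by apply: mlam => v [].
- by move=> v [+ _]; exact: lam0.
- move=> v vw; split; first exact: (sub_itv _ wu).
  move: vw; rewrite /= !in_itv/= => /andP[v0 vw].
  by rewrite (le_lt_trans _ ba)// -wb cumulative_intensity_le.
Qed.

Lemma ge0_integral_time_change u (k : R -> \bar R) : 0 <= u ->
  measurable_fun setT k -> (forall y, (0 <= k y)%E) ->
  (\int[mu]_(y in `[0%R, Lambda u]) k y =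
   \int[mu]_(v in `[0%R, u]) ((lambda v)%:E * k (Lambda v)))%E.
Proof.
move=> u0 mk k0.
apply: (@ge0_change_of_variables _ _ _ mu _ (EFin \o lambda) Lambda) => //.
- by apply/measurable_EFinP; exact: measurable_lambda_itv.
- by move=> v; rewrite /= in_itv/= => /andP[v0 _]; rewrite lee_fin lambda_ge0.
- exact: measurable_cumulative_intensity.
- by move=> a; exact: integral_lambda_ray.
- move=> a; apply: (@le_lt_trans _ _ (mu `[0%R, Lambda u]%classic)).
    by apply: le_measure; rewrite ?inE//; apply: measurableI; exact: measurable_itv.
  by rewrite lebesgue_measure_itv/= lte_fin; case: ifP => _; rewrite -?EFinB ltry.
Qed.

Definition jump_rate (k : nat) (v : R) : R := lambda v * poisson_mass (Lambda v) k.

Lemma jump_rate_ge0 k v : 0 <= v -> 0 <= jump_rate k v.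
Proof.
by move=> v0; rewrite mulr_ge0 ?lambda_ge0// poisson_mass_ge0// cumulative_intensity_ge0.
Qed.

(** The substitution m = Lambda(v) in the integral of the Poisson mass. *)
Lemma integral_jump_rate k u : 0 <= u ->
  (\int[mu]_(v in `[0%R, u]) (jump_rate k v)%:E = (1 - poisson_cdf k (Lambda u))%:E)%E.
Proof.
move=> u0; rewrite -integral_poisson_mass ?cumulative_intensity_ge0//.
have mp : measurable_fun setT (fun m : R => (poisson_mass `|m| k)%:E).
  apply/measurable_EFinP; apply: (measurableT_comp (f := fun m : R => poisson_mass m k)) => //.
  by apply: continuous_measurable_fun; exact: continuous_poisson_mass.
have p0 (m : R) : (0 <= (poisson_mass `|m| k)%:E)%E by rewrite lee_fin poisson_mass_ge0.
transitivity (\int[mu]_(y in `[0%R, Lambda u]) (poisson_mass `|y| k)%:E)%E; last first.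
  apply: eq_integral => y; rewrite inE/= in_itv/= => /andP[y0 _].
  by rewrite ger0_norm.
rewrite (ge0_integral_time_change u0 mp p0); apply: eq_integral => v _.
by rewrite -EFinM ger0_norm// cumulative_intensity_ge0.
Qed.

Let itv (n : nat) : set (measurableTypeR R) := `[0, n%:R]%classic.

Let pos_itv : pos `<=` \bigcup_n itv n.
Proof.
move=> v /=; rewrite in_itv/= andbT => v0; exists (Num.trunc v).+1 => //=.
by rewrite /itv /= in_itv/= (ltW v0) ltW// truncnS_gt.
Qed.

Let measurable_on_itvs (h : R -> R) : (forall n, measurable_fun (itv n) h) ->
  measurable_fun (\bigcup_n itv n) h.
Proof.
by move=> mh; apply/measurable_fun_bigcup => // n; exact: measurable_itv.
Qed.

Let measurable_jump_rate_itvs k : measurable_fun (\bigcup_n itv n) (jump_rate k).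
Proof.
apply: measurable_funM; first by apply: measurable_on_itvs => n; exact: measurable_lambda_itv.
apply: (measurableT_comp (f := fun m : R => poisson_mass m k)).
  by apply: continuous_measurable_fun; exact: continuous_poisson_mass.
by apply: measurable_on_itvs => n; exact: measurable_cumulative_intensity.
Qed.

Let measurable_itvs : measurable (\bigcup_n itv n).
Proof. by apply: bigcup_measurable => n _; exact: measurable_itv. Qed.

Lemma measurable_jump_rate k : measurable_fun pos (jump_rate k).
Proof. exact: measurable_funS (measurable_jump_rate_itvs k). Qed.

Lemma measurable_cumulative_intensity_pos : measurable_fun pos Lambda.
Proof.
apply: (measurable_funS measurable_itvs pos_itv).
by apply: measurable_on_itvs => n; exact: measurable_cumulative_intensity.
Qed.

(** The integrals over [0, n] are bounded by 1. *)
Lemma integrable_jump_rate k : mu.-integrable pos (EFin \o jump_rate k).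
Proof.
apply/integrableP; split; first by apply/measurable_EFinP; exact: measurable_jump_rate.
have mabs : measurable_fun (\bigcup_n itv n) (fun v => `|(jump_rate k v)%:E|%E).
  by apply: measurableT_comp => //; apply/measurable_EFinP; exact: measurable_jump_rate_itvs.
apply: (@le_lt_trans _ _ (\int[mu]_(v in \bigcup_n itv n) `|(jump_rate k v)%:E|)%E).
  by apply: ge0_subset_integral => //; exact: measurable_itv.
apply: (@le_lt_trans _ _ 1%E); last by rewrite ltry.
have nd : nondecreasing_seq itv.
  move=> n m nm; rewrite subsetEset; apply: subset_itvl.
  by rewrite bnd_simp ler_nat.
have cv := @ge0_nondecreasing_set_cvg_integral _ _ _ itv (fun v => `|(jump_rate k v)%:E|%E) mu nd
  (fun n => measurable_itv _) (fun n => measurable_funS measurable_itvs (bigcup_sup I) mabs)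
  (fun n v _ => abse_ge0 _).
apply: (cvge_to_le cv); apply: nearW => n /=.
apply: (@le_trans _ _ (\int[mu]_(v in `[0%R, n%:R]) (jump_rate k v)%:E)%E).
  rewrite le_eqVlt; apply/orP; left; apply/eqP; apply: eq_integral => v.
  by rewrite inE /itv /= in_itv/= => /andP[v0 _]; rewrite ger0_norm// jump_rate_ge0.
by rewrite integral_jump_rate// lee_fin gerBl poisson_cdf_ge0// cumulative_intensity_ge0.
Qed.

End cumulative_intensity.

(** * Integration against a density by its tails *)

Section tails.
Local Open Scope ereal_scope.
Context (R : realType).
Local Notation mu := (@lebesgue_measure R).
Local Notation pos := (`]0%R, +oo[%classic : set (measurableTypeR R)).
Implicit Types m : {measure set (measurableTypeR R) -> \bar R}.

(** Right tails also generate; those at a <= 0 are recovered from the total mass. *)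
Lemma measure_unique_pos_tail m1 m2 :
  m1 setT < +oo -> m1 setT = m2 setT ->
  m1 `]-oo, 0%R[%classic = 0 -> m2 `]-oo, 0%R[%classic = 0 ->
  (forall a, (0 < a)%R -> m1 `]a, +oo[%classic = m2 `]a, +oo[%classic) ->
  forall A, measurable A -> m1 A = m2 A.
Proof.
move=> m1oo m12T m10 m20 m12 A mA.
pose g (k : nat) := `](- k%:R)%R, +oo[%classic : set (measurableTypeR R).
have Gm : @RGenOInfty.G R `<=` (@measurable _ (measurableTypeR R)).
  by move=> B [x ->]; exact: measurable_itv.
have sA : <<s @RGenOInfty.G R >> A.
  by have -> : <<s @RGenOInfty.G R >> = (@ocitv R).-sigma.-measurable by rewrite RGenOInfty.measurableE.
have tail_neg (m : {measure set (measurableTypeR R) -> \bar R}) (a : R) : (a < 0)%R ->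
    m `]-oo, 0%R[%classic = 0 -> m `]a, +oo[%classic = m setT.
  move=> a0 m0; apply/eqP; rewrite eq_le; apply/andP; split.
    by apply: le_measure; rewrite ?inE//; exact: measurable_itv.
  rewrite (_ : setT = `]-oo, 0%R[%classic `|` `]a, +oo[%classic); last first.
    apply/seteqP; split => // x _ /=; rewrite !in_itv/= andbT.
    by have [x0|x0] := ltP x 0%R; [left|right; exact: lt_le_trans x0].
  have mA1 : measurable (`]-oo, 0%R[%classic : set (measurableTypeR R)) by exact: measurable_itv.
  have mA2 : measurable (`]a, +oo[%classic : set (measurableTypeR R)) by exact: measurable_itv.
  by apply: (le_trans (measureU2 m mA1 mA2)); rewrite [X in X + _]m0 add0e.
have tail0 (m : {measure set (measurableTypeR R) -> \bar R}) :
    m `](n.+1%:R^-1)%R, +oo[%classic @[n --> \oo] --> m `]0%R, +oo[%classic.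
  have -> : `]0%R, +oo[%classic = \bigcup_n `](n.+1%:R^-1)%R, +oo[%classic :> set R.
    apply/seteqP; split => x /=; last first.
      by move=> [n _] /=; rewrite !in_itv/= !andbT; apply: lt_trans; rewrite invr_gt0.
    rewrite in_itv/= andbT => x0; exists (Num.trunc x^-1) => //=; rewrite in_itv/= andbT.
    by rewrite -[ltRHS]invrK ltf_pV2 ?posrE ?invr_gt0// truncnS_gt.
  apply: (@nondecreasing_cvg_mu _ _ _ m (fun n => `](n.+1%:R^-1)%R, +oo[%classic)).
  - by move=> n; exact: measurable_itv.
  - by apply: bigcupT_measurable => n; exact: measurable_itv.
  - move=> n k nk; rewrite subsetEset; apply: subset_itvr.
    by rewrite bnd_simp lef_pV2 ?posrE// ler_nat.
have m12' (a : R) : m1 `]a, +oo[%classic = m2 `]a, +oo[%classic.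
  have [a0|a0|->] := ltgtP a 0%R; [by rewrite !tail_neg|exact: m12|].
  have := tail0 m1; rewrite (_ : (fun n => _) = fun n => m2 `](n.+1%:R^-1)%R, +oo[%classic).
    by move=> /cvg_unique/(_ (tail0 m2)) ->.
  by apply/funext => n; rewrite m12// invr_gt0.
apply: (@g_sigma_algebra_measure_unique _ R (measurableTypeR R) _ Gm g _ _ m1 m2 _ _ _ A sA) => //.
- by move=> k; exists (- k%:R)%R.
- apply/seteqP; split => // x _; exists (Num.trunc (- x)).+1 => //.
  by rewrite /g /= in_itv/= andbT ltrNl truncnS_gt.
- move=> B C [x ->] [y ->]; exists (Num.max x y).
  apply/seteqP; split => z /=; rewrite !in_itv/= !andbT gt_max.
    by move=> [-> ->].
  by move=> /andP[-> ->].
- by move=> B [x ->].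
- by move=> k; apply: le_lt_trans m1oo; apply: le_measure; rewrite ?inE//; exact: measurable_itv.
Qed.

(** Tonelli on {0 < v < u}. *)
Lemma ge0_integral_triangle (p d : R -> R) :
  measurable_fun pos p -> measurable_fun pos d ->
  (forall x, (0 < x)%R -> (0 <= p x)%R) -> (forall x, (0 < x)%R -> (0 <= d x)%R) ->
  \int[mu]_(u in pos) ((\int[mu]_(v in `]0%R, u[) (p v)%:E) * (d u)%:E) =
  \int[mu]_(v in pos) ((p v)%:E * \int[mu]_(u in `]v, +oo[) (d u)%:E).
Proof.
move=> mp md p0 d0; have mpos : measurable pos by exact: measurable_itv.
have pos_ext (f : R -> R) (f0 : forall x, (0 < x)%R -> (0 <= f x)%R) x : (0 <= (f \_ pos) x)%R.
  by rewrite patchE; case: ifPn => //; rewrite inE/= in_itv/= andbT => /f0.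
have posE (f : R -> R) x : (0 < x)%R -> (f \_ pos) x = f x.
  by move=> x0; rewrite patchE mem_set//= in_itv/= x0.
have pos0 (f : R -> R) x : (x <= 0)%R -> (f \_ pos) x = 0%R.
  by move=> x0; rewrite patchE memNset//= in_itv/= andbT; apply/negP; rewrite -leNgt.
have mpp : measurable_fun setT (p \_ pos : measurableTypeR R -> measurableTypeR R).
  by apply/(measurable_restrictT _ mpos).
have mdp : measurable_fun setT (d \_ pos : measurableTypeR R -> measurableTypeR R).
  by apply/(measurable_restrictT _ mpos).
pose F (z : measurableTypeR R * measurableTypeR R) : \bar R :=
  ((p \_ pos) z.2 * (d \_ pos) z.1 * \1_pos (z.1 - z.2))%:E.
have mF : measurable_fun setT F.
  apply/measurable_EFinP; apply: measurable_funM.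
    apply: measurable_funM; first exact: (measurableT_comp mpp measurable_snd).
    exact: (measurableT_comp mdp measurable_fst).
  apply: (measurableT_comp (f := fun x : measurableTypeR R => \1_pos x : R)).
    exact: measurable_indic.
  exact: measurable_funB.
have F0 z : 0 <= F z.
  by rewrite /F lee_fin indic_pos mulr_ge0// mulr_ge0// pos_ext.
have indE (u v : R) : (\1_pos (u - v) = (v < u)%R%:R :> R)%R by rewrite indic_pos subr_gt0.
have mS (f : R -> R) (D : set (measurableTypeR R)) : measurable_fun pos f -> D `<=` pos ->
    measurable_fun D (fun x => (f x)%:E).
  by move=> mf Dp; apply/measurable_EFinP; exact: measurable_funS mf.
transitivity (\int[mu]_u \int[mu]_v F (u, v)).
  rewrite [LHS]ge0_integral_indic//; apply: eq_integral => u _.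
  rewrite indic_pos; have [u0|u0] := leP u 0%R.
    by rewrite mul0e; apply/esym/integral0_eq => v _; rewrite /F [X in (_ * X * _)%R]pos0// mulr0 mul0r.
  rewrite mul1e muleC -ge0_integralZl//; last 3 first.
  - by apply: mS => // v; rewrite /= !in_itv/= => /andP[-> _].
  - by move=> v; rewrite /= in_itv/= => /andP[v0 _]; rewrite lee_fin p0.
  - by rewrite lee_fin d0.
  rewrite [LHS]ge0_integral_indic//; apply: eq_integral => v _.
  rewrite /F /= indE (posE d u u0) indicE; have [v0|v0] := leP v 0%R.
    by rewrite pos0// !mul0r memNset ?mul0e//= in_itv/= ltNge v0.
  rewrite (posE p v v0); have [vu|uv] := ltP v u.
    by rewrite mem_set/= ?in_itv/= ?v0// mul1e mulr1 -EFinM mulrC.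
  by rewrite mulr0 memNset ?mul0e//= in_itv/= [(v < u)%R]ltNge uv andbF.
rewrite fubini_tonelli//.
rewrite [RHS]ge0_integral_indic//; apply: eq_integral => v _.
rewrite indic_pos; have [v0|v0] := leP v 0%R.
  by rewrite mul0e; apply/integral0_eq => u _; rewrite /F pos0// !mul0r.
rewrite mul1e -ge0_integralZl//; last 3 first.
- by apply: mS => // u; rewrite /= !in_itv/= !andbT; exact: lt_trans.
- by move=> u; rewrite /= in_itv/= andbT => vu; rewrite lee_fin d0// (lt_trans v0).
- by rewrite lee_fin p0.
rewrite [RHS]ge0_integral_indic//; apply: eq_integral => u _.
rewrite /F /= indE (posE p v v0) indicE; have [vu|uv] := ltP v u.
  by rewrite (posE d u (lt_trans v0 vu)) mem_set/= ?in_itv/= ?vu// mul1e mulr1 -EFinM.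
by rewrite mulr0 memNset ?mul0e//= in_itv/= andbT; apply/negP; rewrite -leNgt.
Qed.

End tails.

Section poisson_mixture.
Context (R : realType).
Local Notation mu := (@lebesgue_measure R).
Local Notation pos := (`]0%R, +oo[%classic : set (measurableTypeR R)).
Variables (lambda d : R -> R).
Hypotheses (lambda_ge0 : forall u : R, 0 <= u -> 0 <= lambda u)
  (lambda_int : forall t : R, 0 <= t -> mu.-integrable `[0, t] (EFin \o lambda)).
Hypotheses (md : measurable_fun pos d) (d_ge0 : forall u, 0 < u -> 0 <= d u)
  (d1 : (\int[mu]_(u in pos) (d u)%:E = 1)%E).
Local Notation Lambda := (cumulative_intensity lambda).

Lemma measurable_poisson_cdf_time k : measurable_fun pos (fun u => poisson_cdf k (Lambda u)).
Proof.
apply: (measurableT_comp (f := poisson_cdf k)).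
  apply: continuous_measurable_fun => m; apply: differentiable_continuous.
  by apply/derivable1_diffP; have [] := is_derive_poisson_cdf k m.
exact: measurable_cumulative_intensity_pos.
Qed.

Lemma poisson_cdf_le1 k u : 0 <= u -> poisson_cdf k (Lambda u) <= 1.
Proof.
move=> u0; rewrite -subr_ge0 -lee_fin -integral_jump_rate//.
apply: integral_ge0 => v; rewrite /= in_itv/= => /andP[v0 _].
by rewrite lee_fin jump_rate_ge0.
Qed.

(** Integration by parts: 1 - poisson_cdf is the primitive of the jump rate, so that its average
    against d is the integral of the jump rate against the tails of d. *)
Lemma integral_poisson_cdf_mixture k :
  (\int[mu]_(u in pos) (poisson_cdf k (Lambda u) * d u)%:E +
   \int[mu]_(v in pos) ((jump_rate lambda k v)%:E * \int[mu]_(u in `]v, +oo[) (d u)%:E) = 1)%E.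
Proof.
have mj : measurable_fun pos (jump_rate lambda k) by exact: measurable_jump_rate.
rewrite -(@ge0_integral_triangle _ (jump_rate lambda k) d)//; last first.
  by move=> x x0; exact/jump_rate_ge0/ltW.
have IE (u : R) : 0 < u -> (\int[mu]_(v in `]0%R, u[) (jump_rate lambda k v)%:E =
    (1 - poisson_cdf k (Lambda u))%:E)%E.
  move=> u0; rewrite -integral_jump_rate ?(ltW u0)//.
  have mju : measurable_fun (`]0, u[%classic : set (measurableTypeR R)) (fun v => (jump_rate lambda k v)%:E).
    apply/measurable_EFinP; apply: measurable_funS mj => //.
    by move=> v; rewrite /= !in_itv/= => /andP[-> _].
  rewrite -integral_itv_bndo_bndc.
    by rewrite integral_itv_obnd_cbnd.
  exact/emeasurable_fun_itv_obnd_cbndP.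
rewrite -ge0_integralD//=; last 4 first.
- move=> u; rewrite in_itv/= andbT => u0.
  by rewrite lee_fin mulr_ge0 ?d_ge0// poisson_cdf_ge0// cumulative_intensity_ge0.
- by apply/measurable_EFinP; apply: measurable_funM => //; exact: measurable_poisson_cdf_time.
- move=> u; rewrite in_itv/= andbT => u0.
  by rewrite IE// -EFinM lee_fin mulr_ge0 ?d_ge0// subr_ge0 poisson_cdf_le1// ltW.
- apply: (@eq_measurable_fun _ _ _ _ _ (fun u => ((1 - poisson_cdf k (Lambda u)) * d u)%:E)).
    by move=> u; rewrite inE/= in_itv/= andbT => u0; rewrite IE// EFinM.
  apply/measurable_EFinP; apply: measurable_funM => //; apply: measurable_funB => //.
  exact: measurable_poisson_cdf_time.
rewrite -d1; apply: eq_integral => u; rewrite inE/= in_itv/= andbT => u0.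
by rewrite IE// -EFinM -EFinD -mulrDl addrC subrK mul1r.
Qed.

End poisson_mixture.

(** * Laws of the stable subordinator and of its first passage times *)

Section borel_copy.
Context (R : realType) d (T : measurableType d) (P : probability T R).

(** A copy whose codomain carries the measurable structure on which Lebesgue measure is defined. *)
Definition borel_RV (X : {RV P >-> R}) : T -> measurableTypeR R := X.

Lemma measurable_preimage_RV (X : {RV P >-> R}) (A : set R) : measurable A -> measurable (X @^-1` A).
Proof. by move=> mA; rewrite -[_ @^-1` _]setTI; exact: measurable_funPT. Qed.

Lemma measurable_borel_RV (X : {RV P >-> R}) : measurable_fun setT (borel_RV X).
Proof. by move=> _ B mB; rewrite setTI; exact: measurable_preimage_RV. Qed.

HB.instance Definition _ (X : {RV P >-> R}) :=
  @isMeasurableFun.Build _ _ _ _ (borel_RV X) (measurable_borel_RV X).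

End borel_copy.

Section stable_marginals.
Context (R : realType) d (T : measurableType d) (P : probability T R).
Local Notation mu := (@lebesgue_measure R).
Local Notation pos := (`]0%R, +oo[%classic : set (measurableTypeR R)).
Local Notation law X := (distribution P (borel_RV X)).
Variables (alpha : R) (L : R -> {RV P >-> R}) (g : R -> R).
Hypotheses (alpha_gt0 : 0 < alpha) (L_stable : stable_subordinator alpha L)
  (g_density : is_density (L 1) g).

Let mpos : measurable pos. Proof. exact: measurable_itv. Qed.
Let mg : measurable_fun setT g. Proof. by have [] := g_density. Qed.
Let g_ge0 x : 0 <= g x. Proof. by have [_ + _] := g_density; exact. Qed.

Let law_density (A : set (measurableTypeR R)) : measurable A ->
  law (L 1) A = (\int[mu]_(x in A) (g x)%:E)%E.
Proof. by move=> mA; have [_ _ gE] := g_density; exact: gE. Qed.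

(** Paths are nondecreasing and start at 0 almost surely. *)
Lemma stable_negative_null (v : R) : 0 <= v -> law (L v) `]-oo, 0[%classic = 0%E.
Proof.
move=> v0; have [[[N [mN N0 LN]] cad _ _] _] := L_stable.
apply/eqP; rewrite -measure_le0 -N0.
rewrite [leLHS](_ : _ = P (L v @^-1` `]-oo, 0[%classic))//.
apply: le_measure; rewrite ?inE//.
  by apply: measurable_preimage_RV; exact: measurable_itv.
move=> w; rewrite /preimage /= in_itv/= => Lv; apply: LN => /= L0.
by have [/(_ 0 v (lexx _) v0) + _] := cad w; rewrite L0 leNgt Lv.
Qed.

Lemma stable_laplace_RV (v s : R) : 0 <= v -> 0 <= s ->
  (\int[law (L v)]_x (expR (- (s * x)))%:E = (expR (- (v * s `^ alpha)))%:E)%E.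
Proof.
move=> v0 s0; have [_ <-//] := L_stable; rewrite unlock ge0_integral_distribution//.
  by apply/measurable_EFinP; apply: measurableT_comp => //; exact: measurableT_comp.
Qed.

Lemma stable_density_positive (A : set R) : measurable A ->
  (law (L 1) A = \int[mu]_(x in pos `&` A) (g x)%:E)%E.
Proof.
move=> mA; rewrite law_density//.
have mgS (B : set (measurableTypeR R)) : measurable_fun B (fun x => (g x)%:E).
  by apply: (@measurable_funTS _ _ (measurableTypeR R)); exact/measurable_EFinP.
have mneg : measurable (`]-oo, 0]%classic : set (measurableTypeR R)) by exact: measurable_itv.
have neg0 : (\int[mu]_(x in `]-oo, 0%R]) (g x)%:E = 0)%E.
  rewrite -integral_itv_bndo_bndc; last exact: mgS.
  rewrite -law_density; last exact: measurable_itv.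
  by rewrite stable_negative_null.
have AE : A = (pos `&` A) `|` (`]-oo, 0]%classic `&` A).
  apply/seteqP; split => [x Ax|x [[]//|[]//]].
  by have [x0|x0] := leP x 0; [right|left]; split => //=; rewrite in_itv/= ?andbT.
rewrite [in LHS]AE ge0_integral_setU//.
- rewrite [X in (_ + X)%E](_ : _ = 0%E) ?adde0//.
  apply/eqP; rewrite eq_le integral_ge0 ?andbT; last by move=> x _; rewrite lee_fin.
  rewrite -neg0; apply: ge0_subset_integral => //; first exact: measurableI.
  by move=> x _; rewrite lee_fin.
- exact: measurableI.
- exact: measurableI.
- by move=> x _; rewrite lee_fin.
- rewrite disj_set2E; apply/eqP; rewrite -subset0 => x [[x0 _] [x1 _]].
  have {}x0 : 0 < x by move: x0; rewrite /= in_itv/= andbT.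
  have : x <= 0 by move: x1; rewrite /= in_itv.
  by rewrite leNgt x0.
Qed.

Lemma stable_density_total : (\int[mu]_(x in pos) (g x)%:E = 1)%E.
Proof.
rewrite -[X in integral _ X](setIT pos) -stable_density_positive//.
by rewrite /distribution /pushforward preimage_setT probability_setT.
Qed.

Lemma stable_density_integrable : mu.-integrable pos (EFin \o g).
Proof.
apply/integrableP; split.
  by apply: (@measurable_funTS _ _ (measurableTypeR R)); exact/measurable_EFinP.
under eq_integral do rewrite gee0_abs ?lee_fin//.
by rewrite stable_density_total ltry.
Qed.

Let mgpos : measurable_fun pos (EFin \o g).
Proof. by apply: (@measurable_funTS _ _ (measurableTypeR R)); exact/measurable_EFinP. Qed.

Let g0pos x : pos x -> (0 <= (EFin \o g) x)%E. Proof. by move=> _; rewrite lee_fin. Qed.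

Let mexp (s : R) : measurable_fun setT (fun x : R => (expR (- (s * x)))%:E).
Proof. by apply/measurable_EFinP; apply: measurableT_comp => //; exact: measurableT_comp. Qed.

Lemma stable_density_laplace (s : R) : 0 <= s ->
  (\int[mu]_(x in pos) ((g x)%:E * (expR (- (s * x)))%:E) = (expR (- (s `^ alpha)))%:E)%E.
Proof.
move=> s0; rewrite -[X in expR (- X)]mul1r -stable_laplace_RV//.
have mid : measurable_fun pos (@idfun (measurableTypeR R)) by exact: measurable_id.
rewrite -(@ge0_integral_weighted_image _ _ _ _ _ mu pos _ _ mpos mgpos g0pos mid _ (mexp s)); last first.
  by move=> x; rewrite lee_fin expR_ge0.
by apply: eq_measure_integral => A mA _; rewrite weighted_image_measureE; exact/esym/stable_density_positive.
Qed.

Lemma stable_density_laplace_real (s : R) : 0 < s ->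
  \int[mu]_(x in pos) (expR (- (s * x)) * g x) = expR (- (s `^ alpha)).
Proof.
move=> s0; rewrite /Rintegral -[RHS]/(fine (expR (- (s `^ alpha)))%:E) -stable_density_laplace ?ltW//.
by congr fine; apply: eq_integral => x _; rewrite mulrC EFinM.
Qed.

(** Self-similarity: L(v) has the law of v^(1/alpha) L(1), as both have Laplace transform
    exp(- v s^alpha). *)
Lemma stable_scaling (v : R) (A : set (measurableTypeR R)) : 0 < v -> measurable A ->
  (law (L v) A =
   \int[mu]_(y in pos `&` (fun y => v `^ alpha^-1 * y)%R @^-1` A) (g y)%:E)%E.
Proof.
move=> v0 mA; pose c := v `^ alpha^-1; have c0 : 0 < c by rewrite powR_gt0.
have mX : measurable_fun pos (fun y : measurableTypeR R => c * y : measurableTypeR R).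
  by apply: (@measurable_funTS _ _ (measurableTypeR R)); exact: measurable_funM.
pose m := weighted_image_measure mu mpos mgpos g0pos mX.
have -> : (\int[mu]_(y in pos `&` (fun y => c * y)%R @^-1` A) (g y)%:E)%E = m A.
  by rewrite /m weighted_image_measureE.
have mT : (m setT = 1)%E.
  by rewrite /m weighted_image_measureE (_ : _ `&` _ = pos) ?stable_density_total// setIT.
apply: (@laplace_unique _ (law (L v)) m) => //.
- by rewrite /= /distribution /pushforward preimage_setT probability_setT ltry.
- by rewrite mT ltry.
- by apply: stable_negative_null; exact: ltW.
- rewrite /m weighted_image_measureE (_ : _ `&` _ = set0) ?integral_set0//.
  rewrite -subset0 => y [] /=; rewrite !in_itv/= andbT => y0.
  by rewrite ltNge mulr_ge0// ltW.
move=> n; rewrite stable_laplace_RV ?(ltW v0)// /m.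
rewrite (@ge0_integral_weighted_image _ _ _ _ _ mu pos _ _ mpos mgpos g0pos mX _ (mexp n%:R)); last first.
  by move=> x; rewrite lee_fin expR_ge0.
under eq_integral do rewrite mulrA.
rewrite stable_density_laplace ?mulr_ge0 ?(ltW c0)//; congr (expR (- _))%:E.
by rewrite powRM ?(ltW c0)// /c -powRrM mulVf ?gt_eqF// powRr1 ?(ltW v0)// mulrC.
Qed.

Definition stable_cdf (x : R) : \bar R :=
  (\int[mu]_(y in pos) ((\1_(`]-oo, x[) y)%:E * (g y)%:E))%E.

Lemma stable_lt_prob (v t : R) : 0 < v ->
  (P [set w | L v w < t]%R = stable_cdf (t * v `^ (- alpha^-1))).
Proof.
move=> v0; have mA : measurable (`]-oo, t[%classic : set (measurableTypeR R)) by exact: measurable_itv.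
transitivity (law (L v) `]-oo, t[%classic).
  by congr (P _); apply/seteqP; split => w; rewrite /preimage /= in_itv.
rewrite (stable_scaling v0 mA) integral_mkcondr; apply: eq_integral => y _.
rewrite patchE indicE.
have -> : (y \in (fun y => v `^ alpha^-1 * y)%R @^-1` `]-oo, t[) =
    (y \in `]-oo, (t * v `^ (- alpha^-1))[%classic).
  apply/idP/idP; rewrite !inE/= !in_itv/= powRN ltr_pdivlMr ?powR_gt0//; by rewrite mulrC.
by case: ifPn => _; rewrite ?mul1e ?mul0e.
Qed.

(** Laws with a density have no atoms, so strict and weak inequalities have the same probability. *)
Lemma stable_eq_prob (v t : R) : 0 < v -> P [set w | L v w = t] = 0%E.
Proof.
move=> v0; have mA : measurable ([set t] : set (measurableTypeR R)) by exact: measurable_set1.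
transitivity (law (L v) [set t]); first by [].
rewrite (stable_scaling v0 mA).
apply: (integral_Sset1 (t * v `^ (- alpha^-1))) => y [_] /= <-.
by rewrite powRN mulrAC divff ?mul1r// gt_eqF// powR_gt0.
Qed.

Lemma stable_le_prob (v t : R) : 0 < v ->
  (P [set w | L v w <= t]%R = stable_cdf (t * v `^ (- alpha^-1))).
Proof.
move=> v0; rewrite -stable_lt_prob//.
have m1 : measurable [set w | L v w < t]%R.
  rewrite (_ : [set w | _] = L v @^-1` `]-oo, t[%classic); last first.
    by apply/seteqP; split => w; rewrite /preimage /= in_itv.
  by apply: measurable_preimage_RV; exact: measurable_itv.
have m2 : measurable [set w | L v w = t].
  rewrite (_ : [set w | _] = L v @^-1` [set t])//; exact/measurable_preimage_RV/measurable_set1.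
rewrite (_ : [set w | _] = [set w | L v w < t]%R `|` [set w | L v w = t]); last first.
  apply/seteqP; split => w /=; first by rewrite le_eqVlt => /predU1P[|]; [right|left].
  by case=> [/ltW//|->].
rewrite measureU// ?[X in (_ + X)%E]stable_eq_prob ?adde0//.
by rewrite -subset0 => w /= [+ wt]; rewrite wt ltxx.
Qed.

End stable_marginals.

Section first_passage_law.
Context (R : realType) d (T : measurableType d) (P : probability T R).
Local Notation mu := (@lebesgue_measure R).
Local Notation pos := (`]0%R, +oo[%classic : set (measurableTypeR R)).
Variables (alpha : R) (L : R -> {RV P >-> R}) (g : R -> R).
Hypotheses (alpha_gt0 : 0 < alpha) (L_stable : stable_subordinator alpha L)
  (g_density : is_density (L 1) g).
Local Notation Y := (first_passage (fun t w => L t w)).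

Let cad w : (forall s t, 0 <= s -> s <= t -> L s w <= L t w) /\
  (forall t, 0 <= t -> L s w @[s --> t^'+] --> L t w).
Proof. by have [[_ cad _ _] _] := L_stable; exact: cad. Qed.

Lemma first_passage_ge0 t w : 0 <= Y t w.
Proof.
rewrite /first_passage; set E := (X in inf X).
have [->|/set0P E0] := eqVneq E set0; first by rewrite inf0.
by apply: lb_le_inf => // u [].
Qed.

Lemma first_passage_le t v w : 0 <= v -> t < L v w -> Y t w <= v.
Proof.
by move=> v0 tL; apply: ge_inf; [exists 0 => u []|split].
Qed.

(** A description by countably many coordinates of L, which gives measurability. The second case is
    that of a path bounded by t, where the passage time is 0 by convention. *)
Lemma first_passage_ltE t v w : 0 < v ->
  (Y t w < v) <-> ((exists n : nat, t < L (v * (n%:R / n.+1%:R)) w) \/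
                   (forall n : nat, L n%:R w <= t)).
Proof.
move=> v0; have [mono _] := cad w; split.
  rewrite /first_passage; set E := (X in inf X).
  have [E0|/set0P E0] := eqVneq E set0.
    move=> _; right=> n; rewrite leNgt; apply/negP => tL.
    suff : E n%:R by rewrite E0.
    by split.
  move=> /(inf_lt E0)[u [u0 tLu] uv]; left.
  have vu : 0 < v - u by rewrite subr_gt0.
  exists (Num.trunc (v / (v - u))); set n := Num.trunc _.
  apply: (lt_le_trans tLu); apply: mono => //.
  have nv : v / (v - u) < n.+1%:R by exact: truncnS_gt.
  rewrite mulrA ler_pdivlMr ?ltr0n//.
  move: nv; rewrite ltr_pdivrMr// => nv.
  by rewrite -natr1 in nv *; nra.
case=> [[n tL]|H].
  have n0 : 0 <= v * (n%:R / n.+1%:R) by rewrite mulr_ge0 ?(ltW v0)// divr_ge0.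
  apply: (le_lt_trans (first_passage_le n0 tL)).
  by rewrite gtr_pMr// ltr_pdivrMr ?ltr0n// mul1r ltr_nat.
rewrite /first_passage (_ : [set u | _] = set0) ?inf0//.
rewrite -subset0 => u [u0]; rewrite ltNge => /negP; apply.
apply: le_trans (H (Num.trunc u).+1); apply: mono => //.
exact/ltW/truncnS_gt.
Qed.

Let measurable_le v t : measurable [set w | L v w <= t].
Proof.
rewrite (_ : [set w | _] = L v @^-1` `]-oo, t]%classic).
  by apply: measurable_preimage_RV; exact: measurable_itv.
by apply/seteqP; split => w; rewrite /preimage /= in_itv.
Qed.

Let measurable_lt v t : measurable [set w | L v w < t].
Proof.
rewrite (_ : [set w | _] = L v @^-1` `]-oo, t[%classic).
  by apply: measurable_preimage_RV; exact: measurable_itv.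
by apply/seteqP; split => w; rewrite /preimage /= in_itv.
Qed.

Let never t : set T := \bigcap_n [set w | L n%:R w <= t].

Let measurable_never t : measurable (never t).
Proof. by apply: bigcapT_measurable => n; exact: measurable_le. Qed.

Lemma measurable_first_passage t : measurable_fun setT (Y t : T -> measurableTypeR R).
Proof.
move=> mT; apply: (measurability _ (RGenInftyO.measurableE R)) => //.
move=> _ [_ [v ->] <-]; rewrite setTI.
have [v0|v0] := leP v 0.
  rewrite (_ : _ @^-1` _ = set0)// -subset0 => w.
  by rewrite /preimage /= in_itv/= ltNge (le_trans v0)// first_passage_ge0.
rewrite (_ : _ @^-1` _ =
    (\bigcup_n ~` [set w | L (v * (n%:R / n.+1%:R)) w <= t]) `|` never t).
  apply: measurableU => //; apply: bigcupT_measurable => n.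
  exact/measurableC/measurable_le.
apply/seteqP; split => w; rewrite /preimage /= in_itv/=.
  move=> /(first_passage_ltE t w v0)[[n tL]|H]; last by right=> n _; exact: H.
  by left; exists n => //=; apply/negP; rewrite -ltNge.
move=> H; apply/(first_passage_ltE t w v0); case: H => [[n _ /= /negP]|H].
  by rewrite -ltNge => ?; left; exists n.
by right=> n; exact: H.
Qed.

(** Markov's inequality for exp(- L(n) / t). *)
Lemma stable_prob_le_expR (n t : R) : 0 <= n -> 0 < t ->
  (P [set w | L n w <= t]%R <= (expR 1 * expR (- (n * t^-1 `^ alpha)))%:E)%E.
Proof.
move=> n0 t0; have t10 : 0 <= t^-1 by rewrite invr_ge0 ltW.
have mE : measurable_fun setT (fun w => (expR 1 * expR (- (t^-1 * L n w)))%:E).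
  apply/measurable_EFinP; apply: measurable_funM => //.
  by apply: measurableT_comp => //; apply: measurableT_comp => //; exact: measurable_funM.
have F0 w : (0 <= (expR 1 * expR (- (t^-1 * L n w)))%:E)%E.
  by rewrite lee_fin mulr_ge0 ?expR_ge0.
apply: (@le_trans _ _ (\int[P]_(w in [set w | (L n w <= t)%R]) (expR 1 * expR (- (t^-1 * L n w)))%:E)%E).
  rewrite -[leLHS]mul1e -integral_cst//; apply: ge0_le_integral => //.
    exact: measurable_funTS.
  move=> w /= Lt; rewrite lee_fin -expRD -[leLHS]expR0 ler_expR subr_ge0.
  by rewrite mulrC ler_pdivrMr// mul1r.
apply: (@le_trans _ _ (\int[P]_w (expR 1 * expR (- (t^-1 * L n w)))%:E)%E).
  exact: ge0_subset_integral.
under eq_integral do rewrite EFinM.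
rewrite ge0_integralZl ?lee_fin ?expR_ge0//; last first.
  by apply/measurable_EFinP; apply: measurableT_comp => //; apply: measurableT_comp => //; exact: measurable_funM.
have [_ /(_ t^-1 n t10 n0)] := L_stable; rewrite unlock => ->.
by rewrite EFinM.
Qed.

(** The paths are almost surely unbounded: the previous bound tends to 0. *)
Lemma null_never t : 0 < t -> P (never t) = 0%E.
Proof.
move=> t0; have mN := measurable_never t.
apply/eqP; rewrite eq_le measure_ge0 andbT.
rewrite -(fineK (fin_num_measure P (never t) mN)) lee_fin.
set p := fine _; rewrite leNgt; apply/negP => p0.
pose c : R := t^-1 `^ alpha; have c0 : 0 < c by rewrite powR_gt0 ?invr_gt0.
have pc0 : 0 < p * c by rewrite mulr_gt0.
pose n := (Num.trunc (expR 1 / (p * c) : R)).+1.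
have nE : expR 1 < n%:R * (p * c) by rewrite -ltr_pdivrMr// truncnS_gt.
have : p <= expR 1 * expR (- (n%:R * c)).
  rewrite -lee_fin /p fineK ?fin_num_measure//.
  apply: le_trans (stable_prob_le_expR (ler0n _ _) t0).
  by apply: le_measure; rewrite ?inE// => w; exact.
rewrite expRN ler_pdivlMr ?expR_gt0// leNgt => /negP; apply.
apply: (lt_le_trans nE); rewrite mulrCA; apply: ler_wpM2l; first exact: ltW.
by apply: le_trans (expR_ge1Dx _); rewrite lerDr.
Qed.

(** {L(v) < t} is contained in {Y(t) > v} up to the null event of bounded paths, by right-continuity,
    and {Y(t) > v} in {L(v) <= t}, by monotonicity; the outer events have equal probability. *)
Lemma first_passage_tail t v : 0 < t -> 0 < v ->
  P [set w | v < Y t w] = stable_cdf g (t * v `^ (- alpha^-1)).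
Proof.
move=> t0 v0; have mY : measurable [set w | v < Y t w].
  rewrite (_ : [set w | _] = setT `&` Y t @^-1` `]v, +oo[%classic).
    exact: (measurable_first_passage t measurableT (measurable_itv _)).
  by rewrite setTI; apply/seteqP; split => w; rewrite /preimage /= in_itv/= andbT.
apply/eqP; rewrite eq_le; apply/andP; split.
  rewrite -(stable_le_prob alpha_gt0 L_stable g_density)//.
  apply: le_measure; rewrite ?inE// => w /=; rewrite leNgt => vY.
  by apply/negP => tL; move: vY; rewrite ltNge (first_passage_le (ltW v0) tL).
rewrite -(stable_lt_prob alpha_gt0 L_stable g_density)//.
apply: (@le_trans _ _ (P ([set w | v < Y t w] `|` never t))).
  apply: le_measure; rewrite ?inE//; first exact: measurableU.
  move=> w /= Lt; have [mono rcont] := cad w.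
  have [H|] := pselect (forall n : nat, L n%:R w <= t); first by right=> n _; exact: H.
  move=> /existsNP[n /negP]; rewrite -ltNge => tL; left.
  have : \forall s \near v^'+, L s w < t.
    by have /cvgr_lt/(_ _ Lt) := rcont v (ltW v0).
  move=> near_lt; near v^'+ => s.
  have vs : v < s by near: s; exact: nbhs_right_gt.
  have Ls : L s w < t by near: s.
  apply: (lt_le_trans vs); apply: lb_le_inf; first by exists n%:R; split.
  move=> u [u0 tLu]; rewrite leNgt; apply/negP => us.
  by have := lt_trans (le_lt_trans (mono _ _ u0 (ltW us)) Ls) tLu; rewrite ltxx.
apply: (le_trans (measureU2 P mY (measurable_never t))).
by rewrite [X in (_ + X)%E](null_never t0) adde0.
Unshelve. all: by end_near. Qed.

Section density.
Variables (t : R) (h : R -> R).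
Hypotheses (t_gt0 : 0 < t) (mh : measurable_fun setT h)
  (h_ge0 : forall v, 0 < v -> 0 <= h v)
  (h1 : (\int[mu]_(u in pos) (h u)%:E = 1)%E)
  (h_tail : forall v, 0 < v ->
    (\int[mu]_(u in `]v, +oo[) (h u)%:E)%E = stable_cdf g (t * v `^ (- alpha^-1))).

(** The law of Y(t) and the measure with density h have the same tails. *)
Lemma ge0_integral_first_passage (k : measurableTypeR R -> \bar R) :
  measurable_fun setT k -> (forall y, (0 <= k y)%E) ->
  (\int[P]_w k (Y t w) = \int[mu]_(u in pos) ((h u)%:E * k u))%E.
Proof.
move=> mk k0.
have mposR : measurable pos by exact: measurable_itv.
have mW : measurable_fun pos (EFin \o h).
  by apply: (@measurable_funTS _ _ (measurableTypeR R)); exact/measurable_EFinP.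
have W0 u : pos u -> (0 <= (EFin \o h) u)%E.
  by rewrite /= in_itv/= andbT => u0; rewrite lee_fin h_ge0.
have mid : measurable_fun pos (@idfun (measurableTypeR R)) by exact: measurable_id.
have m1 : measurable_fun [set: T] (cst 1%E : T -> \bar R) by [].
have p1 (w : T) : [set: T] w -> (0 <= (cst 1%E : T -> \bar R) w)%E by [].
pose mP := weighted_image_measure P measurableT m1 p1 (measurable_first_passage t).
pose mQ := weighted_image_measure mu mposR mW W0 mid.
have mPE (A : set (measurableTypeR R)) : measurable A -> mP A = P (Y t @^-1` A).
  move=> mA; rewrite /mP weighted_image_measureE integral_cst; last exact: measurable_first_passage.
  by rewrite mul1e setTI.
transitivity (\int[mP]_y k y)%E.
  by rewrite /mP ge0_integral_weighted_image//; apply: eq_integral => w _; rewrite mul1e.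
transitivity (\int[mQ]_y k y)%E; last first.
  by rewrite /mQ ge0_integral_weighted_image.
apply: eq_measure_integral => A mA _; apply: measure_unique_pos_tail => //.
- by rewrite mPE// preimage_setT probability_setT ltry.
- rewrite mPE// preimage_setT probability_setT.
  by rewrite /mQ weighted_image_measureE preimage_setT setIT h1.
- rewrite mPE; last exact: measurable_itv.
  rewrite (_ : _ @^-1` _ = set0) ?measure0// -subset0 => w.
  by rewrite /preimage /= in_itv/= ltNge first_passage_ge0.
- rewrite /mQ weighted_image_measureE (_ : _ `&` _ = set0) ?integral_set0//.
  rewrite -subset0 => y [] /=; rewrite !in_itv/= andbT => y0.
  by rewrite ltNge ltW.
- move=> v v0; rewrite mPE; last exact: measurable_itv.
  rewrite /mQ weighted_image_measureE.
  rewrite (_ : Y t @^-1` _ = [set w | v < Y t w]); last first.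
    by apply/seteqP; split => w; rewrite /preimage /= in_itv/= andbT.
  rewrite first_passage_tail// -h_tail//; congr (integral _ _ _).
  apply/seteqP; split => y /=; rewrite !in_itv/= !andbT; last by case.
  by move=> vy; split => //; exact: lt_trans vy.
Qed.

End density.

Lemma first_passage0 v : 0 < v -> P [set w | v < Y 0 w] = 0%E.
Proof.
move=> v0; have m1 : measurable [set w | v < Y 0 w].
  rewrite (_ : [set w | _] = setT `&` Y 0 @^-1` `]v, +oo[%classic).
    exact: (measurable_first_passage 0 measurableT (measurable_itv _)).
  by rewrite setTI; apply/seteqP; split => w; rewrite /preimage /= in_itv/= andbT.
apply/eqP; rewrite eq_le measure_ge0 andbT.
apply: (@le_trans _ _ (P [set w | L v w <= 0])).
  apply: le_measure; rewrite ?inE// => w /=; rewrite leNgt => vY.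
  by apply/negP => tL; move: vY; rewrite ltNge (first_passage_le (ltW v0) tL).
rewrite (stable_le_prob alpha_gt0 L_stable g_density)// mul0r /stable_cdf.
rewrite integral0_eq// => y; rewrite /= in_itv/= andbT => y0.
by rewrite indicE memNset ?mul0e//= in_itv/= ltNge (ltW y0).
Qed.

End first_passage_law.

(** * A Poisson process at an independent random time *)

Section null_sets.
Context (R : realType) d (T : measurableType d) (m : {measure set T -> \bar R}).

Lemma measure_eq_off_null (A B M : set T) : measurable A -> measurable B -> measurable M ->
  m M = 0%E -> (forall w, ~ M w -> (A w <-> B w)) -> m A = m B.
Proof.
move=> mA mB mM M0 AB.
suff le (C D : set T) : measurable C -> measurable D -> (forall w, ~ M w -> C w -> D w) ->
    (m C <= m D)%E.
  by apply/eqP; rewrite eq_le; apply/andP; split; apply: le => // w /AB[].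
move=> mC mD CD; apply: (@le_trans _ _ (m (D `|` M))).
  apply: le_measure; rewrite ?inE//; first exact: measurableU.
  by move=> w Cw; have [Mw|Mw] := pselect (M w); [right|left; exact: CD].
by apply: (le_trans (measureU2 m mD mM)); rewrite [X in (_ + X)%E]M0 adde0.
Qed.

End null_sets.

Section random_time.
Context (R : realType) d (T : measurableType d) (P : probability T R).
Variables (N : R -> {RV P >-> nat}) (Z : T -> R).
Hypotheses (N_poisson : poisson_process 1 N)
  (mZ : measurable_fun setT (Z : T -> measurableTypeR R))
  (Z_ge0 : forall w, 0 <= Z w)
  (indep : forall s x (B : set (measurableTypeR R)), 0 <= s -> measurable B ->
    P ([set w | N s w = x] `&` Z @^-1` B) = (P [set w | N s w = x] * P (Z @^-1` B))%E).

Lemma measurable_count s x : measurable [set w | N s w = x].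
Proof.
rewrite (_ : [set w | _] = setT `&` N s @^-1` [set x]); last by rewrite setTI.
exact: measurable_funPT.
Qed.

(** Increments from time 0, where the process vanishes almost surely. *)
Lemma poisson_marginal s x : 0 <= s -> P [set w | N s w = x] = (poisson_mass s x)%:E.
Proof.
move=> s0; have [[M [mM M0 NM]] _ _ inc] := N_poisson.
have := inc 0 s x (lexx _) s0; rewrite subr0 mul1r => <-.
have mB : measurable [set w | N s w = (N 0 w + x)%N].
  rewrite (_ : [set w | _] =
      \bigcup_j ([set w | N 0 w = j] `&` [set w | N s w = (j + x)%N])).
    by apply: bigcupT_measurable => j; apply: measurableI; exact: measurable_count.
  apply/seteqP; split => w /=; first by move=> E; exists (N 0 w).
  by move=> [j _ [/= -> ->]].
apply: (measure_eq_off_null (measurable_count s x) mB mM M0) => w Mw /=.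
have -> : N 0 w = 0%N by apply: contrapT => H; apply: Mw; exact: NM.
by rewrite add0n.
Qed.

Lemma poisson_mass_le1 (s : R) x : 0 <= s -> poisson_mass s x <= 1.
Proof.
by move=> s0; rewrite -lee_fin -poisson_marginal// probability_le1//; exact: measurable_count.
Qed.

(** A right-continuous path with values in the natural numbers is locally constant on the right. *)
Lemma count_right_constant w z : 0 <= z -> \forall s \near z^'+, N s w = N z w.
Proof.
move=> z0; have [_ cad _ _] := N_poisson; have [_ /(_ z z0)] := cad w.
move=> /cvgrPdist_lt/(_ 1 ltr01); apply: filterS => s.
rewrite ltr_norml => /andP[sz zs].
apply/eqP; rewrite eqn_leq -ltnS -[(N z w <= _)%N]ltnS -!(ltr_nat R) -!natr1.
by apply/andP; split; lra.
Qed.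

(* [D n] is the least point of the grid of step 1/(n+1) strictly above Z: it converges to Z
   from the right, and it depends on Z through countably many events. *)
Let grid n k : R := k.+1%:R / n.+1%:R.
Let K n w := Num.trunc (n.+1%:R * Z w).
Let E n k := [set w | K n w = k].
Let D n w := grid n (K n w).

Let grid_ge0 n k : 0 <= grid n k. Proof. by rewrite divr_ge0. Qed.

Let gt_D n w : Z w < D n w.
Proof. by rewrite /D /grid ltr_pdivlMr ?ltr0n// mulrC truncnS_gt. Qed.

Let D_le n w : D n w <= Z w + n.+1%:R^-1.
Proof.
rewrite /D /grid -natr1 mulrDl mul1r lerD2r ler_pdivrMr ?ltr0n// [leRHS]mulrC truncn_le.
by rewrite mulr_ge0.
Qed.

Let measurable_E n k : measurable (E n k) /\
  exists2 B : set (measurableTypeR R), measurable B & E n k = Z @^-1` B.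
Proof.
have EE : E n k = Z @^-1` `[(k%:R / n.+1%:R), (k.+1%:R / n.+1%:R)[%classic.
  apply/seteqP; split => w; rewrite /E /K /preimage /= in_itv/=.
    move=> /eqP; rewrite truncn_eq ?mulr_ge0// => /andP[k1 k2].
    by rewrite ler_pdivrMr ?ltr0n// ltr_pdivlMr ?ltr0n// mulrC k1.
  rewrite ler_pdivrMr ?ltr0n// ltr_pdivlMr ?ltr0n// => k12.
  by apply/eqP; rewrite truncn_eq ?mulr_ge0// mulrC.
split; last by eexists; [|exact: EE]; exact: measurable_itv.
by rewrite EE -[_ @^-1` _]setTI; apply: mZ => //; exact: measurable_itv.
Qed.

Let E_cover n : setT = \bigcup_k E n k.
Proof. by apply/seteqP; split => // w _; exists (K n w). Qed.

Let E_triv n : trivIset setT (E n).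
Proof. by move=> i j _ _ [w [/= <- <-]]. Qed.

Let cvg_D w : D n w @[n --> \oo] --> Z w.
Proof.
apply/cvgrPdist_lt => e e0; near=> n; rewrite ltr_norml.
have ne : n.+1%:R^-1 < e by near: n; exact: (near_infty_natSinv_lt (PosNum e0)).
move: (gt_D n w) (D_le n w) ne; move: (n.+1%:R^-1 : R) (D n w) => r u *.
by apply/andP; split; lra.
Unshelve. all: by end_near. Qed.

Section level.
Variable x : nat.
Let A_ n : set T := [set w | N (D n w) w = x].

Let A_E n k : A_ n `&` E n k = [set w | N (grid n k) w = x] `&` E n k.
Proof. by apply/seteqP; split => w [/= + Ek]; rewrite /A_ /D /= Ek. Qed.

Let measurable_A_ n : measurable (A_ n).
Proof.
rewrite -[A_ n]setIT (E_cover n) setI_bigcupr; apply: bigcupT_measurable => k.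
rewrite A_E; apply: measurableI; first exact: measurable_count.
by have [] := measurable_E n k.
Qed.

Let D_eventually w : \forall n \near \oo, N (D n w) w = N (Z w) w.
Proof.
have := count_right_constant w (Z_ge0 w).
move=> /nbhs_ballP[e /= e0 H]; near=> n; apply: H; last exact: gt_D.
rewrite /ball/= ltr_norml.
have ne : n.+1%:R^-1 < e by near: n; exact: (near_infty_natSinv_lt (PosNum e0)).
move: (gt_D n w) (D_le n w) ne; move: (n.+1%:R^-1 : R) (D n w) => r u *.
by apply/andP; split; lra.
Unshelve. all: by end_near. Qed.

(** N(Z) is eventually equal to N(D n), and N(D n) only involves countably many times. *)
Lemma measurable_count_at_time : measurable [set w | N (Z w) w = x].
Proof.
rewrite (_ : [set w | _] = \bigcup_m \bigcap_(n in [set n | (m <= n)%N]) A_ n).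
  by apply: bigcupT_measurable => m; apply: bigcap_measurable => //; exists m => /=.
apply/seteqP; split => w /=.
  by have [m _ H] := D_eventually w => NZ; exists m => // n /= mn; rewrite /A_ /= H.
have [m1 _ H1] := D_eventually w => -[m2 _ H2].
have := H2 (maxn m1 m2) (leq_maxr _ _).
by rewrite /A_ /= H1//= leq_maxl.
Qed.

Let measurable_mass n : measurable_fun setT (fun w => (poisson_mass (D n w) x)%:E).
Proof.
rewrite (E_cover n); apply/measurable_fun_bigcup; first by move=> k; have [] := measurable_E n k.
move=> k; apply: (@eq_measurable_fun _ _ _ _ _ (cst (poisson_mass (grid n k) x)%:E)) => //.
by move=> w; rewrite inE /E /D /= => ->.
Qed.

(** On each cell of the grid the time is constant and independence applies. *)
Let step_prob n :
  (\int[P]_w (\1_(A_ n) w)%:E = \int[P]_w (poisson_mass (D n w) x)%:E)%E.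
Proof.
have mE k : measurable (E n k) by have [] := measurable_E n k.
have m1 : measurable_fun (\bigcup_k E n k) (fun w => (\1_(A_ n) w)%:E : \bar R).
  by rewrite -E_cover; apply/measurable_EFinP; exact: measurable_indic.
have m2 : measurable_fun (\bigcup_k E n k) (fun w => (poisson_mass (D n w) x)%:E).
  by rewrite -E_cover.
rewrite (E_cover n) ge0_integral_bigcup//.
rewrite ge0_integral_bigcup//; last first.
  by move=> w _; rewrite lee_fin poisson_mass_ge0// grid_ge0.
apply: eq_eseriesr => k _; rewrite integral_indic// A_E.
transitivity ((poisson_mass (grid n k) x)%:E * P (E n k))%E.
  have [_ [B mB ->]] := measurable_E n k.
  by rewrite -poisson_marginal//; exact: indep.
rewrite -integral_cst//; apply: eq_integral => w; rewrite inE /E /D /= => ->.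
by [].
Qed.

(** The identity for grid-valued times passes to the limit by dominated convergence on both sides. *)
Lemma integral_poisson_mass_at_time :
  (P [set w | N (Z w) w = x] = \int[P]_w (poisson_mass (Z w) x)%:E)%E.
Proof.
have mA := measurable_count_at_time.
have int1 : P.-integrable setT (EFin \o cst (1 : R)) by exact: finite_measure_integrable_cst.
have mpZ : measurable_fun setT (fun w => (poisson_mass (Z w) x)%:E).
  apply/measurable_EFinP; apply: (measurableT_comp (f := (@poisson_mass R)^~ x)); last exact: mZ.
  exact: continuous_measurable_fun (@continuous_poisson_mass R x).
have mAn n : measurable_fun setT (fun w => (\1_(A_ n) w)%:E : \bar R).
  by apply/measurable_EFinP; exact: measurable_indic.
have [_ _ cvA] := @dominated_convergence _ _ _ P setT measurableT
  (fun n w => (\1_(A_ n) w)%:E) (fun w => (\1_[set w | N (Z w) w = x] w)%:E)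
  (EFin \o cst (1 : R)) mAn
  ltac:(by apply/measurable_EFinP; exact: measurable_indic)
  ltac:(apply: aeW => w _; apply: cvg_near_cst; have := D_eventually w; apply: filterS => n NDZ;
    congr (_%:E); rewrite !indicE; congr (_%:R); congr nat_of_bool;
    by apply/idP/idP; rewrite !inE /A_ /= NDZ)
  int1
  ltac:(by apply: aeW => w n _; rewrite /= lee_fin indicE ger0_norm// lern1; case: (_ \in _)).
have [_ _ cvD] := @dominated_convergence _ _ _ P setT measurableT
  (fun n w => (poisson_mass (D n w) x)%:E) (fun w => (poisson_mass (Z w) x)%:E)
  (EFin \o cst (1 : R)) measurable_mass mpZ
  ltac:(apply: aeW => w _; apply: cvg_EFin; [exact: nearW|];
    apply: (cvg_comp (fun n => D n w) ((@poisson_mass R)^~ x)); [exact: cvg_D|exact: continuous_poisson_mass])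
  int1
  ltac:(apply: aeW => w n _; rewrite /= lee_fin ger0_norm ?poisson_mass_ge0 ?grid_ge0//;
    by apply: poisson_mass_le1; exact: grid_ge0).
move: cvA; rewrite (_ : [sequence _]_n = fun n => \int[P]_w (poisson_mass (D n w) x)%:E)%E; last first.
  by apply/funext => n; exact: step_prob.
move=> /cvg_unique/(_ cvD) <-//.
by rewrite integral_indic// setIT.
Qed.

End level.
End random_time.

(** * Marginals of the time-changed process *)

Section all_times.
Context (R : realType).
Local Notation mu := (@lebesgue_measure R).
Variable lambda : R -> R.
Hypotheses (lambda_ge0 : forall u : R, 0 <= u -> 0 <= lambda u)
  (lambda_int : forall t : R, 0 <= t -> mu.-integrable `[0, t] (EFin \o lambda)).

Lemma measurable_cumulative_intensityT :
  measurable_fun setT (cumulative_intensity lambda : measurableTypeR R -> measurableTypeR R).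
Proof.
have m1 : measurable (`]-oo, 0]%classic : set (measurableTypeR R)) by exact: measurable_itv.
have m2 : measurable (`]0, +oo[%classic : set (measurableTypeR R)) by exact: measurable_itv.
have -> : [set: measurableTypeR R] = `]-oo, 0]%classic `|` `]0, +oo[%classic.
  apply/seteqP; split => // x _ /=; rewrite !in_itv/= andbT.
  by have [x0|x0] := leP x 0; [left|right].
apply/measurable_funU => //; split; last exact: measurable_cumulative_intensity_pos.
apply: (@eq_measurable_fun _ _ _ _ _ (cst (0 : R))) => // u.
rewrite inE/= in_itv/= le_eqVlt => /predU1P[->|u0]; first by rewrite cumulative_intensity0.
rewrite /cumulative_intensity (_ : [set` _] = set0) ?Rintegral_set0//.
by rewrite set_itv_ge// bnd_simp -ltNge.
Qed.

End all_times.

Section fractional_poisson.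
Context (R : realType) d (T : measurableType d) (P : probability T R).
Local Notation mu := (@lebesgue_measure R).
Local Notation pos := (`]0%R, +oo[%classic : set (measurableTypeR R)).
Variables (alpha : R) (lambda : R -> R) (N1 : R -> {RV P >-> nat})
  (L : R -> {RV P >-> R}) (g rho : R -> R) (C : R).
Hypotheses (alpha_gt0 : 0 < alpha) (alpha_lt1 : alpha < 1)
  (lambda_ge0 : forall u : R, 0 <= u -> 0 <= lambda u)
  (lambda_int : forall t : R, 0 <= t -> mu.-integrable `[0, t] (EFin \o lambda))
  (N1_poisson : poisson_process 1 N1)
  (L_stable : stable_subordinator alpha L)
  (g_density : is_density (L 1) g).
Local Notation Lambda := (cumulative_intensity lambda).
Local Notation Y := (first_passage (fun t w => L t w)).
Local Notation h := (inverse_stable_density alpha g).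
Hypothesis indep : independent_processes P (fun t w => N1 t w) Y.
Hypotheses (mrho : measurable_fun setT rho) (rho_ge0 : forall x, 0 <= rho x)
  (crho : forall x : R, 0 < x -> {for x, continuous rho})
  (g_rho : {ae mu, forall x : R, 0 < x -> g x = rho x})
  (rho_le : forall x : R, 0 < x -> x * rho x <= C /\ x `^ (1 + alpha) * rho x <= C)
  (rho_conv : {ae mu, forall x : R, 0 < x ->
    (x * rho x)%:E = ((alpha / Gamma (1 - alpha))%:E * power_conv rho (1 - alpha) x)%E}).

Let mg : measurable_fun setT g. Proof. by have [] := g_density. Qed.
Let g_ge0 x : 0 <= g x. Proof. by have [_ + _] := g_density; exact. Qed.
Let mpos : measurable pos. Proof. exact: measurable_itv. Qed.

Let rho_total : (\int[mu]_(x in pos) (rho x)%:E = 1)%E.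
Proof.
rewrite -(stable_density_total L_stable g_density).
apply: ge0_ae_eq_integral => //.
- by apply: (@measurable_funTS _ _ (measurableTypeR R)); exact/measurable_EFinP.
- by apply: (@measurable_funTS _ _ (measurableTypeR R)); exact/measurable_EFinP.
- by move=> y _; rewrite lee_fin.
- by move=> y _; rewrite lee_fin.
- apply: (@filterS _ _ (ae_filter_ringOfSetsType mu) _ _ _ g_rho) => y /= H.
  by rewrite in_itv/= andbT => /H ->.
Qed.

Let rho_int : mu.-integrable pos (EFin \o rho).
Proof.
apply/integrableP; split.
  by apply: (@measurable_funTS _ _ (measurableTypeR R)); exact/measurable_EFinP.
under eq_integral do rewrite gee0_abs ?lee_fin//.
by rewrite rho_total ltry.
Qed.

Let rho1 : \int[mu]_(x in pos) rho x = 1.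
Proof. by rewrite /Rintegral rho_total. Qed.

Let h_ge0 t v : 0 < t -> 0 < v -> 0 <= h t v.
Proof.
by move=> t0 v0; rewrite /inverse_stable_density mulr_ge0// divr_ge0 ?(ltW t0)// mulr_ge0 ?powR_ge0// ltW.
Qed.

Let mh t : measurable_fun setT (h t). Proof. exact: measurable_inverse_density. Qed.

Let h_total t : 0 < t -> (\int[mu]_(u in pos) (h t u)%:E = 1)%E.
Proof. exact: (@integral_inverse_density _ _ _ rho). Qed.

Let h_tail t v : 0 < t -> 0 < v ->
  (\int[mu]_(u in `]v, +oo[) (h t u)%:E)%E = stable_cdf g (t * v `^ (- alpha^-1)).
Proof.
move=> t0 v0; rewrite (@tail_inverse_density _ _ _ rho)// /stable_cdf.
by rewrite (@cdfE _ g rho).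
Qed.

Let Z t w := Lambda (Y t w).

Let mZ t : measurable_fun setT (Z t : T -> measurableTypeR R).
Proof.
apply: (measurableT_comp (f := Lambda : measurableTypeR R -> measurableTypeR R)).
  exact: measurable_cumulative_intensityT.
exact: (measurable_first_passage L_stable).
Qed.

Let Z_ge0 t w : 0 <= Z t w. Proof. exact: cumulative_intensity_ge0. Qed.

Let Z_indep t s x (B : set (measurableTypeR R)) : 0 <= t -> 0 <= s -> measurable B ->
  P ([set w | N1 s w = x] `&` Z t @^-1` B) = (P [set w | N1 s w = x] * P (Z t @^-1` B))%E.
Proof.
move=> t0 s0 mB; apply: indep; apply: sub_sigma_algebra.
  exists s; first by rewrite /= in_itv/= s0.
  by exists [set x] => //; rewrite setTI.
exists t; first by rewrite /= in_itv/= t0.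
exists (Lambda @^-1` B); last by rewrite setTI.
rewrite -[_ @^-1` _]setTI; exact: (measurable_cumulative_intensityT lambda_int measurableT mB).
Qed.

Lemma measurable_time_changed t x : 0 <= t -> measurable [set w | N1 (Z t w) w = x].
Proof.
by move=> t0; exact: measurable_count_at_time.
Qed.

Lemma time_changed_prob t x : 0 < t ->
  (P [set w | N1 (Z t w) w = x] = \int[mu]_(u in pos) (poisson_mass (Lambda u) x * h t u)%:E)%E.
Proof.
move=> t0; rewrite integral_poisson_mass_at_time//; last by move=> *; apply: Z_indep => //; exact: ltW.
have mk : measurable_fun setT (fun u : measurableTypeR R => (poisson_mass (Lambda u) x)%:E).
  apply/measurable_EFinP; apply: (measurableT_comp (f := (@poisson_mass R)^~ x)).
    exact: continuous_measurable_fun (@continuous_poisson_mass R x).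
  exact: measurable_cumulative_intensityT.
rewrite (ge0_integral_first_passage alpha_gt0 L_stable g_density t0 (mh t) _ (h_total t0) _ mk).
- by apply: eq_integral => u _; rewrite muleC -EFinM.
- by move=> v v0; exact: h_ge0.
- by move=> v v0; exact: h_tail.
- by move=> u; rewrite lee_fin poisson_mass_ge0// cumulative_intensity_ge0.
Qed.

Local Notation J q := (mixed_cdf alpha rho q).

Lemma poisson_cdf_average t k : 0 < t ->
  (\int[mu]_(u in pos) (poisson_cdf k (Lambda u) * h t u)%:E = (1 - J (jump_rate lambda k) t)%:E)%E.
Proof.
move=> t0; have jint := integrable_jump_rate lambda_ge0 lambda_int k.
have := @integral_poisson_cdf_mixture _ lambda (h t) lambda_ge0 lambda_int
  (measurable_funTS (mh t)) (fun u u0 => h_ge0 t0 u0) (h_total t0) k.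
rewrite [X in (_ + X)%E](_ : _ = (J (jump_rate lambda k) t)%:E).
  move=> E; rewrite EFinB -E addeK//.
rewrite /mixed_cdf /Rintegral fineK; last first.
  apply: integrable_fin_num => //; exact: (@integrable_mixed_cdf _ alpha rho mrho rho_ge0 crho rho_int rho1 _ jint t t0).
apply: eq_integral => v; rewrite inE/= in_itv/= andbT => v0.
by rewrite (@tail_inverse_density _ _ _ rho).
Qed.

(** This is [lambda * p_(x-1)], with [p_(-1) = 0]. *)
Definition entry_rate (x : nat) : R -> R :=
  if x is k.+1 then jump_rate lambda k else cst 0.

Let entry_rate_ge0 x v : 0 <= v -> 0 <= entry_rate x v.
Proof. by case: x => [//|k] v0; exact: jump_rate_ge0. Qed.

Let integrable_entry_rate x : mu.-integrable pos (EFin \o entry_rate x).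
Proof. by case: x => [|k]; [exact: integrable0|exact: integrable_jump_rate]. Qed.

Lemma mixed_cdf0 t : J (cst 0) t = 0.
Proof.
rewrite /mixed_cdf /Rintegral integral0_eq// => v _.
by rewrite mul0r.
Qed.

(** The mass at x is the difference of the distribution functions at x and x - 1. *)
Lemma marginal_mixed_cdf t x : 0 < t ->
  (\int[mu]_(u in pos) (poisson_mass (Lambda u) x * h t u)%:E)%E =
  ((x == 0)%:R + (J (entry_rate x) t - J (jump_rate lambda x) t))%:E.
Proof.
move=> t0; case: x => [|k].
  under eq_integral do rewrite -poisson_cdf0.
  by rewrite poisson_cdf_average// mixed_cdf0 sub0r.
rewrite add0r /=.
have mP (F : R -> R) : measurable_fun setT (F : measurableTypeR R -> R) ->
    measurable_fun pos (fun u => (F (Lambda u) * h t u)%:E).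
  move=> mF; apply: (@measurable_funTS _ _ (measurableTypeR R)); apply/measurable_EFinP.
  apply: measurable_funM; last exact: mh.
  have mL : measurable_fun setT (Lambda : measurableTypeR R -> measurableTypeR R).
    exact: measurable_cumulative_intensityT.
  exact: (measurableT_comp mF mL).
have := poisson_cdf_average k.+1 t0.
under eq_integral do rewrite poisson_cdfS mulrDl EFinD.
rewrite ge0_integralD//; last 4 first.
- move=> u; rewrite /= in_itv/= andbT => u0.
  by rewrite lee_fin mulr_ge0 ?h_ge0// poisson_cdf_ge0// cumulative_intensity_ge0.
- apply: (mP (poisson_cdf k)); apply: continuous_measurable_fun => m.
  apply: differentiable_continuous.
  by apply/derivable1_diffP; have [] := is_derive_poisson_cdf k m.
- move=> u; rewrite /= in_itv/= andbT => u0.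
  by rewrite lee_fin mulr_ge0 ?h_ge0// poisson_mass_ge0// cumulative_intensity_ge0.
- apply: (mP ((@poisson_mass R)^~ k.+1)).
  exact: continuous_measurable_fun (@continuous_poisson_mass R k.+1).
rewrite poisson_cdf_average// => E.
have := congr1 (fun e => e - (1 - J (jump_rate lambda k) t)%:E)%E E.
rewrite addeC addeK// => ->; rewrite -EFinB; congr (_%:E); ring.
Qed.

Let jump_rate_pos x v : 0 < v -> 0 <= jump_rate lambda x v.
Proof. by move=> v0; apply: jump_rate_ge0 => //; exact: ltW. Qed.

Let entry_rate_pos x v : 0 < v -> 0 <= entry_rate x v.
Proof. by move=> v0; apply: entry_rate_ge0; exact: ltW. Qed.

(** The derivative of J_q is nonnegative, so that integrability follows from the finite value of
    the fractional integral. *)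
Lemma caputo_mixed_cdf q t : (forall v, 0 < v -> 0 <= q v) ->
    mu.-integrable pos (EFin \o q) -> 0 < t ->
  mu.-integrable `]0, t[ (EFin \o caputo_integrand alpha (J q) t) /\
  \int[mu]_(tau in `]0, t[) caputo_integrand alpha (J q) t tau =
    Gamma (1 - alpha) * \int[mu]_(v in pos) (q v * h t v).
Proof.
move=> q0 qint t0.
have [mF intF] := @frac_integral_mixed_cdf _ alpha g rho C alpha_gt0 alpha_lt1 mg g_ge0
  mrho rho_ge0 crho g_rho rho_le rho_conv rho_int rho1 q q0 qint t t0.
have qh : mu.-integrable pos (EFin \o (fun v => q v * h t v)).
  exact: (@integrable_inverse_density _ alpha g rho C).
have F0 (tau : R) : 0 < tau -> 0 <= caputo_integrand alpha (J q) t tau.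
  move=> tau0; rewrite /caputo_integrand divr_ge0 ?powR_ge0// derive1E.
  have D := @is_derive_mixed_cdf _ alpha rho C mrho rho_ge0 crho rho_le rho_int rho1 q q0 qint tau tau0.
  rewrite (derive_val (is_derive := D)); apply: Rintegral_ge0 => v.
  by rewrite /= in_itv/= andbT => v0; rewrite mulr_ge0 ?q0// mulr_ge0// powR_ge0.
have qh_fin := integrable_fin_num mpos qh.
split; last by rewrite /Rintegral -[in RHS](fineK qh_fin) [in LHS]intF fineM.
apply/integrableP; split; first exact: mF.
apply: (@le_lt_trans _ _ (\int[mu]_(tau in `]0%R, t[) (caputo_integrand alpha (J q) t tau)%:E)%E).
  rewrite le_eqVlt; apply/orP; left; apply/eqP; apply: eq_integral => tau.
  by rewrite inE/= in_itv/= => /andP[tau0 _]; rewrite ger0_norm ?F0.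
by rewrite [X in (X < _)%E]intF -(fineK qh_fin) -EFinM ltry.
Qed.

Section closed_form.
Variables (f : R -> R) (x : nat).
Hypothesis fE : forall t, 0 < t ->
  f t = (x == 0)%:R + (J (entry_rate x) t - J (jump_rate lambda x) t).

Let is_derive_J q (t : R) : (forall v, 0 < v -> 0 <= q v) ->
  mu.-integrable pos (EFin \o q) -> 0 < t -> derivable (J q) t 1.
Proof.
move=> q0 qint t0.
by have [] := @is_derive_mixed_cdf _ alpha rho C mrho rho_ge0 crho rho_le rho_int rho1 q q0 qint t t0.
Qed.

Let derivable_f (t : R) : 0 < t ->
  derivable f t 1 /\
  derive1 f t = derive1 (J (entry_rate x)) t - derive1 (J (jump_rate lambda x)) t.
Proof.
move=> t0.
have d1 := is_derive_J (entry_rate_pos x) (integrable_entry_rate x) t0.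
have d2 := is_derive_J (jump_rate_pos x) (integrable_jump_rate lambda_ge0 lambda_int x) t0.
have near_f : \near t, ((cst (x == 0)%:R : R -> R) + (J (entry_rate x) - J (jump_rate lambda x))) t = f t.
  near=> s; rewrite fE//; near: s; exact: lt_nbhsr.
have D : is_derive t 1 ((cst (x == 0)%:R : R -> R) + (J (entry_rate x) - J (jump_rate lambda x)))
    (0 + (derive1 (J (entry_rate x)) t - derive1 (J (jump_rate lambda x)) t)).
  by rewrite !derive1E; apply: is_deriveD; apply: is_deriveB; apply: DeriveDef.
have [df fv] := near_eq_is_derive near_f D.
by split => //; rewrite derive1E fv add0r.
Unshelve. all: by end_near. Qed.

(** The Caputo derivative only involves f on ]0, t[, where the closed form holds; there f is, up to
    a constant, a difference of two functions J_q. *)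
Lemma caputo_closed_form t : 0 < t ->
  [/\ caputo_derivable alpha f t,
      mu.-integrable pos (EFin \o (fun v => (entry_rate x v - jump_rate lambda x v) * h t v)) &
      caputo alpha f t = \int[mu]_(v in pos) ((entry_rate x v - jump_rate lambda x v) * h t v)].
Proof.
move=> t0; have mt : measurable (`]0, t[%classic : set (measurableTypeR R)) by exact: measurable_itv.
have [i1 I1] := caputo_mixed_cdf (entry_rate_pos x) (integrable_entry_rate x) t0.
have [i2 I2] := caputo_mixed_cdf (jump_rate_pos x) (integrable_jump_rate lambda_ge0 lambda_int x) t0.
have cE : {in `]0, t[%classic, caputo_integrand alpha f t =1
    (fun tau => caputo_integrand alpha (J (entry_rate x)) t tau -
                caputo_integrand alpha (J (jump_rate lambda x)) t tau)}.
  move=> tau; rewrite inE/= in_itv/= => /andP[tau0 _]; rewrite /caputo_integrand.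
  by have [_ ->] := derivable_f tau0; rewrite mulrBl.
have h1 : mu.-integrable pos (EFin \o (fun v => entry_rate x v * h t v)).
  exact: (@integrable_inverse_density _ alpha g rho C).
have h2 : mu.-integrable pos (EFin \o (fun v => jump_rate lambda x v * h t v)).
  apply: (@integrable_inverse_density _ alpha g rho C) => //; exact: integrable_jump_rate.
have G0 : Gamma (1 - alpha) != 0.
  by apply: lt0r_neq0; apply: Gamma_gt0; rewrite subr_gt0.
split.
- split; first by move=> tau tau0 _; have [] := derivable_f tau0.
  apply: (eq_integrable mt) (integrableB mt i1 i2) => tau tauI.
  by rewrite /= cE.
- apply: (eq_integrable mpos) (integrableB mpos h1 h2) => v _.
  by rewrite /= mulrBl.
rewrite /caputo (eq_Rintegral mu cE) RintegralB// I1 I2 -mulrBr mulKf// -RintegralB//.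
by apply: eq_Rintegral => v _; rewrite mulrBl.
Qed.

End closed_form.

(** P(Y(0) > v) = P(L(v) <= 0) = 0 for every v > 0. *)
Lemma first_passage0_ae : {ae P, forall w, Y 0 w = 0}.
Proof.
have mB n : measurable [set w | n.+1%:R^-1 < Y 0 w].
  rewrite (_ : [set w | _] = setT `&` Y 0 @^-1` `]n.+1%:R^-1, +oo[%classic).
    exact: (measurable_first_passage L_stable 0 measurableT (measurable_itv _)).
  by rewrite setTI; apply/seteqP; split => w; rewrite /preimage /= in_itv/= andbT.
exists (\bigcup_n [set w | n.+1%:R^-1 < Y 0 w]); split.
- exact: bigcupT_measurable.
- apply/negligibleP; first exact: bigcupT_measurable.
  apply: negligible_bigcup => n; apply/negligibleP => //.
  exact: (first_passage0 alpha_gt0 L_stable g_density).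
- move=> w /= Yw; have Y0 : 0 < Y 0 w.
    by rewrite lt_neqAle first_passage_ge0 andbT eq_sym; exact/eqP.
  exists (Num.trunc (Y 0 w)^-1) => //=.
  by rewrite -[ltRHS]invrK ltf_pV2 ?posrE ?invr_gt0// truncnS_gt.
Qed.

Lemma time_changed0 x : P [set w | N1 (Z 0 w) w = x] = ((x == 0)%:R)%:E.
Proof.
have [N10 _ _ _] := N1_poisson.
have [M [mM M0 MP]] := @filterI _ _ (ae_filter_ringOfSetsType P) _ _ N10 first_passage0_ae.
pose B : set T := if x == 0 then setT else set0.
have -> : P [set w | N1 (Z 0 w) w = x] = P B.
  apply: (measure_eq_off_null _ _ mM M0) => [||w Mw]; first exact: measurable_time_changed.
    by rewrite /B; case: ifP.
  have [N0 Y0] : N1 0 w = 0 /\ Y 0 w = 0 by apply: contrapT => H; apply: Mw; exact: MP.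
  rewrite /Z /= Y0 cumulative_intensity0 N0 /B.
  by split => [<-|]; [rewrite eqxx|case: eqP].
by rewrite /B; case: ifP => _; [exact: probability_setT|exact: measure0].
Qed.

End fractional_poisson.

Theorem corollary1 (R : realType) (d : measure_display) (T : measurableType d)
    (P : probability T R) (alpha : R) (lambda : R -> R)
    (N1 : R -> {RV P >-> nat}) (L : R -> {RV P >-> R}) (g : R -> R)
    (alpha_gt0 : 0 < alpha) (alpha_lt1 : alpha < 1)
    (lambda_ge0 : forall u : R, 0 <= u -> 0 <= lambda u)
    (lambda_int : forall t : R, 0 <= t ->
       lebesgue_measure.-integrable `[0, t] (EFin \o lambda))
    (N1_poisson : poisson_process 1 N1)
    (L_stable : stable_subordinator alpha L)
    (g_density : is_density (L 1) g) :
  let Lambda := cumulative_intensity lambda in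
  let Y := first_passage (fun t w => L t w) in
  let p := poisson_at Lambda in
  let h := inverse_stable_density alpha g in
  let Nalpha := time_changed (fun t w => N1 t w) Lambda Y in
  let f := marginal P Nalpha in
  independent_processes P (fun t w => N1 t w) Y ->
  [/\
      forall t : R, 0 <= t -> measurable_fun setT (Nalpha t),
      forall (x : nat) (t : R), 0 < t ->
        (f x%:Z t)%:E =
        (\int[lebesgue_measure]_(u in `]0%R, +oo[) (p x%:Z u * h t u)%:E)%E,
      forall (x : nat) (t : R), 0 < t ->
        [/\ caputo_derivable alpha (f x%:Z) t,
            lebesgue_measure.-integrable `]0, +oo[
              (EFin \o (fun u =>
                 lambda u * (- p x%:Z u + p (x%:Z - 1) u) * h t u)) &
            caputo alpha (f x%:Z) t =
            \int[lebesgue_measure]_(u in `]0, +oo[)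
              (lambda u * (- p x%:Z u + p (x%:Z - 1) u) * h t u)],
      forall x : nat, f x%:Z 0 = if x == 0%N then 1 else 0 &
      forall t : R, 0 <= t -> f (-1) t = 0].
Proof.
move=> Lambda Y p h Nalpha f indep.
have mg : measurable_fun setT g by have [] := g_density.
have g_ge0 x : 0 <= g x by have [_ + _] := g_density; exact.
have [rho [[mrho rho_ge0 crho g_rho] [[C rho_le] rho_conv]]] :=
  stable_density_regular alpha_gt0 alpha_lt1 mg g_ge0
    (stable_density_integrable L_stable g_density)
    (stable_density_laplace_real L_stable g_density).
have levelE x t : [set w | (Nalpha t w)%:Z = x%:Z] = [set w | N1 (Lambda (Y t w)) w = x].
  by apply/seteqP; split => w /=; [case|move=> <-].
have prob := time_changed_prob alpha_gt0 lambda_ge0 lambda_int N1_poisson L_stable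
  g_density indep mrho rho_ge0 g_rho.
have closed (x : nat) t : 0 < t -> f x%:Z t = (x == 0%N)%:R +
    (mixed_cdf alpha rho (entry_rate lambda x) t - mixed_cdf alpha rho (jump_rate lambda x) t).
  move=> t0; rewrite /f /marginal levelE prob//.
  by rewrite (marginal_mixed_cdf alpha_gt0 lambda_ge0 lambda_int L_stable g_density
    mrho rho_ge0 crho g_rho).
have rateE (x : nat) u : lambda u * (- p x%:Z u + p (x%:Z - 1) u) =
    entry_rate lambda x u - jump_rate lambda x u.
  rewrite /p /jump_rate; case: x => [|k]; first by rewrite /= /jump_rate addr0 mulrN sub0r.
  by rewrite -[k.+1%:Z]/(k.+1%:Z) intS addrAC subrr add0r /= /jump_rate mulrDr mulrN addrC.
split.
- move=> t t0 _ B _; rewrite setTI.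
  rewrite (_ : _ @^-1` _ = \bigcup_(x in B) [set w | N1 (Lambda (Y t w)) w = x]).
    apply: bigcup_measurable => x _.
    exact: (measurable_time_changed lambda_ge0 lambda_int N1_poisson L_stable).
  apply/seteqP; split => w; [by move=> Bw; exists (Nalpha t w)|move=> [x Bx NE]].
  by move: Bx; rewrite -(NE : N1 (Lambda (Y t w)) w = x).
- move=> x t t0; rewrite /f /marginal levelE -prob// fineK//.
  exact: fin_num_measure (measurable_time_changed lambda_ge0 lambda_int N1_poisson L_stable _ (ltW t0)).
- move=> x t t0.
  have [H1 H2 H3] := caputo_closed_form alpha_gt0 alpha_lt1 lambda_ge0 lambda_int
    L_stable g_density mrho rho_ge0 crho g_rho rho_le rho_conv (closed x) t0.
  rewrite (_ : (fun u => _) = (fun v => (entry_rate lambda x v - jump_rate lambda x v) *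
    inverse_stable_density alpha g t v))//.
  by apply/funext => u; rewrite rateE.
- move=> x; rewrite /f /marginal levelE.
  rewrite (time_changed0 alpha_gt0 lambda_ge0 lambda_int N1_poisson L_stable g_density).
  by case: eqP.
- move=> t t0; rewrite /f /marginal (_ : [set w | _] = set0) ?measure0//.
  by rewrite -subset0 => w.
Qed.
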